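(* Let $\Omega\subset\mathbb R^d$ be a bounded connected open set satisfying Assumption 1 (stated in the context), and suppose that $\gamma=\max_{i\in I_c}(\alpha_i-1)d_i'$ satisfies $0<\gamma<2$. Let $\rho$ be a measurable function on $\overline\Omega$ with $m\le\rho(x)\le M$ for all $x\in\Omega$, for some constants $m,M>0$, and $\int_\Omega\rho\,dx=1$; write $\mu_\rho=\rho(x)dx$. Let $t_{h,\rho}(x,dy)$ be the Metropolis kernel, $t^n_{h,\rho}(x,dy)$ its $n$-th iterate, $T_h$ the associated operator on $L^2(\Omega,\rho(x)dx)$ and $g(h)=\operatorname{dist}(1,\sigma(T_h)\setminus\{1\})$ its spectral gap. Then there exist $C,h_0>0$ such that for all $h\in]0,h_0]$ and all $n\in\mathbb N$, $$\sup_{x\in\Omega}\|t^n_{h,\rho}(x,dy)-\mu_\rho\|_{TV}\le C\,h^{-\gamma-\frac d2}\,e^{-n\,g(h)(1+O(h^{2-\gamma}))},$$ where $O(h^{2-\gamma})$ denotes a quantity bounded in absolute value by $Ch^{2-\gamma}$ for all $h\in]0,h_0]$, uniformly in $n$.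
   Context: Metropolis kernel and operator. For $h\in]0,1]$ let $k_{h,\rho}(x,y)=h^{-d}\phi\big(\frac{x-y}{h}\big)\min\big(\frac{\rho(y)}{\rho(x)},1\big)$, where $\phi=\frac1{\mathscr V_d}\mathbf 1_{B(0,1)}$, $B(0,1)$ is the open unit ball of $\mathbb R^d$ and $\mathscr V_d$ its volume. Let $m_{h,\rho}(x)=1-\int_\Omega k_{h,\rho}(x,y)\,dy$, $$t_{h,\rho}(x,dy)=m_{h,\rho}(x)\delta_{y=x}+k_{h,\rho}(x,y)dy,\qquad T_hu(x)=m_{h,\rho}(x)u(x)+\int_\Omega k_{h,\rho}(x,y)u(y)\,dy .$$ $T_h$ is a Markov operator, self-adjoint on $L^2(\Omega,\rho(x)dx)$. Total variation distance between probability measures: $\|\mu-\nu\|_{TV}=\sup_A|\mu(A)-\nu(A)|$, supremum over Borel sets $A$. Assumption 1. There is a finite collection of open subsets $(\omega_i)_{i\in I_r\cup I_c}$ of $\mathbb R^d$ with $\partial\Omega\subset\bigcup_{i\in I_r\cup I_c}\omega_i$ such that: (i) for all $i\in I_r$, $\partial\Omega\cap\omega_i$ has Lipschitz regularity; (ii) for all $i\in I_c$ there exist a closed submanifold $S_i$ of $\mathbb R^d$ of dimension $d_i''\ge0$, and $\alpha_i>1$, $r_i>0$, $\epsilon_i>0$ such that, with $d=1+d_i'+d_i''$ and $d_i'\ge1$, near every point $p\in S_i$ there is a smooth coordinate system $(x_1,x',x'')\in\mathbb R\times\mathbb R^{d_i'}\times\mathbb R^{d_i''}$ in which $p=(0,0,0)$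 and $\Omega\cap\omega_i$ is given by $$\{(x_1,x',x''):\ 0<x_1<\epsilon_i,\ |x'|<x_1^{\alpha_i},\ |x''|<r_i\}.$$ (Precisely: $\omega_i$ is the union over $p\in S_i$ of open neighbourhoods $V_p$ of $p$ on which such a coordinate system is defined and in which $\Omega\cap V_p$ is the displayed set.) Here $|\cdot|$ is the Euclidean norm. *)

(* Defs.v *)
From HB Require Import structures.
From mathcomp Require Import all_boot all_order all_algebra.
From mathcomp Require Import all_classical all_reals all_analysis.
From mathcomp Require Import measurable_realfun.

Set Implicit Arguments.
Unset Strict Implicit.
Unset Printing Implicit Defensive.

Import Order.TTheory GRing.Theory Num.Theory.
Import numFieldNormedType.Exports.

Local Open Scope classical_set_scope.
Local Open Scope ring_scope.

(* The Borel sigma-algebra of R^n. The library norm on 'rV[R]_n is the sup    *)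
(* norm; the topology is the usual one.                                       *)

HB.instance Definition _ (R : realType) (n : nat) :=
  @isMeasurable.Build (sigma_display (@open 'rV[R]_n)) 'rV[R]_n
    <<s @open 'rV[R]_n >> (@sigma_algebra0 _ setT _)
    (@sigma_algebraC _ _) (@sigma_algebra_bigcup _ setT _).

Section lebesgue_rV.
Context {R : realType}.

Definition consv n (xv : measurableTypeR R * 'rV[R]_n) : 'rV[R]_n.+1 :=
  \row_i oapp (fun j => xv.2 0 j) xv.1 (unlift ord0 i).

Definition unconsv n (v : 'rV[R]_n.+1) : measurableTypeR R * 'rV[R]_n :=
  (v 0 0, \row_j v 0 (lift ord0 j)).

Lemma consvK n : cancel (@consv n) (@unconsv n).
Proof.
move=> [x v]; rewrite /unconsv /consv/= !mxE/= unlift_none/=; congr pair.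
by apply/rowP => j; rewrite !mxE liftK.
Qed.

Lemma open_rV_measurable n (U : set 'rV[R]_n) : open U -> measurable U.
Proof. by move=> oU; exact: sub_gen_smallest. Qed.

Lemma measurable_coordv n (i : 'I_n) :
  measurable_fun [set: 'rV[R]_n] (fun v => v 0 i).
Proof.
apply: (measurability _ (RGenOpens.measurableE R)) => // _ [_ [a [b ->]] <-].
rewrite setTI; apply: open_rV_measurable; apply: open_comp.
  by move=> v _; exact: coord_continuous.
exact: interval_open.
Qed.

Lemma measurable_unconsv n : measurable_fun setT (@unconsv n).
Proof.
apply/measurable_fun_pairP; split => /=; first exact: measurable_coordv.
apply: (@measurability _ _ _ _ setT _ (@open 'rV[R]_n)) => // _ [U oU <-].
rewrite setTI; apply: open_rV_measurable; apply: open_comp => // v _.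
move=> /= B /nbhs_ballP[e e0 eB]; apply/nbhs_ballP; exists e => // w [_ vw].
by apply: eB; split => // i j; rewrite !mxE; exact: vw.
Qed.

Lemma ball_consv n (c y : 'rV[R]_n.+1) (e : R) :
  ball c e y <-> ball (c 0 0) e (y 0 0) /\
    ball (\row_j c 0 (lift ord0 j)) e (\row_j y 0 (lift ord0 j)).
Proof.
split=> [[e0 cy]|[cy0 [e0 cy]]].
  split; first exact: cy.
  by split => // i j; rewrite !mxE; exact: cy.
split => // i j; rewrite ord1; case: (unliftP ord0 j) => [k|] -> //.
by have := cy 0 k; rewrite !mxE.
Qed.

Lemma ball_rV_measurable n (c : 'rV[R]_n) (e : R) : measurable (ball c e).
Proof.
have [e0|e0] := ltP 0 e.
  by apply: open_rV_measurable; exact: ball_open.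
rewrite (_ : ball c e = set0)//; apply/seteqP; split => // y [].
by rewrite ltNge e0.
Qed.

Lemma open_rV_bigcup_ball n (U : set 'rV[R]_n) : open U ->
  U = \bigcup_(cr in [set cr : 'rV[rat]_n * rat |
      ball (map_mx ratr cr.1 : 'rV[R]_n) (ratr cr.2) `<=` U])
    ball (map_mx ratr cr.1 : 'rV[R]_n) (ratr cr.2).
Proof.
move=> oU; apply/seteqP; split => [x Ux|x [] cr /= + xcr]; last exact.
have /nbhs_ballP[e e0 eU] : nbhs x U by exact: open_nbhs_nbhs.
have e20 : 0 < e / 2 by rewrite divr_gt0.
have /rat_in_itvoo[r] : 0 < e / 2 by [].
rewrite in_itv/= => /andP[r0 re].
have qP i : exists q : rat, ball (x 0 i) (ratr r) (ratr q).
  have /rat_in_itvoo[q] : x 0 i - ratr r < x 0 i + ratr r.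
    by rewrite ltrD2l gtrN.
  rewrite in_itv/= => /andP[q1 q2]; exists q; rewrite /ball/= ltr_distlC.
  by rewrite q1.
have [f fP] := choice qP.
have xf : ball x (ratr r) (map_mx ratr (\row_i f i)).
  by split => // i j; rewrite ord1 !mxE; exact: fP.
exists (\row_i f i, r) => /=; last exact: ball_sym.
move=> y fy; apply: eU; apply: (@le_ball _ _ _ (ratr r + ratr r)).
  by rewrite (splitr e) lerD// ltW.
exact: ball_triangle fy.
Qed.

Lemma measurable_consv n : measurable_fun setT (@consv n).
Proof.
apply: (@measurability _ _ _ _ setT _ (@open 'rV[R]_n.+1)) => // _ [U oU <-].
rewrite setTI (open_rV_bigcup_ball oU) preimage_bigcup bigcup_mkcond.
apply: countable_bigcupT_measurable => [|cr]; first exact: countableP.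
case: ifPn => // _.
set c : 'rV[R]_n.+1 := map_mx _ _.
rewrite (_ : _ @^-1` _ = ball (c 0 0) (ratr cr.2) `*`
    ball (\row_j c 0 (lift ord0 j)) (ratr cr.2)).
  apply: measurableX; last exact: ball_rV_measurable.
  exact: measurable_ball.
have cE (z : measurableTypeR R * 'rV[R]_n) : (consv z) 0 0 = z.1
  by rewrite mxE unlift_none.
have cE' (z : measurableTypeR R * 'rV[R]_n) :
    \row_j (consv z) 0 (lift ord0 j) = z.2.
  by apply/rowP => j; rewrite !mxE liftK.
apply/seteqP; split => z /=; first by move/ball_consv; rewrite cE cE'.
by move=> [z1 z2]; apply/ball_consv; rewrite cE cE'.
Qed.

HB.instance Definition _ n := isMeasurableFun.Build _ _ _ _ (@consv n)
  (@measurable_consv n).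

Section lebesgue_step.
Variables (n : nat) (mu : {sigma_finite_measure set 'rV[R]_n -> \bar R}).

Definition lebesgue_step : set 'rV[R]_n.+1 -> \bar R :=
  pushforward (lebesgue_measure \x mu)%E (@consv n).

Let lebesgue_step0 : lebesgue_step set0 = 0%E.
Proof. by rewrite /lebesgue_step; exact: measure0. Qed.

Let lebesgue_step_ge0 A : (0 <= lebesgue_step A)%E.
Proof. by rewrite /lebesgue_step; exact: measure_ge0. Qed.

Let lebesgue_step_sigma_additive : semi_sigma_additive lebesgue_step.
Proof. by rewrite /lebesgue_step; exact: measure_semi_sigma_additive. Qed.

HB.instance Definition _ := isMeasure.Build _ _ _ lebesgue_step
  lebesgue_step0 lebesgue_step_ge0 lebesgue_step_sigma_additive.

Let lebesgue_step_sigma_finite : sigma_finite setT lebesgue_step.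
Proof.
have /sigma_finiteP[F [FT ndF Foo]] :=
  sigma_finiteT (lebesgue_measure :
    {sigma_finite_measure set (measurableTypeR R) -> \bar R}).
have /sigma_finiteP[G [GT ndG Goo]] := sigma_finiteT mu.
exists (fun k => @unconsv n @^-1` (F k `*` G k)).
  rewrite -preimage_bigcup (_ : \bigcup_k _ = setT) ?preimage_setT//.
  apply/seteqP; split => // -[x y] _.
  have [i _ Fx] : (\bigcup_k F k) x by rewrite -FT.
  have [j _ Gy] : (\bigcup_k G k) y by rewrite -GT.
  exists (maxn i j) => //; split.
  - by move: x Fx; exact/subsetPset/ndF/leq_maxl.
  - by move: y Gy; exact/subsetPset/ndG/leq_maxr.
move=> k; have [mF Fk] := Foo k; have [mG Gk] := Goo k; split.
  rewrite -[X in measurable X]setTI; apply: measurable_unconsv => //.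
  exact: measurableX.
rewrite /lebesgue_step /pushforward (_ : _ @^-1` _ = F k `*` G k).
  by rewrite product_measure1E// lte_mul_pinfty// ge0_fin_numE.
rewrite -comp_preimage (_ : _ \o _ = id) ?preimage_id//.
by apply/funext; exact: consvK.
Qed.

HB.instance Definition _ := Measure_isSigmaFinite.Build _ _ _ lebesgue_step
  lebesgue_step_sigma_finite.

End lebesgue_step.

(* Lebesgue measure on R^n, as an iterated product; lebesgue_rV_box below     *)
(* gives its value on boxes.                                                  *)
Fixpoint lebesgue_rV n : {sigma_finite_measure set 'rV[R]_n -> \bar R} :=
  match n with
  | 0 => dirac (0 : 'rV[R]_0)
  | n'.+1 => lebesgue_step (lebesgue_rV n')
  end.

Lemma lebesgue_rV_box n (A : 'I_n -> set (measurableTypeR R)) :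
  (forall i, measurable (A i)) ->
  lebesgue_rV n [set v | forall i, A i (v 0 i)] =
  (\prod_(i < n) lebesgue_measure (A i))%E.
Proof.
elim: n A => [|n IH] A mA /=.
  by rewrite big_ord0 diracE mem_set//= => -[].
have mB : measurable [set v : 'rV[R]_n | forall i, A (lift ord0 i) (v 0 i)].
  rewrite (_ : [set v | _] = \bigcap_(i in [set: 'I_n])
      ((fun v : 'rV[R]_n => v 0 i) @^-1` A (lift ord0 i))).
    apply: fin_bigcap_measurable => [|i _]; first exact: (@finite_finset 'I_n).
    rewrite -[X in measurable X]setTI.
    exact: (@measurable_coordv n i measurableT _ (mA _)).
  by apply/seteqP; split => v /= vA i; [move=> _; exact: vA|exact: vA].
rewrite big_ord_recl -IH// -product_measure1E//.
rewrite /lebesgue_step /pushforward; congr (product_measure1 _ _ _).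
apply/seteqP; split => -[x v] /=.
  move=> xvA; split; first by have := xvA ord0; rewrite mxE unlift_none.
  by move=> i; have := xvA (lift ord0 i); rewrite mxE liftK.
move=> [xA vA] i; rewrite mxE.
by case: (unliftP ord0 i) => [j|] ->; rewrite ?liftK ?unlift_none/=.
Qed.

End lebesgue_rV.

Section euclidean_geometry.
Context {R : realType}.

Definition dotv n (x y : 'rV[R]_n) : R := \sum_i x 0 i * y 0 i.

Definition enorm n (x : 'rV[R]_n) : R := Num.sqrt (dotv x x).

Definition boundary n (A : set 'rV[R]_n) : set 'rV[R]_n :=
  closure A `\` interior A.

(* C^k functions on an open set U: all iterated partial derivatives of order  *)
(* at most k exist and are continuous on U.                                   *)
Fixpoint Ck n (k : nat) (U : set 'rV[R]_n) (f : 'rV[R]_n -> R) : Prop :=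
  (forall x, U x -> {for x, continuous f}) /\
  if k is k'.+1 then
    forall i : 'I_n, (forall x, U x -> derivable f x (delta_mx 0 i)) /\
                     Ck k' U (fun x => 'D_(delta_mx 0 i) f x)
  else True.

Definition smooth_on n p (U : set 'rV[R]_n) (f : 'rV[R]_n -> 'rV[R]_p) :=
  forall k (j : 'I_p), Ck k U (fun x => f x 0 j).

(* kappa is a smooth coordinate system on V: a C^oo diffeomorphism from the   *)
(* open set V onto an open set.                                               *)
Definition smooth_chart n p (V : set 'rV[R]_n) (kappa : 'rV[R]_n -> 'rV[R]_p) :=
  [/\ open V, open (kappa @` V), smooth_on V kappa &
      exists2 kappa' : 'rV[R]_p -> 'rV[R]_n,
        smooth_on (kappa @` V) kappa' & {in V, cancel kappa kappa'}].

(* Embedded smooth submanifold (without boundary) of dimension k.             *)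
Definition submanifold n (k : nat) (S : set 'rV[R]_n) :=
  (k <= n)%N /\
  forall p, S p -> exists V (kappa : 'rV[R]_n -> 'rV[R]_n),
    [/\ V p, smooth_chart V kappa &
        forall x, V x ->
          (S x <-> forall i : 'I_n, (k <= i)%N -> kappa x 0 i = 0)].

(* Near p, Omega is the region strictly above the graph of a Lipschitz        *)
(* function g over the hyperplane orthogonal to the unit vector e.            *)
Definition lipschitz_boundary_at n (Omega : set 'rV[R]_n) (p : 'rV[R]_n) :=
  exists (e : 'rV[R]_n) (g : 'rV[R]_n -> R) (L : R) (U : set 'rV[R]_n),
  [/\ enorm e = 1,
      (forall y z, dotv y e = 0 -> dotv z e = 0 ->
         `|g y - g z| <= L * enorm (y - z)),
      open U, U p &
      forall x, U x ->
        (Omega x <-> g (x - dotv x e *: e) < dotv x e)].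

(* The model cusp, in coordinates (x_1, x', x'') of R^(1 + d' + d'').         *)
Definition cusp (d' d'' : nat) (alpha r eps : R) : set 'rV[R]_(1 + d' + d'') :=
  [set y : 'rV[R]_(1 + d' + d'') | let x1 := lsubmx (lsubmx y) 0 0 in
    [/\ 0 < x1 < eps, enorm (rsubmx (lsubmx y)) < x1 `^ alpha &
        enorm (rsubmx y) < r]].

Definition cusp_boundary n (Omega omega : set 'rV[R]_n) (S : set 'rV[R]_n)
    (d' d'' : nat) (alpha r eps : R) :=
  [/\ n = (1 + d' + d'')%N, (1 <= d')%N, [/\ 1 < alpha, 0 < r & 0 < eps],
      closed S /\ submanifold d'' S &
      exists2 V : 'rV[R]_n -> set 'rV[R]_n,
        omega = \bigcup_(p in S) V p &
        forall p, S p -> V p p /\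
          exists kappa : 'rV[R]_n -> 'rV[R]_(1 + d' + d''),
            [/\ smooth_chart (V p) kappa, kappa p = 0 &
                kappa @` (Omega `&` V p) = cusp alpha r eps]].

Definition assumption1 n (Omega : set 'rV[R]_n) (I : finType) (Ir Ic : {set I})
    (omega S : I -> set 'rV[R]_n) (d' d'' : I -> nat) (alpha r eps : I -> R) :=
  [/\ forall i, i \in Ir :|: Ic -> open (omega i),
      boundary Omega `<=` \bigcup_(i in [set i | i \in Ir :|: Ic]) omega i,
      forall i, i \in Ir ->
        forall p, (boundary Omega `&` omega i) p ->
          lipschitz_boundary_at Omega p &
      forall i, i \in Ic ->
        cusp_boundary Omega (omega i) (S i) (d' i) (d'' i)
          (alpha i) (r i) (eps i)].

End euclidean_geometry.

Section metropolis.
Context {R : realType} {d : nat}.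
Local Notation leb := (lebesgue_rV (R := R) d).

Definition phi (z : 'rV[R]_d) : R :=
  (fine (leb [set x | enorm x < 1]))^-1 * \1_[set x | enorm x < 1] z.

Variables (Omega : set 'rV[R]_d) (rho : 'rV[R]_d -> R) (h : R).

Definition metropolis_density (x y : 'rV[R]_d) : R :=
  h ^- d * phi (h^-1 *: (x - y)) * Num.min (rho y / rho x) 1.

Definition holding_prob (x : 'rV[R]_d) : R :=
  1 - \int[leb]_(y in Omega) metropolis_density x y.

(* t_{h,rho}(x, dy) as a set function on the subsets of R^d; for x in Omega   *)
(* it is a Borel probability measure carried by Omega.                        *)
Definition metropolis_kernel (x : 'rV[R]_d) (A : set 'rV[R]_d) : \bar R :=
  ((holding_prob x)%:E * \d_x A +
   \int[leb]_(y in A `&` Omega) (metropolis_density x y)%:E)%E.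

Fixpoint metropolis_iter (n : nat) (x : 'rV[R]_d) (A : set 'rV[R]_d) : \bar R :=
  if n is n'.+1 then
    (\int[metropolis_kernel x]_(y in Omega) metropolis_iter n' y A)%E
  else \d_x A.

Definition metropolis_op (u : 'rV[R]_d -> R) (x : 'rV[R]_d) : R :=
  holding_prob x * u x +
  \int[leb]_(y in Omega) (metropolis_density x y * u y).

Definition mu_rho (A : set 'rV[R]_d) : \bar R :=
  (\int[leb]_(x in A `&` Omega) (rho x)%:E)%E.

(* L^2(Omega, rho(x) dx) with real scalars: elements are represented by       *)
(* functions, considered up to Lebesgue-a.e. equality on Omega, which is      *)
(* rho(x) dx-a.e. equality since rho is positive on Omega.                    *)
Definition L2 (u : 'rV[R]_d -> R) : Prop :=
  measurable_fun Omega u /\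
  (\int[leb]_(x in Omega) (u x ^+ 2 * rho x)%:E < +oo)%E.

Definition L2norm (u : 'rV[R]_d -> R) : R :=
  Num.sqrt (\int[leb]_(x in Omega) (u x ^+ 2 * rho x)).

(* A has a bounded two-sided inverse B on L^2. For A linear, these conditions *)
(* force B to be linear and to respect a.e. equality.                         *)
Definition L2_invertible (A : ('rV[R]_d -> R) -> ('rV[R]_d -> R)) : Prop :=
  exists B : ('rV[R]_d -> R) -> ('rV[R]_d -> R),
    [/\ exists K : R, forall u, L2 u ->
          L2 (B u) /\ L2norm (B u) <= K * L2norm u,
        forall u, L2 u -> B (A u) = u %[ae leb in Omega] &
        forall u, L2 u -> A (B u) = u %[ae leb in Omega]].

Definition spectrum (A : ('rV[R]_d -> R) -> ('rV[R]_d -> R)) : set R :=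
  [set lambda | ~ L2_invertible (fun u x => A u x - lambda * u x)].

Definition spectral_gap : R :=
  inf [set `|1 - lambda| | lambda in spectrum metropolis_op `\ 1].

End metropolis.

Definition TV_dist {R : realType} {d : nat} (mu nu : set 'rV[R]_d -> \bar R) :
    \bar R :=
  ereal_sup [set `|mu A - nu A|%E | A in measurable].

(* Main.v *)
(** On bounded measurable functions the Metropolis operator [T] is a Markov
operator, symmetric for [rho dx].  Let [G] be the infimum of the Rayleigh
quotients of [1 - T] over functions of mean zero.  Approximate minimisers prevent
[T - (1 - G)] from having a bounded inverse, so [g(h) <= G], and the bound follows,
with zero error term, from a decay like [(1 - G)^n].

The geometric input is that a cube of side [r] centred in [Omega] meets [Omega] in
volume at least [c r^(d + gamma)]: by compactness this is local, and near a cusp a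
smooth chart reduces it to an explicit box in the model cusp.  It gives a jump
probability of at least [a = c h^gamma], and [1 + T >= c h^gamma].  A coordinate
function shows [G <= C h^2], which is smaller than both since [gamma < 2]; hence [T]
contracts the mean-zero functions in [L^2] at rate [1 - G].  In the pointwise value
of [T u], the part that stays put shrinks by [1 - a], faster than [1 - G], while the
part that jumps is bounded by [C h^(-d/2)] times the [L^2] norm of [u]; summing the
geometric series costs a factor [1/a].  Finally [G > 0] because the Dirichlet form
controls the oscillation between neighbouring cubes and [Omega] is connected. *)

Require Import Defs.
From HB Require Import structures.
From mathcomp Require Import all_boot all_order all_algebra.
From mathcomp Require Import all_classical all_reals all_analysis.
From mathcomp Require Import measurable_realfun ring lra.

Set Implicit Arguments.
Unset Strict Implicit.
Unset Printing Implicit Defensive.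

Import Order.TTheory GRing.Theory Num.Theory.
Import numFieldNormedType.Exports.

Local Open Scope classical_set_scope.
Local Open Scope ring_scope.

(** * Bounded measurable functions on finite measure spaces *)

Section bounded_measurable.
Context {R : realType}.

(** The analysis stays with everywhere defined bounded measurable functions on the whole space,
    integrated against the finite measure that Lebesgue measure induces on [Omega]. Every integral
    that occurs then exists and Fubini applies, and neither completeness of L^2 nor functional
    calculus enters: a polarisation argument for symmetric forms turns bounds on <Au, u> into bounds
    on |Au|.

    Only g(h) <= G links the estimates to the spectrum, and this is the useful direction, since (1 -
    G)^n <= exp(-nG) <= exp(-n g(h)). The gap leaves out the spectral value 1, so 1 - G is
    admissible only when G > 0; this is what connectedness is for, and constants that degenerate
    with h are harmless there.

    The geometric obstacle is that the boxes inside a cusp have sides of orders tau and tau^alpha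
    and sit in curved coordinates. Change of variables is replaced by a count of pairs of points
    that needs Lipschitz bounds only.

    In the final bound 1/a supplies h^(-gamma), and the supremum of the jump density, of order
    h^(-d), enters through its square root. *)

Definition bmeas d (T : measurableType d) (f : T -> R) :=
  measurable_fun setT f /\ exists M, forall x, `|f x| <= M.

Lemma bmeas_cst d (T : measurableType d) (r : R) : bmeas (fun _ : T => r).
Proof. by split=> //; exists `|r|. Qed.

Lemma bmeasD d (T : measurableType d) (f g : T -> R) :
  bmeas f -> bmeas g -> bmeas (fun x => f x + g x).
Proof.
move=> [mf [M fM]] [mg [N gN]]; split; first exact: measurable_funD.
by exists (M + N) => x; rewrite (le_trans (ler_normD _ _))// lerD.
Qed.

Lemma bmeasM d (T : measurableType d) (f g : T -> R) :
  bmeas f -> bmeas g -> bmeas (fun x => f x * g x).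
Proof.
move=> [mf [M fM]] [mg [N gN]]; split; first exact: measurable_funM.
by exists (M * N) => x; rewrite normrM ler_pM.
Qed.

Lemma bmeasN d (T : measurableType d) (f : T -> R) :
  bmeas f -> bmeas (fun x => - f x).
Proof.
move=> [mf [M fM]]; split; first exact: measurable_funN.
by exists M => x; rewrite normrN.
Qed.

Lemma bmeasX d (T : measurableType d) (f : T -> R) n :
  bmeas f -> bmeas (fun x => f x ^+ n).
Proof.
move=> [mf [M fM]]; split; first exact: measurable_funX.
by exists (M ^+ n) => x; rewrite normrX; apply: lerXn2r; rewrite ?nnegrE// (le_trans _ (fM x)).
Qed.

Lemma bmeas_norm d (T : measurableType d) (f : T -> R) :
  bmeas f -> bmeas (fun x => `|f x|).
Proof.
move=> [mf [M fM]]; split; first exact: measurableT_comp.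
by exists M => x; rewrite normr_id.
Qed.

Lemma bmeasV d (T : measurableType d) (f : T -> R) (c : R) : 0 < c ->
  (forall x, c <= f x) -> bmeas f -> bmeas (fun x => (f x)^-1).
Proof.
move=> c0 cf [mf _]; split.
  rewrite (_ : (fun x => _) = (fun x => f x `^ (-1))).
    by apply: (measurableT_comp (measurable_powR (-1))).
  by apply/funext => x; rewrite powR_inv1// (le_trans _ (cf x))// ltW.
exists c^-1 => x; have f0 := lt_le_trans c0 (cf x).
by rewrite gtr0_norm ?invr_gt0// lef_pV2.
Qed.

Lemma bmeas_comp d1 d2 (T1 : measurableType d1) (T2 : measurableType d2)
    (f : T2 -> R) (p : T1 -> T2) :
  measurable_fun setT p -> bmeas f -> bmeas (fun x => f (p x)).
Proof.
move=> mp [mf [M fM]]; split; first exact: measurableT_comp.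
by exists M.
Qed.

Lemma bmeas_indic d (T : measurableType d) (A : set T) :
  measurable A -> bmeas (\1_A : T -> R).
Proof.
move=> mA; split; first exact: measurable_indic.
by exists 1 => x; rewrite indicE; case: (_ \in _); rewrite ?normr1 ?normr0.
Qed.

Definition bmeas2 d1 d2 (T1 : measurableType d1) (T2 : measurableType d2)
    (f : T1 -> T2 -> R) := bmeas (fun p : T1 * T2 => f p.1 p.2).

Lemma bmeas2_l d1 d2 (T1 : measurableType d1) (T2 : measurableType d2)
    (f : T1 -> T2 -> R) x : bmeas2 f -> bmeas (f x).
Proof. exact: (bmeas_comp (pair1_measurable x)). Qed.

Lemma bmeas2_r d1 d2 (T1 : measurableType d1) (T2 : measurableType d2)
    (f : T1 -> T2 -> R) y : bmeas2 f -> bmeas (f^~ y).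
Proof. exact: (bmeas_comp (pair2_measurable y)). Qed.

Lemma bmeas2_swap d1 d2 (T1 : measurableType d1) (T2 : measurableType d2)
    (f : T1 -> T2 -> R) : bmeas2 f -> bmeas2 (fun y x => f x y).
Proof.
exact: (bmeas_comp (p := fun p => (p.2, p.1)) (f := fun p => f p.1 p.2)
  (measurable_fun_pair measurable_snd measurable_fst)).
Qed.

Section integral.
Context d (T : measurableType d) (mu : {finite_measure set T -> \bar R}).

Lemma bmeas_integrable (f : T -> R) : bmeas f ->
  mu.-integrable setT (EFin \o f).
Proof.
move=> [mf [M fM]]; apply: measurable_bounded_integrable => //.
- by rewrite ltey_eq fin_num_measure.
- exists M; split; first exact: num_real.
  by move=> x Mx y _; rewrite /= (le_trans (fM y))// ltW.
Qed.

Lemma RintD (f g : T -> R) : bmeas f -> bmeas g ->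
  \int[mu]_x (f x + g x) = \int[mu]_x f x + \int[mu]_x g x.
Proof. by move=> bf bg; rewrite RintegralD//; exact: bmeas_integrable. Qed.

Lemma RintB (f g : T -> R) : bmeas f -> bmeas g ->
  \int[mu]_x (f x - g x) = \int[mu]_x f x - \int[mu]_x g x.
Proof. by move=> bf bg; rewrite RintegralB//; exact: bmeas_integrable. Qed.

Lemma RintZ (f : T -> R) r : bmeas f ->
  \int[mu]_x (r * f x) = r * \int[mu]_x f x.
Proof. by move=> bf; rewrite RintegralZl//; exact: bmeas_integrable. Qed.

Lemma RintZr (f : T -> R) r : bmeas f ->
  \int[mu]_x (f x * r) = \int[mu]_x f x * r.
Proof. by move=> bf; rewrite RintegralZr//; exact: bmeas_integrable. Qed.

Lemma Rint_le (f g : T -> R) : bmeas f -> bmeas g -> (forall x, f x <= g x) ->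
  \int[mu]_x f x <= \int[mu]_x g x.
Proof. by move=> bf bg fg; apply: le_Rintegral => //; exact: bmeas_integrable. Qed.

Lemma Rint_ge0 (f : T -> R) : (forall x, 0 <= f x) -> 0 <= \int[mu]_x f x.
Proof. by move=> f0; apply: Rintegral_ge0. Qed.

Lemma EFin_Rint (f : T -> R) : bmeas f ->
  (\int[mu]_x f x)%:E = (\int[mu]_x (f x)%:E)%E.
Proof.
move=> bf; rewrite fineK//; apply: integrable_fin_num => //.
exact: bmeas_integrable.
Qed.

Lemma Rint_ae_eq (D : set T) (f g : T -> R) : measurable D -> mu (~` D) = 0%E ->
  bmeas f -> bmeas g -> (forall x, D x -> f x = g x) ->
  \int[mu]_x f x = \int[mu]_x g x.
Proof.
move=> mD D0 bf bg fg; rewrite /Rintegral; congr fine.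
apply: ae_eq_integral => //; [| |exists (~` D); split => //].
- by apply/measurable_EFinP; case: bf.
- by apply/measurable_EFinP; case: bg.
- exact: measurableC.
- by move=> x /= xfg Dx; apply: xfg => _; rewrite fg.
Qed.

Lemma Rint_ae_le (D : set T) (f g : T -> R) : measurable D -> mu (~` D) = 0%E ->
  bmeas f -> bmeas g -> (forall x, D x -> f x <= g x) ->
  \int[mu]_x f x <= \int[mu]_x g x.
Proof.
move=> mD D0 bf bg fg.
(* Multiplying by the indicator of [D] makes the comparison hold at every point without changing the
   integrals. *)
have bD := bmeas_indic mD.
rewrite (@Rint_ae_eq D f (fun x => \1_D x * f x))//; first last.
- by move=> x Dx; rewrite indicE mem_set// mul1r.
- exact: bmeasM.
rewrite (@Rint_ae_eq D g (fun x => \1_D x * g x))//; first last.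
- by move=> x Dx; rewrite indicE mem_set// mul1r.
- exact: bmeasM.
apply: Rint_le; [exact: bmeasM|exact: bmeasM|move=> x].
by rewrite indicE; have [|] := boolP (x \in D) => [/set_mem/fg|_]; rewrite ?mul1r ?mul0r.
Qed.

Lemma Rint_indic (A : set T) : measurable A ->
  \int[mu]_x (\1_A x : R) = fine (mu A).
Proof. by move=> mA; rewrite /Rintegral integral_indic// setIT. Qed.

End integral.

Section double_integral.
Context d1 d2 (T1 : measurableType d1) (T2 : measurableType d2).
Variables (mu : {finite_measure set T1 -> \bar R})
  (nu : {finite_measure set T2 -> \bar R}).

Lemma bmeas2_integrable (f : T1 -> T2 -> R) : bmeas2 f ->
  (mu \x nu)%E.-integrable setT (EFin \o (fun p => f p.1 p.2)).
Proof.
move=> [mf [M fM]]; apply: measurable_bounded_integrable => //.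
- have muoo : ((mu \x nu)%E setT < +oo)%E.
    rewrite -setXTT product_measure1E// lte_mul_pinfty// ?ltey_eq.
      by rewrite fin_num_measure.
    by rewrite fin_num_measure.
  exact: muoo.
- exists M; split; first exact: num_real.
  by move=> x Mx y _; rewrite /= (le_trans (fM y))// ltW.
Qed.

End double_integral.

Lemma bmeas_Rint d1 d2 (T1 : measurableType d1) (T2 : measurableType d2)
  (nu : {finite_measure set T2 -> \bar R}) (f : T1 -> T2 -> R) : bmeas2 f ->
  bmeas (fun x => \int[nu]_y f x y).
Proof.
move=> bf; split.
  (* Measurability in [x] does not involve a measure on the first factor, so the zero measure is
     supplied. *)
  have mF := measurable_fubini_F (bmeas2_integrable mzero nu bf).
  exact: (measurableT_comp (@fine_measurable R setT measurableT) mF).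
have [M fM] := bf.2; exists (M * fine (nu setT)) => x.
have bfx : bmeas (f x) by exact: bmeas2_l.
rewrite (le_trans (le_normr_Rintegral _ _))//; first exact: bmeas_integrable.
rewrite -Rintegral_cst//; apply: Rint_le => [| |y]; first exact: bmeas_norm.
  exact: bmeas_cst.
exact: (fM (x, y)).
Qed.

Lemma Rint_swap d1 d2 (T1 : measurableType d1) (T2 : measurableType d2)
  (mu : {finite_measure set T1 -> \bar R})
  (nu : {finite_measure set T2 -> \bar R}) (f : T1 -> T2 -> R) : bmeas2 f ->
  \int[mu]_x \int[nu]_y f x y = \int[nu]_y \int[mu]_x f x y.
Proof.
move=> bf; have bf' := bmeas2_swap bf.
have /= fub := Fubini (bmeas2_integrable mu nu bf).
apply: EFin_inj.
rewrite EFin_Rint; last by apply: bmeas_Rint.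
rewrite EFin_Rint; last by apply: bmeas_Rint.
under eq_integral do rewrite (EFin_Rint nu (bmeas2_l _ bf)).
rewrite fub; apply: eq_integral => y _.
by rewrite EFin_Rint//; exact: bmeas2_r.
Qed.

End bounded_measurable.

(** The closure rules are chosen by the syntactic shape of the function; leaves that they do not
    settle remain as goals. *)
Ltac bm := first [assumption | lazymatch goal with
  | |- bmeas2 _ => rewrite /bmeas2; bm
  | |- bmeas (fun _ => ?r) => exact: bmeas_cst
  | |- bmeas (fun x => (@?f x + @?g x)%R) => apply: (@bmeasD _ _ _ f g); bm
  | |- bmeas (fun x => (- @?f x)%R) => apply: (@bmeasN _ _ _ f); bm
  | |- bmeas (fun x => (@?f x * @?g x)%R) => apply: (@bmeasM _ _ _ f g); bm
  | |- bmeas (fun x => (@?f x ^+ ?n)%R) => apply: (@bmeasX _ _ _ f n); bm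
  | |- bmeas (fun x => `|@?f x|%R) => apply: (@bmeas_norm _ _ _ f); bm
  | |- bmeas (fun x => Rintegral _ _ _) => apply: bmeas_Rint; bm
  | |- bmeas (fun p => ?u p.1) => apply: (bmeas_comp measurable_fst); bm
  | |- bmeas (fun p => ?u p.2) => apply: (bmeas_comp measurable_snd); bm
  | |- bmeas (fun y => _ _ y) => first
       [by apply: bmeas2_l | by apply: bmeas2_r | idtac]
  | |- bmeas (fun x => _ x _) => first [by apply: bmeas2_r | idtac]
  | |- bmeas (_ _) => first [by apply: bmeas2_l | idtac]
  | |- _ => idtac
  end].

(** * Reversible Markov operators with a bounded density *)

Section symmetric_contraction.
Context {R : realType} (V : Type) (P : V -> Prop) (cmb : V -> R -> V -> V).
Variables (B : V -> V -> R) (A : V -> V).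
Hypothesis P_cmb : forall u t v, P u -> P v -> P (cmb u t v).
Hypothesis B_sym : forall u v, B u v = B v u.
Hypothesis B_lin : forall u t v z, P u -> P v -> P z ->
  B (cmb u t v) z = B u z + t * B v z.
Hypothesis P_A : forall u, P u -> P (A u).
Hypothesis A_lin : forall u t v, P u -> P v ->
  A (cmb u t v) = cmb (A u) t (A v).
Hypothesis A_sym : forall u v, P u -> P v -> B (A u) v = B u (A v).

(** Polarisation: the forms at [u + t A u] and [u - t A u] differ by [4 t B (A u) (A u)], and
    [t = 1/q] balances the two terms of the bound. The abstract setting, with [cmb u t v] for
    [u + t v] and [P] for a subspace, serves both the Markov operator and its shift by a
    constant. *)
Lemma symmetric_contraction q : 0 < q ->
  (forall u, P u -> `|B (A u) u| <= q * B u u) ->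
  forall u, P u -> B (A u) (A u) <= q ^+ 2 * B u u.
Proof.
move=> q0 Aq u Pu; have Pv := P_A Pu; have Pz := P_A Pv.
have BE t : B (cmb u t (A u)) (cmb u t (A u)) =
    B u u + 2 * t * B u (A u) + t ^+ 2 * B (A u) (A u).
  have Pt := P_cmb t Pu Pv.
  by rewrite B_lin// [B u _]B_sym [B (A u) _]B_sym !B_lin// (B_sym (A u) u); ring.
have AE t : B (A (cmb u t (A u))) (cmb u t (A u)) =
    B (A u) u + 2 * t * B (A u) (A u) + t ^+ 2 * B (A (A u)) (A u).
  have Pt := P_cmb t Pu Pv; rewrite A_lin// B_lin//.
  rewrite [B (A u) _]B_sym [B (A (A u)) _]B_sym !B_lin//.
  rewrite (B_sym u (A (A u))) (A_sym Pv Pu) (B_sym u (A u)).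
  by rewrite (B_sym (A u) (A (A u))); ring.
have := Aq _ (P_cmb q^-1 Pu Pv); have := Aq _ (P_cmb (- q^-1) Pu Pv).
rewrite !BE !AE !ler_norml => /andP[+ _] /andP[_ +].
move: (B (A u) u) (B (A u) (A u)) (B u u) (B u (A u)) (B (A (A u)) (A u)).
move=> a N p k b H1 H2.
have : 4 * q^-1 * N <= q * (2 * p + 2 * (q^-1) ^+ 2 * N) by lra.
rewrite (_ : q * _ = 2 * q * p + 2 * q^-1 * N); last by field; rewrite gt_eqF.
move=> H3; have : q^-1 * N <= q * p by lra.
by rewrite mulrC ler_pdivrMr// => /le_trans; apply; rewrite mulrAC -expr2.
Qed.

End symmetric_contraction.

(** * Poincaré inequalities between pairs of sets *)

Section linked_sets.
Context {R : realType} d (T : measurableType d).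
Variables (mu : {finite_measure set T -> \bar R}) (s : T -> T -> R).
Hypotheses (bs : bmeas2 s) (s_ge0 : forall x y, 0 <= s x y).

(** Twice the Dirichlet form of the reversible operator with symmetric density [s]. *)
Definition energy (u : T -> R) :=
  \int[mu]_x \int[mu]_y (s x y * (u x - u y) ^+ 2).

Definition osc (A B : set T) (u : T -> R) :=
  \int[mu]_x \int[mu]_y (\1_A x * \1_B y * (u x - u y) ^+ 2).

(** The constant may depend on the two sets but not on [u], so that the relation can be chained from
    small cubes to the whole domain. *)
Definition linked (A B : set T) :=
  exists2 C, 0 < C & forall u, bmeas u -> osc A B u <= C * energy u.

Let bind A B u : measurable A -> measurable B -> bmeas u ->
  bmeas2 (fun x y : T => \1_A x * \1_B y * (u x - u y) ^+ 2 : R).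
Proof.
move=> /(bmeas_indic (R := R)) bA /(bmeas_indic (R := R)) bB bu.
by rewrite /bmeas2; bm.
Qed.

Lemma osc_le A B u (C : R) (f : T -> T -> R) :
  measurable A -> measurable B -> bmeas u -> bmeas2 f ->
  (forall x y, \1_A x * \1_B y * (u x - u y) ^+ 2 <= f x y) ->
  osc A B u <= \int[mu]_x \int[mu]_y f x y.
Proof.
move=> mA mB bu bf le_f; have bo := bind mA mB bu.
apply: Rint_le => [| |x]; [exact: bmeas_Rint|exact: bmeas_Rint|].
by apply: Rint_le => [| |y]; [exact: bmeas2_l bo|exact: bmeas2_l bf|].
Qed.

Lemma linked_near A B (c : R) : measurable A -> measurable B -> 0 < c ->
  (forall x y, A x -> B y -> c <= s x y) -> linked A B.
Proof.
move=> mA mB c0 cs; exists c^-1; rewrite ?invr_gt0// => u bu.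
rewrite /energy -RintZ; last by bm.
rewrite (_ : Rintegral _ _ _ =
  \int[mu]_x \int[mu]_y (c^-1 * (s x y * (u x - u y) ^+ 2))); last first.
  by apply: eq_Rintegral => x _; rewrite RintZ//; bm.
apply: osc_le => //; first by rewrite /bmeas2; bm.
move=> x y; rewrite [leRHS]mulrA ler_wpM2r ?sqr_ge0// !indicE ler_pdivlMl//.
have [/set_mem Ax|_] := boolP (x \in A); last by rewrite mul0r mulr0.
have [/set_mem By|_] := boolP (y \in B); last by rewrite !mulr0.
by rewrite !mulr1 cs.
Qed.

Lemma oscC A B u : measurable A -> measurable B -> bmeas u ->
  osc A B u = osc B A u.
Proof.
move=> mA mB bu; rewrite /osc (Rint_swap mu mu (bind mA mB bu)).
apply: eq_Rintegral => x _; apply: eq_Rintegral => y _.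
by rewrite [\1_A _ * _]mulrC -sqrrN opprB.
Qed.

Lemma linked_sym A B : measurable A -> measurable B ->
  linked A B -> linked B A.
Proof.
move=> mA mB [C C0 AB]; exists C; first exact: C0.
by move=> u bu; rewrite (oscC mB mA bu); exact: AB.
Qed.

Lemma linked_subr A B B' : measurable A -> measurable B -> measurable B' ->
  B' `<=` B -> linked A B -> linked A B'.
Proof.
move=> mA mB mB' BB [C C0 AB]; exists C; first exact: C0.
move=> u bu.
apply: le_trans (AB _ bu); apply: osc_le => //; first exact: bind.
move=> x y; rewrite ler_wpM2r ?sqr_ge0// ler_wpM2l// !indicE//.
by have [/set_mem/BB/mem_set ->//|_] := boolP (y \in B').
Qed.

Lemma linkedUr A B B' : measurable A -> measurable B -> measurable B' ->
  linked A B -> linked A B' -> linked A (B `|` B').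
Proof.
move=> mA mB mB' [C C0 AB] [C' C'0 AB'].
exists (C + C'); first exact: addr_gt0.
move=> u bu; rewrite mulrDl (le_trans _ (lerD (AB _ bu) (AB' _ bu)))//.
have bo := bind mA mB bu; have bo' := bind mA mB' bu.
rewrite /osc -RintD; [|exact: bmeas_Rint..].
apply: (@le_trans _ _ (\int[mu]_x \int[mu]_y
  (\1_A x * \1_B y * (u x - u y) ^+ 2 + \1_A x * \1_B' y * (u x - u y) ^+ 2))).
  apply: osc_le => //; [exact: measurableU|exact: bmeasD|].
  move=> x y; rewrite -mulrDl -mulrDr ler_wpM2r ?sqr_ge0// ler_wpM2l//.
  rewrite !indicE in_setU.
  by case: (y \in B); case: (y \in B') => /=; rewrite ?addr0 ?add0r// lerDl.
rewrite le_eqVlt; apply/orP; left; apply/eqP; apply: eq_Rintegral => x _.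
by rewrite RintD//; [exact: bmeas2_l bo|exact: bmeas2_l bo'].
Qed.

Let mass A := \int[mu]_x (\1_A x : R).
Let mom u A := \int[mu]_x (\1_A x * u x).
Let mom2 u A := \int[mu]_x (\1_A x * u x ^+ 2).

(** Expressed by masses and the first two moments, [osc] is a polynomial, which makes transitivity
    an algebraic inequality. *)
Let oscE A B u : measurable A -> measurable B -> bmeas u ->
  osc A B u = mass B * mom2 u A - 2 * mom u A * mom u B + mass A * mom2 u B.
Proof.
move=> /(bmeas_indic (R := R)) bA /(bmeas_indic (R := R)) bB bu.
transitivity (\int[mu]_x (mass B * (\1_A x * u x ^+ 2) +
    (- (2 * mom u B)) * (\1_A x * u x) + \1_A x * mom2 u B)).
  apply: eq_Rintegral => x _.
  transitivity (\int[mu]_y (\1_A x * u x ^+ 2 * \1_B y +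
    (- (2 * (\1_A x * u x))) * (\1_B y * u y) + \1_A x * (\1_B y * u y ^+ 2))).
    by apply: eq_Rintegral => y _; ring.
  rewrite !RintD; [|by bm..]; rewrite !RintZ; [|by bm..].
  by rewrite -/(mass B) -/(mom u B) -/(mom2 u B); ring.
rewrite !RintD; [|by bm..]; rewrite RintZr ?RintZ; [|by bm..].
by rewrite -/(mass A) -/(mom u A) -/(mom2 u A); ring.
Qed.

Let osc_ge0 A B u : 0 <= osc A B u.
Proof.
apply: Rint_ge0 => x; apply: Rint_ge0 => y.
by rewrite mulr_ge0 ?sqr_ge0// mulr_ge0.
Qed.

Let massE A : measurable A -> (0 < mu A)%E -> 0 < mass A.
Proof.
move=> mA A0; rewrite /mass Rint_indic// fine_gt0// A0/=.
by rewrite ltey_eq fin_num_measure.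
Qed.

(** This is the integral over [A], [B] and [C] of [(u x - u z)^2 <= 2 (u x - u y)^2 + 2 (u y - u
    z)^2], carried out on moments so that no triple integral appears. The mass of [B] comes from the
    intermediate variable and is divided out. *)
Lemma linked_trans A B C : measurable A -> measurable B -> measurable C ->
  (0 < mu A)%E -> (0 < mu B)%E -> (0 < mu C)%E ->
  linked A B -> linked B C -> linked A C.
Proof.
move=> mA mB mC A0 B0 C0 [K K0 AB] [K' K'0 BC].
move: (massE mA A0) (massE mB B0) (massE mC C0) => a0 b0 c0.
exists ((2 * mass C * K + 2 * mass A * K') / mass B).
  by rewrite divr_gt0// addr_gt0// !mulr_gt0.
move=> u bu; rewrite mulrAC ler_pdivlMr// mulrDl -!mulrA.
apply: (@le_trans _ _ (2 * (mass C * osc A B u) + 2 * (mass A * osc B C u))).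
  have := osc_ge0 A A u; have := osc_ge0 B B u; have := osc_ge0 C C u.
  rewrite !oscE//.
  move: (mass A) (mass B) (mass C) a0 b0 c0 => a b c a0 b0 c0.
  move: (mom u A) (mom u B) (mom u C) => p q r.
  move: (mom2 u A) (mom2 u B) (mom2 u C) => x y z H1 H2 H3.
  have abc : 0 < a * b * c by rewrite !mulr_gt0.
  rewrite -subr_ge0 -(pmulr_rge0 _ abc).
  (* The difference is the square for the second difference of the means
     [p / a], [q / b], [r / c], plus multiples of the three variances. *)
  have -> : a * b * c * (2 * (c * (b * x - 2 * p * q + a * y)) +
      2 * (a * (c * y - 2 * q * r + b * z)) -
      (c * x - 2 * p * r + a * z) * b) =
      (b * c * p + a * b * r - 2 * a * c * q) ^+ 2 +
      (b * c) ^+ 2 * (a * x - p ^+ 2) + (a * b) ^+ 2 * (c * z - r ^+ 2) +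
      4 * (a * c) ^+ 2 * (b * y - q ^+ 2) by ring.
  by rewrite !addr_ge0 ?sqr_ge0// mulr_ge0 ?sqr_ge0 ?mulr_ge0 ?sqr_ge0//; lra.
move: (ler_wpM2l (ltW c0) (AB u bu)) (ler_wpM2l (ltW a0) (BC u bu)).
move: (mass A) (mass C) (osc A B u) (osc B C u) (energy u) => a c p q e.
by rewrite !mulrA => H1 H2; lra.
Qed.

End linked_sets.

(** * Reversible operators: Dirichlet forms, gap, pointwise decay *)

Section reversible_kernel.
Context {R : realType} d (T : measurableType d).
Variables (mu : {finite_measure set T -> \bar R}) (w : T -> R).
Variables (s : T -> T -> R) (c : R).
Hypotheses (c_gt0 : 0 < c) (w_ge : forall x, c <= w x) (bw : bmeas w).
Hypotheses (bs : bmeas2 s) (s_sym : forall x y, s x y = s y x).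
Hypotheses (s_ge0 : forall x y, 0 <= s x y).

Let w_gt0 x : 0 < w x. Proof. exact: lt_le_trans (w_ge x). Qed.
Let bwV : bmeas (fun x => (w x)^-1). Proof. exact: bmeasV c_gt0 w_ge bw. Qed.

Definition rjump x := (w x)^-1 * \int[mu]_y s x y.

(** A jump from [x] has density [s x y / w x]; otherwise the chain stays. Symmetry of [s] is
    detailed balance with respect to [w dmu]. *)
Definition rop (u : T -> R) x :=
  (1 - rjump x) * u x + (w x)^-1 * \int[mu]_y (s x y * u y).

Definition rdot (u v : T -> R) := \int[mu]_x (u x * v x * w x).

Hypothesis rjump_le1 : forall x, rjump x <= 1.

Lemma bmeas_rjump : bmeas rjump.
Proof. by rewrite /rjump; bm. Qed.

Lemma bmeas_rop u : bmeas u -> bmeas (rop u).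
Proof.
move=> bu; rewrite /rop; bm; exact: bmeas_rjump.
Qed.

Lemma rdotC u v : rdot u v = rdot v u.
Proof. by apply: eq_Rintegral => x _; rewrite mulrAC mulrC mulrA. Qed.

Lemma rdot_lin u v z t : bmeas u -> bmeas v -> bmeas z ->
  rdot (fun x => u x + t * v x) z = rdot u z + t * rdot v z.
Proof.
move=> bu bv bz; rewrite /rdot -RintZ; last by bm.
rewrite -RintD; [|by bm..].
by apply: eq_Rintegral => x _; ring.
Qed.

Lemma rdot_ge0 u : 0 <= rdot u u.
Proof. by apply: Rint_ge0 => x; rewrite mulr_ge0 -?expr2 ?sqr_ge0// ltW. Qed.

Lemma rop_lin u v t : bmeas u -> bmeas v ->
  rop (fun x => u x + t * v x) = (fun x => rop u x + t * rop v x).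
Proof.
move=> bu bv; apply/funext => x; rewrite /rop.
rewrite (_ : \int[mu]_y _ =
  \int[mu]_y (s x y * u y) + t * \int[mu]_y (s x y * v y)); first by ring.
rewrite -RintZ; last by bm.
rewrite -RintD; [|by bm..].
by apply: eq_Rintegral => y _; ring.
Qed.

Lemma rop1 : rop (fun=> 1) = fun=> 1.
Proof.
apply/funext => x; rewrite /rop/= /rjump.
rewrite (_ : \int[mu]_y (s x y * 1) = \int[mu]_y s x y); first by ring.
by apply: eq_Rintegral => y _; rewrite mulr1.
Qed.

Lemma rdot_ropE u v : bmeas u -> bmeas v -> rdot (rop u) v =
  rdot u v - \int[mu]_x \int[mu]_y (s x y * (u x * v x)) +
  \int[mu]_x \int[mu]_y (s x y * (u y * v x)).
Proof.
move=> bu bv; rewrite /rdot -RintB; [|by bm|]; last first.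
  by bm.
rewrite -RintD; last 2 first.
- by bm.
- by bm.
apply: eq_Rintegral => x _.
rewrite [X in _ - X](_ : _ = \int[mu]_y s x y * (u x * v x)); last first.
  by rewrite -RintZr//; bm.
rewrite [X in _ + X](_ : _ = \int[mu]_y (s x y * u y) * v x); last first.
  rewrite -RintZr; last by bm.
  by apply: eq_Rintegral => y _; ring.
by rewrite /rop /rjump; field; rewrite gt_eqF.
Qed.

Lemma rop_sym u v : bmeas u -> bmeas v -> rdot (rop u) v = rdot u (rop v).
Proof.
move=> bu bv; rewrite [RHS]rdotC (rdot_ropE bu bv) (rdot_ropE bv bu).
rewrite [rdot v u]rdotC.
have -> : \int[mu]_x \int[mu]_y (s x y * (u x * v x)) =
    \int[mu]_x \int[mu]_y (s x y * (v x * u x)).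
  by apply: eq_Rintegral => x _; apply: eq_Rintegral => y _; rewrite [u x * _]mulrC.
have -> // : \int[mu]_x \int[mu]_y (s x y * (u y * v x)) =
    \int[mu]_x \int[mu]_y (s x y * (v y * u x)).
rewrite Rint_swap; last by rewrite /bmeas2; bm.
apply: eq_Rintegral => x _; apply: eq_Rintegral => y _.
by rewrite s_sym [u x * _]mulrC.
Qed.

(** Taken at [e = -1] and [e = 1], it gives the forms of [1 - T] and [1 + T] together. *)
Let Rint2_sqr (e : R) u : bmeas u ->
  \int[mu]_x \int[mu]_y (s x y * (u x + e * u y) ^+ 2) =
  (1 + e ^+ 2) * \int[mu]_x \int[mu]_y (s x y * (u x * u x)) +
  2 * e * \int[mu]_x \int[mu]_y (s x y * (u y * u x)).
Proof.
move=> bu.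
have E : \int[mu]_x \int[mu]_y (s x y * (u x * u x)) =
    \int[mu]_x \int[mu]_y (s x y * (u y * u y)).
  rewrite Rint_swap; last by rewrite /bmeas2; bm.
  by apply: eq_Rintegral => x _; apply: eq_Rintegral => y _; rewrite s_sym.
rewrite mulrDl mul1r {2}E -!RintZ; last 2 first.
- by bm.
- by bm.
rewrite -RintD; last 2 first.
- by bm.
- by bm.
rewrite -RintD; last 2 first.
- by bm.
- by bm.
apply: eq_Rintegral => x _.
rewrite -!RintZ; [|by bm..].
rewrite -!RintD; [|by bm..].
apply: eq_Rintegral => y _; ring.
Qed.

Lemma dirichlet_rop u : bmeas u -> rdot u u - rdot (rop u) u =
  2^-1 * \int[mu]_x \int[mu]_y (s x y * (u x - u y) ^+ 2).
Proof.
move=> bu; have /= := Rint2_sqr (-1) bu.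
under eq_Rintegral do under eq_Rintegral do rewrite mulN1r.
move=> ->; rewrite (rdot_ropE bu bu).
by move: (rdot _ _) (Rintegral _ _ _) (Rintegral _ _ _) => p q r; field.
Qed.

(** The difference of the two sides is twice the integral of [(1 - rjump) u^2 w], the contribution
    of holding. *)
Lemma dirichlet_rop_add u : bmeas u ->
  2^-1 * \int[mu]_x \int[mu]_y (s x y * (u x + u y) ^+ 2) <=
  rdot u u + rdot (rop u) u.
Proof.
move=> bu; have /= := Rint2_sqr 1 bu.
under eq_Rintegral do under eq_Rintegral do rewrite mul1r.
move=> ->; rewrite (rdot_ropE bu bu).
suff : \int[mu]_x \int[mu]_y (s x y * (u x * u x)) <= rdot u u.
  by move: (rdot _ _) (Rintegral _ _ _) (Rintegral _ _ _) => p q r; lra.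
apply: Rint_le; [|by bm|].
  by bm.
move=> x; rewrite RintZr; last by bm.
rewrite mulrC ler_wpM2l -?expr2 ?sqr_ge0//.
by have := rjump_le1 x; rewrite /rjump mulrC ler_pdivrMr// mul1r.
Qed.

Definition centered (u : T -> R) := bmeas u /\ rdot u (fun=> 1) = 0.

Lemma centered_cmb u t v : centered u -> centered v ->
  centered (fun x => u x + t * v x).
Proof.
move=> [bu u0] [bv v0]; split; first by bm.
by rewrite rdot_lin//; [rewrite u0 v0; ring|bm].
Qed.

Lemma centered_rop u : centered u -> centered (rop u).
Proof.
move=> [bu u0]; split; first exact: bmeas_rop.
rewrite (rop_sym bu); last by bm.
by rewrite rop1.
Qed.

Lemma rop_contraction q : 0 < q ->
  (forall u, centered u -> `|rdot (rop u) u| <= q * rdot u u) ->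
  forall u, centered u -> rdot (rop u) (rop u) <= q ^+ 2 * rdot u u.
Proof.
move=> q0; apply: (symmetric_contraction (cmb := fun u t v x => u x + t * v x)) => //.
- exact: centered_cmb.
- exact: rdotC.
- by move=> u t v z [bu _] [bv _] [bz _]; exact: rdot_lin.
- exact: centered_rop.
- by move=> u t v [bu _] [bv _]; exact: rop_lin.
- by move=> u v [bu _] [bv _]; exact: rop_sym.
Qed.

(** With [A = T + G] the hypothesis implies [-1 <= A <= 1] as forms, hence |Au| <= |u|. Since
    [1 - G - T = 1 - A], expanding |u - Au|^2 gives the claim: the residual is small whenever the
    Rayleigh quotient is close to [G]. *)
Lemma rop_resolvent G : 0 <= G ->
  (forall u, centered u -> - rdot u u <= rdot (rop u) u <= (1 - G) * rdot u u) ->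
  forall u, centered u ->
  rdot (fun x => (1 - G) * u x - rop u x) (fun x => (1 - G) * u x - rop u x) <=
  2 * ((1 - G) * rdot u u - rdot (rop u) u).
Proof.
move=> G0 TG u cu; pose A (u : T -> R) := fun x => rop u x + G * u x.
have cA v : centered v -> centered (A v).
  by move=> cv; apply: centered_cmb => //; exact: centered_rop.
have bT v : centered v -> bmeas (rop v) by move=> /centered_rop[].
have AE v : centered v -> rdot (A v) v = rdot (rop v) v + G * rdot v v.
  by move=> cv; rewrite (rdot_lin G (bT _ cv) cv.1 cv.1).
have : rdot (A u) (A u) <= 1 ^+ 2 * rdot u u.
  apply: (@symmetric_contraction _ _ centered
    (fun u t v x => u x + t * v x) rdot A) => //.
  - exact: centered_cmb.
  - exact: rdotC.
  - by move=> v t z y [bv _] [bz _] [yy _]; exact: rdot_lin.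
  - move=> v t z cv cz; rewrite /A (rop_lin t cv.1 cz.1).
    by apply/funext => x; ring.
  - move=> v z cv cz; rewrite (rdot_lin G (bT _ cv) cv.1 cz.1).
    rewrite [RHS]rdotC (rdot_lin G (bT _ cz) cz.1 cv.1).
    by rewrite (rop_sym cv.1 cz.1) (rdotC v) (rdotC z).
  - move=> v cv; rewrite AE// ler_norml mul1r; have /andP[] := TG _ cv.
    have := rdot_ge0 v; move: (rdot v v) (rdot (rop v) v) => a b a0 ba ab.
    have : 0 <= G * a by rewrite mulr_ge0.
    by lra.
rewrite expr1n mul1r => Au.
have -> : (fun x => (1 - G) * u x - rop u x) = (fun x => u x + (-1) * A u x).
  by apply/funext => x; rewrite /A; ring.
have cAu := cA _ cu.
have cuA := centered_cmb (-1) cu cAu.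
rewrite (rdot_lin (-1) cu.1 cAu.1 cuA.1) [rdot u _]rdotC [rdot (A u) _]rdotC.
rewrite (rdot_lin (-1) cu.1 cAu.1 cu.1) (rdot_lin (-1) cu.1 cAu.1 cAu.1).
rewrite (rdotC u (A u)) (AE _ cu); move: Au.
by move: (rdot (A u) (A u)) (rdot u u) (rdot (rop u) u) => a b e; lra.
Qed.

Definition rgap := inf [set rdot u u - rdot (rop u) u |
  u in [set u | centered u /\ rdot u u = 1]].

Lemma rop_le u : bmeas u -> rdot (rop u) u <= rdot u u.
Proof.
move=> bu; rewrite -subr_ge0 (dirichlet_rop bu).
rewrite mulr_ge0 ?invr_ge0//; apply: Rint_ge0 => x; apply: Rint_ge0 => y.
by rewrite mulr_ge0 ?sqr_ge0.
Qed.

Lemma rop_ge u : bmeas u -> - rdot u u <= rdot (rop u) u.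
Proof.
move=> bu; rewrite -subr_ge0 opprK addrC.
apply: le_trans (dirichlet_rop_add bu).
rewrite mulr_ge0 ?invr_ge0//; apply: Rint_ge0 => x; apply: Rint_ge0 => y.
by rewrite mulr_ge0 ?sqr_ge0.
Qed.

Let gap_set := [set rdot u u - rdot (rop u) u |
  u in [set u | centered u /\ rdot u u = 1]].

Let gap_lb : has_lbound gap_set.
Proof. by exists 0 => _ [u [[bu _] u1] <-]; rewrite subr_ge0 rop_le. Qed.

Lemma rdotZZ t u v : bmeas u -> bmeas v ->
  rdot (fun x => t * u x) (fun x => t * v x) = t ^+ 2 * rdot u v.
Proof.
move=> bu bv; rewrite /rdot -RintZ; last by bm.
by apply: eq_Rintegral => x _; ring.
Qed.

Lemma ropZ t u : bmeas u -> rop (fun x => t * u x) = fun x => t * rop u x.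
Proof.
move=> bu; have b0 := @bmeas_cst R _ T 0.
rewrite (_ : (fun x => t * u x) = (fun x => 0 + t * u x)); last first.
  by apply/funext => x; rewrite add0r.
rewrite (rop_lin t b0 bu); apply/funext => x.
rewrite (_ : rop (fun=> 0) x = 0) ?add0r//.
rewrite /rjump /rop mulr0 add0r.
rewrite (_ : \int[mu]_y (s x y * 0) = 0) ?mulr0//.
by under eq_Rintegral do rewrite mulr0; rewrite Rintegral_cst// mul0r.
Qed.

Let normalized u : centered u -> 0 < rdot u u ->
  exists v, [/\ centered v, rdot v v = 1 &
    rdot v v - rdot (rop v) v = (rdot u u - rdot (rop u) u) / rdot u u].
Proof.
move=> [bu u0] uu0; set t := Num.sqrt (rdot u u)^-1.
have t2 : t ^+ 2 = (rdot u u)^-1 by rewrite sqr_sqrtr// invr_ge0 ltW.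
have bTu : bmeas (rop u) by exact: bmeas_rop.
exists (fun x => t * u x); rewrite ropZ// !rdotZZ// t2.
rewrite mulVf ?gt_eqF//; split=> //.
  split; first by bm.
  have := @rdot_lin (fun=> 0) u (fun=> 1) t.
  rewrite u0 mulr0 addr0 => lin.
  rewrite (_ : (fun x => t * u x) = (fun x => 0 + t * u x)); last first.
    by apply/funext => x; rewrite add0r.
  rewrite lin//; try by bm.
  by rewrite /rdot; under eq_Rintegral do rewrite !mul0r; rewrite Rintegral_cst// mul0r.
by field; rewrite gt_eqF.
Qed.

Lemma rgap_ge0 u : centered u -> 0 < rdot u u -> 0 <= rgap.
Proof.
move=> cu uu; have [v [cv v1 _]] := normalized cu uu.
apply: lb_le_inf; first by exists (rdot v v - rdot (rop v) v), v.
by move=> _ [z [[bz _] u1] <-]; rewrite subr_ge0 rop_le.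
Qed.

Lemma rgap_le u : centered u -> rgap * rdot u u <= rdot u u - rdot (rop u) u.
Proof.
move=> cu; have := rdot_ge0 u; rewrite le_eqVlt => /predU1P[E|uu].
  by have := rop_le cu.1; rewrite -E mulr0 sub0r oppr_ge0.
rewrite -ler_pdivlMr//.
by have [v [cv v1 <-]] := normalized cu uu; apply: ge_inf => //; exists v.
Qed.

(* A bounded inverse of [1 - rgap - rop] would push the infimum of the
   Rayleigh quotient strictly above [rgap]. *)
Lemma rgap_not_resolvent K u0 : centered u0 -> 0 < rdot u0 u0 ->
  exists2 u, centered u &
    K * rdot (fun x => (1 - rgap) * u x - rop u x)
             (fun x => (1 - rgap) * u x - rop u x) < rdot u u.
Proof.
move=> cu0 uu0; have [v [cv v1 _]] := normalized cu0 uu0.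
have G0 := rgap_ge0 cu0 uu0.
(* The tolerance absorbs the factor 2 of [rop_resolvent], so that [K] times the squared residual
   falls below 1; [|K| + 1] is positive for every [K]. *)
have [||_ [u [cu u1] <-] ug] := @inf_adherent _ gap_set (2 * (`|K| + 1))^-1.
- by rewrite invr_gt0 mulr_gt0// ltr_wpDl.
- by split => //; exists (rdot v v - rdot (rop v) v), v.
exists u => //; have := rop_resolvent G0 _ cu.
set rr := rdot _ _ => H; have {}H : rr <= 2 * (1 - rgap - rdot (rop u) u).
  move: H; rewrite u1 mulr1; apply => z cz; rewrite (rop_ge cz.1)/=.
  by have := rgap_le cz; move: (rdot z z) (rdot (rop z) z) => a b; lra.
have rr0 : 0 <= rr by exact: rdot_ge0.
have K1 : 0 < `|K| + 1 by rewrite ltr_wpDl.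
apply: (@le_lt_trans _ _ ((`|K| + 1) * rr)).
  by rewrite ler_wpM2r// (le_trans (ler_norm K))// lerDl.
rewrite u1 -ltr_pdivlMl// mulr1; move: ug; rewrite u1 invfM.
rewrite -/rgap; move: H; move: (rdot (rop u) u) (`|K| + 1)^-1 => a b; lra.
Qed.

Lemma rop_iter_centered f n : centered f -> centered (iter n rop f).
Proof. by move=> cf; elim: n => //= n; exact: centered_rop. Qed.

Lemma rop_iter_rdot q f n : 0 < q ->
  (forall u, centered u -> `|rdot (rop u) u| <= q * rdot u u) ->
  centered f -> rdot f f <= 1 ->
  rdot (iter n rop f) (iter n rop f) <= (q ^+ n) ^+ 2.
Proof.
move=> q0 Tq cf f1; elim: n => [|n IH]; first by rewrite expr0 expr1n.
rewrite iterS (le_trans (rop_contraction q0 Tq (rop_iter_centered n cf)))//.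
by rewrite [q ^+ n.+1]exprS exprMn ler_wpM2l// sqr_ge0.
Qed.

(** Young's inequality [|u| <= t/2 + u^2 / (2t)] under the jump integral: the first term uses that
    the jump mass is at most 1, the second the bound on the density. The parameter [t] is later set
    to the scale of the L^2 norm. *)
Lemma rop_pointwise kappa u x t : bmeas u -> 0 < t -> 0 <= kappa ->
  (forall y, s x y <= kappa * w x) ->
  `|rop u x| <= (1 - rjump x) * `|u x| + t / 2 +
                (2 * t)^-1 * (kappa / c) * rdot u u.
Proof.
move=> bu t0 k0 sk; rewrite /rop (le_trans (ler_normD _ _))//.
rewrite normrM (ger0_norm (_ : 0 <= 1 - rjump x)) ?subr_ge0// -addrA lerD2l.
rewrite normrM gtr0_norm ?invr_gt0// ler_pdivrMl//.
have bsu : bmeas (fun y => s x y * u y) by bm.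
rewrite (le_trans (le_normr_Rintegral _ (bmeas_integrable mu bsu)))//.
apply: (@le_trans _ _ (\int[mu]_y (t / 2 * s x y +
    kappa * w x / (2 * t * c) * (u y * u y * w y)))).
  apply: Rint_le; [by bm|by bm|move=> y].
  rewrite normrM (ger0_norm (s_ge0 _ _)).
  apply: (@le_trans _ _ (t / 2 * s x y + (2 * t)^-1 * (s x y * (u y * u y)))).
    have -> : u y * u y = `|u y| ^+ 2 by rewrite -normrX ger0_norm ?sqr_ge0.
    rewrite -subr_ge0.
    have -> : t / 2 * s x y + (2 * t)^-1 * (s x y * `|u y| ^+ 2) -
        s x y * `|u y| = (2 * t)^-1 * s x y * (t - `|u y|) ^+ 2.
      by field; rewrite gt_eqF.
    by rewrite mulr_ge0 ?sqr_ge0// mulr_ge0// invr_ge0 mulr_ge0// ltW.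
  rewrite lerD2l.
  have -> : kappa * w x / (2 * t * c) * (u y * u y * w y) =
    (2 * t)^-1 * ((kappa * w x) * (u y * u y * (w y / c))).
    by field; rewrite !gt_eqF.
  rewrite ler_wpM2l ?invr_ge0 ?mulr_ge0 ?(ltW t0)//.
  apply: ler_pM => //; first by rewrite -expr2 sqr_ge0.
  by rewrite -expr2 ler_peMr ?sqr_ge0// ler_pdivlMr// mul1r.
rewrite RintD; [|by bm..]; rewrite !RintZ; [|by bm..].
rewrite -/(rdot u u).
have -> : w x * (t / 2 + (2 * t)^-1 * (kappa / c) * rdot u u) =
  t / 2 * w x + kappa * w x / (2 * t * c) * rdot u u.
  by field; rewrite !gt_eqF.
rewrite lerD2r ler_wpM2l//; first by rewrite divr_ge0// ltW.
by have := rjump_le1 x; rewrite /rjump mulrC ler_pdivrMr// mul1r.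
Qed.

(* The holding part contracts at rate [1 - a], faster than the rate [q] of the
   [L^2] norms, so the pointwise values inherit the rate [q]. *)
Lemma rop_iter_pointwise (D : set T) kappa a b q f n : 0 < a -> 0 < b ->
  0 <= kappa -> kappa / c <= b ^+ 2 -> 1 - a / 2 <= q -> 0 < q ->
  (forall x, D x -> a <= rjump x) ->
  (forall x y, D x -> s x y <= kappa * w x) ->
  (forall u, centered u -> `|rdot (rop u) u| <= q * rdot u u) ->
  centered f -> rdot f f <= 1 -> (forall x, D x -> `|f x| <= 1) ->
  forall x, D x -> `|iter n rop f x| <= (1 + 2 * b / a) * q ^+ n.
Proof.
move=> a0 b0 k0 kb aq q0 aD sD Tq cf f1 fD x Dx.
elim: n => [|n IH].
  by rewrite expr0 mulr1 (le_trans (fD _ Dx))// lerDl divr_ge0 ?mulr_ge0// ltW.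
have qn0 : 0 < q ^+ n by rewrite exprn_gt0.
(* With [t = b q^n] the two Young terms are each at most [b q^n / 2]. *)
have t0 : 0 < b * q ^+ n by rewrite mulr_gt0.
have [bT _] := rop_iter_centered n cf.
rewrite iterS (le_trans (rop_pointwise bT t0 k0 (sD x ^~ Dx)))//.
have : (1 - rjump x) * `|iter n rop f x| <=
    (1 - a) * ((1 + 2 * b / a) * q ^+ n).
  apply: (@le_trans _ _ ((1 - rjump x) * ((1 + 2 * b / a) * q ^+ n))).
    by rewrite ler_wpM2l// subr_ge0.
  by rewrite ler_wpM2r ?lerD2l ?lerN2 ?aD// mulr_ge0 ?exprn_ge0 ?addr_ge0
    ?divr_ge0 ?mulr_ge0 ?(ltW a0) ?(ltW b0) ?(ltW q0).
have : (2 * (b * q ^+ n))^-1 * (kappa / c) *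
    rdot (iter n rop f) (iter n rop f) <= b * q ^+ n / 2.
  rewrite -mulrA ler_pdivrMl ?mulr_gt0//.
  rewrite (le_trans (ler_pM _ (rdot_ge0 _) kb (rop_iter_rdot n q0 Tq cf f1)))//.
    by rewrite divr_ge0// ltW.
  by rewrite le_eqVlt; apply/orP; left; apply/eqP; field.
move=> H1 H2.
(* The constant [k = 1 + 2b/a] closes the recursion: passing from [1 - a] to [1 - a/2] gains
   [k a/2 = b + a/2], which covers the jump term [b]. *)
suff : (1 - a) * ((1 + 2 * b / a) * q ^+ n) + b * q ^+ n <=
    (1 + 2 * b / a) * q ^+ n.+1.
  by move: H1 H2; lra.
rewrite exprS !mulrA -mulrDl ler_wpM2r ?exprn_ge0 ?(ltW q0)//.
have H3 : 0 <= 1 + 2 * b / a.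
  by rewrite addr_ge0// divr_ge0 ?mulr_ge0// ltW.
apply: le_trans (ler_wpM2l H3 aq).
have -> : (1 + 2 * b / a) * (1 - a / 2) =
   (1 - a) * (1 + 2 * b / a) + b + a / 2 by field; rewrite gt_eqF.
by rewrite lerDl divr_ge0 ?(ltW a0).
Qed.

Lemma rdot_le (M : R) u : (forall x, w x <= M) -> bmeas u ->
  rdot u u <= M * \int[mu]_x (u x) ^+ 2.
Proof.
move=> wM bu; rewrite -RintZ; last by bm.
by apply: Rint_le; [by bm..|move=> x]; rewrite mulrC -expr2 ler_wpM2r ?sqr_ge0.
Qed.

(* On a set of diameter less than the range of the kernel,
   [\int\int (u x + u y)^2] dominates [\int u^2]; such sets are averaged over
   the auxiliary parameter [z]. *)
Lemma rop_lower_bound d2 (Z : measurableType d2)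
    (nu : {finite_measure set Z -> \bar R}) (e : T -> Z -> R) (D : set T)
    (C1 b M : R) :
  bmeas2 e -> (forall x z, 0 <= e x z) -> measurable D -> mu (~` D) = 0%E ->
  0 < C1 -> 0 <= b -> 0 < M -> (forall x, w x <= M) ->
  (forall x y, \int[nu]_z (e x z * e y z) <= C1 * s x y) ->
  (forall x, D x -> b <= \int[nu]_z (e x z * \int[mu]_y e y z)) ->
  forall u, bmeas u ->
  b / (C1 * M) * rdot u u <= rdot u u + rdot (rop u) u.
Proof.
move=> be e0 mD D0 C10 b0 M0 wM eC eb u bu.
apply: le_trans (dirichlet_rop_add bu).
have bez z : bmeas (e^~ z) by bm.
have bE : bmeas (fun z => \int[mu]_y e y z).
  by apply: bmeas_Rint; exact: (bmeas2_swap be).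
have b3 : bmeas2 (fun (p : T * Z) y =>
    e p.1 p.2 * e y p.2 * (u p.1 + u y) ^+ 2).
  have m11 : measurable_fun setT (fun q : T * Z * T => q.1.1).
    exact: (measurableT_comp measurable_fst measurable_fst).
  have m12 : measurable_fun setT (fun q : T * Z * T => q.1.2).
    exact: (measurableT_comp measurable_snd measurable_fst).
  have b1 : bmeas (fun q : T * Z * T => e q.1.1 q.1.2).
    exact: (bmeas_comp measurable_fst be).
  have b2 : bmeas (fun q : T * Z * T => e q.2 q.1.2).
    exact: (bmeas_comp (measurable_fun_pair measurable_snd m12) be).
  have b4 : bmeas (fun q : T * Z * T => u q.1.1) by exact: (bmeas_comp m11 bu).
  by rewrite /bmeas2; bm.
have b2 x : bmeas2 (fun y z => e x z * e y z * (u x + u y) ^+ 2).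
  have m12 : measurable_fun setT (fun q : T * Z => ((x, q.2), q.1)).
    by apply: measurable_fun_pair => //; apply: measurable_fun_pair.
  exact: (bmeas_comp m12 b3).
have b2z z : bmeas2 (fun x y => e x z * e y z * (u x + u y) ^+ 2).
  have b1 : bmeas (fun p : T * T => e p.1 z).
    exact: (bmeas_comp measurable_fst (bez z)).
  have b4 : bmeas (fun p : T * T => e p.2 z).
    exact: (bmeas_comp measurable_snd (bez z)).
  by rewrite /bmeas2; bm.
have b2u : bmeas2 (fun x z => e x z * (u x) ^+ 2 * \int[mu]_y e y z).
  have b1 : bmeas (fun p : T * Z => \int[mu]_y e y p.2).
    exact: (bmeas_comp measurable_snd bE).
  by rewrite /bmeas2; bm.
have H1 : 2 * (b * \int[mu]_x (u x) ^+ 2) <=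
    \int[mu]_x \int[mu]_y \int[nu]_z (e x z * e y z * (u x + u y) ^+ 2).
  rewrite (_ : \int[mu]_x \int[mu]_y \int[nu]_z _ =
      \int[nu]_z \int[mu]_x \int[mu]_y (e x z * e y z * (u x + u y) ^+ 2));
    last first.
    have <- := Rint_swap mu nu
      (bmeas_Rint mu b3 : bmeas2 (fun x z =>
        \int[mu]_y (e x z * e y z * (u x + u y) ^+ 2))).
    by apply: eq_Rintegral => x _; exact: Rint_swap (b2 x).
  apply: (@le_trans _ _ (\int[nu]_z
      (2 * \int[mu]_x (e x z * (u x) ^+ 2 * \int[mu]_y e y z)))).
    rewrite RintZ; last by apply: bmeas_Rint; exact: (bmeas2_swap b2u).
    rewrite ler_pM2l// -(Rint_swap mu nu b2u) -RintZ; last by bm.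
    apply: (Rint_ae_le mD D0) => [| |x Dx]; [by bm|exact: bmeas_Rint|].
    rewrite (_ : \int[nu]_z _ = u x ^+ 2 *
        \int[nu]_z (e x z * \int[mu]_y e y z)); last first.
      by rewrite -RintZ; [apply: eq_Rintegral => z _; ring|by bm].
    by rewrite mulrC ler_wpM2l ?sqr_ge0// eb.
  apply: Rint_le => [| |z].
  - apply: bmeasM; first exact: bmeas_cst.
    by apply: bmeas_Rint; exact: (bmeas2_swap b2u).
  - by apply: bmeas_Rint; exact: (bmeas2_swap (bmeas_Rint _ b3)).
  have -> : \int[mu]_x \int[mu]_y (e x z * e y z * (u x + u y) ^+ 2) =
      2 * (\int[mu]_x (e x z * (u x) ^+ 2 * \int[mu]_y e y z)) +
      2 * (\int[mu]_x (e x z * u x)) ^+ 2.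
    rewrite RintZr; last by bm.
    set E := \int[mu]_y e y z; set p := \int[mu]_x (e x z * u x).
    set r := \int[mu]_x (e x z * u x ^+ 2).
    transitivity (\int[mu]_x (e x z * u x ^+ 2 * E + (e x z * u x) * (2 * p) +
        e x z * r)).
      apply: eq_Rintegral => x _; rewrite /E /r /p.
      rewrite [e x z * u x * (2 * _)]mulrA -!RintZ; [|by bm..].
      rewrite -!RintD; [|by bm..].
      by apply: eq_Rintegral => y _; ring.
    rewrite !RintD; [|by bm..]; rewrite !RintZr; [|by bm..].
    by rewrite -/E -/p -/r; ring.
  by rewrite lerDl mulr_ge0 ?sqr_ge0.
have H2 : \int[mu]_x \int[mu]_y \int[nu]_z (e x z * e y z * (u x + u y) ^+ 2) <=
    C1 * \int[mu]_x \int[mu]_y (s x y * (u x + u y) ^+ 2).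
  rewrite -RintZ; last by bm.
  apply: Rint_le => [| |x].
  - apply: bmeas_Rint.
    have mp : measurable_fun setT (fun q : T * T * Z => ((q.1.1, q.2), q.1.2)).
      apply: measurable_fun_pair; last exact: measurableT_comp.
      by apply: measurable_fun_pair => //; exact: measurableT_comp.
    by apply: bmeas_Rint; exact: (bmeas_comp mp b3).
  - by bm.
  rewrite -RintZ; last by bm.
  apply: Rint_le => [| |y]; [exact: bmeas_Rint|by bm|].
  rewrite RintZr; last by bm.
  by rewrite mulrA ler_wpM2r ?sqr_ge0.
have := le_trans H1 H2; set I2 := \int[mu]_x \int[mu]_y _ => H3.
have := rdot_le wM bu; set U := \int[mu]_x _ => H4.
apply: (@le_trans _ _ (b / C1 * U)).
  rewrite invfM mulrA -mulrA ler_wpM2l ?divr_ge0 ?(ltW C10)//.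
  by rewrite ler_pdivrMl.
rewrite mulrAC ler_pdivrMr//; move: H3; rewrite -/U.
by move: (b * U) I2 => p q; lra.
Qed.

(** For a centered [u] and total weight 1, the double integral of [w x w y (u x - u y)^2] is twice
    the squared norm. Linking [D] to itself is therefore a Poincaré inequality. The function [u0]
    keeps the set of Rayleigh quotients nonempty; [inf] of the empty set would be 0. *)
Lemma rgap_gt0 (D : set T) (M : R) u0 : measurable D -> mu (~` D) = 0%E ->
  0 < M -> (forall x, w x <= M) -> \int[mu]_x w x = 1 -> linked mu s D D ->
  centered u0 -> 0 < rdot u0 u0 -> 0 < rgap.
Proof.
move=> mD D0 M0 wM w1 [C C0 DD] cu0 uu0.
have MC : 0 < M ^+ 2 * C by rewrite mulr_gt0// exprn_gt0.
have Dir u : centered u -> rdot u u <= M ^+ 2 * C * (rdot u u - rdot (rop u) u).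
  move=> [bu u1].
  have bD : bmeas (\1_D : T -> R) by exact: bmeas_indic.
  have E : \int[mu]_x \int[mu]_y (w x * w y * (u x - u y) ^+ 2) = 2 * rdot u u.
    transitivity (\int[mu]_x (u x * u x * w x + w x * rdot u u)).
      apply: eq_Rintegral => x _.
      transitivity (\int[mu]_y (u x * u x * w x * w y +
          (- (2 * u x * w x)) * (u y * 1 * w y) + w x * (u y * u y * w y))).
        by apply: eq_Rintegral => y _; ring.
      rewrite !RintD; [|by bm..]; rewrite !RintZ; [|by bm..].
      by rewrite w1 -/(rdot u (fun=> 1)) u1 -/(rdot u u); ring.
    rewrite RintD; [|by bm..]; rewrite RintZr; last by bm.
    by rewrite w1 -/(rdot u u); ring.
  have bF : bmeas2 (fun x y => w x * w y * (u x - u y) ^+ 2).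
    by rewrite /bmeas2; bm.
  have bO : bmeas2 (fun x y : T => M ^+ 2 * (\1_D x * \1_D y * (u x - u y) ^+ 2)).
    by rewrite /bmeas2; bm.
  have H : \int[mu]_x \int[mu]_y (w x * w y * (u x - u y) ^+ 2) <=
      M ^+ 2 * osc mu D D u.
    rewrite /osc -RintZ; last by bm.
    apply: (Rint_ae_le mD D0) => [| |x Dx]; [by bm|by bm|].
    rewrite -RintZ; last by bm.
    apply: (Rint_ae_le mD D0) => [| |y Dy]; [by bm|by bm|].
    rewrite [leRHS]mulrA ler_wpM2r ?sqr_ge0// !indicE !mem_set// !mulr1 expr2.
    by rewrite ler_pM// ltW.
  rewrite (dirichlet_rop bu) -/(energy mu s u).
  have := DD u bu; have M2 : 0 < M ^+ 2 by rewrite exprn_gt0.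
  rewrite -(ler_pM2l M2); move: H; rewrite E.
  by move: (osc _ _ _ _) (energy _ _ _) (rdot _ _) => p q r; lra.
apply: (@lt_le_trans _ _ (M ^+ 2 * C)^-1); first by rewrite invr_gt0.
have [v [cv v1 _]] := normalized cu0 uu0.
apply: lb_le_inf; first by exists (rdot v v - rdot (rop v) v), v.
move=> _ [z [cz z1] <-]; have := Dir _ cz.
by rewrite -ler_pdivrMl// {1}z1 mulr1.
Qed.

(** The rate is [q = 1 - rgap]: the gap bounds [T] by [q] from above, the form bound on [1 + T]
    gives [T >= -q], and [rgap <= a / 2] keeps the holding part faster than [q]. *)
Lemma rop_iter_rgap (D : set T) kappa a b f n : 0 < a -> 0 < b ->
  0 <= kappa -> kappa / c <= b ^+ 2 -> rgap <= a / 2 -> rgap < 1 ->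
  (forall x, D x -> a <= rjump x) ->
  (forall x y, D x -> s x y <= kappa * w x) ->
  (forall u, centered u -> rgap * rdot u u <= rdot u u + rdot (rop u) u) ->
  centered f -> rdot f f <= 1 -> (forall x, D x -> `|f x| <= 1) ->
  forall x, D x -> `|iter n rop f x| <= (1 + 2 * b / a) * (1 - rgap) ^+ n.
Proof.
move=> a0 b0 k0 kb ga g1 aD sD lb cf f1 fD x Dx.
apply: (rop_iter_pointwise n a0 b0 k0 kb _ _ aD sD) => //; try by lra.
move=> u cu; rewrite ler_norml; have := rgap_le cu; have := lb u cu.
by move: (rdot u u) (rdot (rop u) u) rgap => p q r H1 H2; apply/andP; split; lra.
Qed.

End reversible_kernel.

(** * The Metropolis operator *)

Section density_measure.
Local Open Scope ereal_scope.
Context d (T : measurableType d) {R : realType} (mu : {measure set T -> \bar R}).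
Variables (D : set T) (f : T -> R).

(** The proofs are arguments so that a measure structure can be attached to the set function
    itself. *)
Definition density_measure (mD : measurable D) (mf : measurable_fun D f)
    (f0 : forall x, D x -> (0 <= f x)%R) (A : set T) :=
  \int[mu]_(x in A `&` D) (f x)%:E.

Hypotheses (mD : measurable D) (mf : measurable_fun D f).
Hypothesis f0 : forall x, D x -> (0 <= f x)%R.

Local Notation dens := (density_measure mD mf f0).

Let dens0 : dens set0 = 0.
Proof. by rewrite /density_measure set0I integral_set0. Qed.

Let dens_ge0 A : 0 <= dens A.
Proof. by apply: integral_ge0 => x [_ /f0]; rewrite lee_fin. Qed.

Let dens_sigma_additive : semi_sigma_additive dens.
Proof.
move=> F mF tF mUF; rewrite /density_measure setI_bigcupl.
rewrite ge0_integral_bigcup.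
- by apply: is_cvg_ereal_nneg_natsum_cond => n _ _; exact: dens_ge0.
- by move=> k; exact: measurableI.
- apply/measurable_EFinP; apply: measurable_funS mf => //.
  by move=> x [k _ []].
- by move=> x [k _ [_ /f0]]; rewrite lee_fin.
- move=> i j _ _ [x [[Fi _] [Fj _]]]; apply: tF => //; by exists x.
Qed.

HB.instance Definition _ := isMeasure.Build _ _ _ dens
  dens0 dens_ge0 dens_sigma_additive.

Let integral_density_indic E : measurable E ->
  \int[dens]_(x in D) (\1_E x)%:E = \int[mu]_(x in D) (\1_E x * f x)%:E.
Proof.
move=> mE; rewrite integral_indic//= /density_measure -setIA setIid setIC.
rewrite integral_mkcondr; apply: eq_integral => x xD.
by rewrite patchE indicE; case: ifPn; rewrite ?mul1r ?mul0r.
Qed.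

Import HBNNSimple.

Let integral_density_nnsfun (g : {nnsfun T >-> R}) :
  \int[dens]_(x in D) (g x)%:E = \int[mu]_(x in D) (g x * f x)%:E.
Proof.
under [LHS]eq_integral do rewrite fimfunE -fsumEFin//.
rewrite [LHS]ge0_integral_fsum//; last 2 first.
  - by move=> r; exact/measurable_EFinP/measurableT_comp.
  - by move=> n x _; rewrite EFinM nnfun_muleindic_ge0.
under [RHS]eq_integral.
  move=> x xD; rewrite EFinM fimfunE -fsumEFin// ge0_mule_fsuml; last first.
    by move=> r; rewrite EFinM nnfun_muleindic_ge0.
  over.
have mfE : measurable_fun D (EFin \o f) by exact/measurable_EFinP.
rewrite [RHS]ge0_integral_fsum//; last 2 first.
  - move=> r; apply: emeasurable_funM => //.
    by apply/measurable_EFinP; apply: measurable_funM.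
  - move=> n x /f0 fx; apply: mule_ge0; last by rewrite lee_fin.
    by rewrite EFinM nnfun_muleindic_ge0.
apply: eq_fsbigr => r _.
rewrite integralZl_indic_nnsfun// integral_density_indic//.
have [r0|r0] := ltP r 0%R.
  rewrite preimage_nnfun0//; rewrite [RHS]integral0_eq ?integral0_eq ?mule0//.
  - by move=> x _; rewrite indic0 mul0r.
  - by move=> x _; rewrite indic0 mulr0 mul0e.
rewrite -ge0_integralZl//; last 2 first.
- by apply/measurable_EFinP; apply: measurable_funM.
- by move=> x /f0 fx; rewrite lee_fin mulr_ge0.
by apply: eq_integral => x _; rewrite !EFinM muleA.
Qed.

(** From indicators to simple functions to monotone limits. The iterated kernel is defined by
    integrals against [metropolis_kernel], whose jump part is such a density measure. *)
Lemma ge0_integral_density (g : T -> \bar R) : measurable_fun D g ->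
  (forall x, D x -> 0 <= g x) ->
  \int[dens]_(x in D) g x = \int[mu]_(x in D) (g x * (f x)%:E).
Proof.
move=> mg g0; pose g_ := nnsfun_approx mD mg.
transitivity (limn (fun n => \int[dens]_(x in D) (g_ n x)%:E)).
  rewrite -monotone_convergence//=.
  - apply: eq_integral => x /[!inE] xD; apply/esym/cvg_lim => //=.
    exact: cvg_nnsfun_approx.
  - by move=> n; apply: measurableT_comp => //; exact: measurable_funTS.
  - by move=> n x _; rewrite lee_fin.
  - by move=> x _ a b ab; rewrite lee_fin//; exact/lefP/nd_nnsfun_approx.
rewrite (_ : \int[mu]_(x in D) _ =
    limn (fun n => \int[mu]_(x in D) (g_ n x * f x)%:E)).
  by congr (limn _); apply/funext => n; rewrite integral_density_nnsfun.
rewrite -monotone_convergence//=.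
- apply: eq_integral => x /[!inE] xD; apply/esym/cvg_lim => //=.
  under eq_fun do rewrite EFinM; apply: cvgeZr => //.
  exact: cvg_nnsfun_approx.
- move=> n; apply/measurable_EFinP; apply: measurable_funM => //.
  exact: measurable_funTS.
- by move=> n x /f0 fx; rewrite lee_fin mulr_ge0.
- move=> x /f0 fx a b ab; rewrite lee_fin ler_wpM2r//.
  exact/lefP/nd_nnsfun_approx.
Qed.

End density_measure.

(** * The Metropolis kernel as a reversible kernel on the whole space *)

Section metropolis_reduction.
Context {R : realType} {d : nat}.
Local Notation leb := (lebesgue_rV (R := R) d).

Lemma enorm_lt1 n (x : 'rV[R]_n) : (enorm x < 1) = (dotv x x < 1).
Proof. by rewrite /enorm -[X in _ < X]sqrtr1 ltr_sqrt. Qed.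

Lemma bmeas_coordB n (i : 'I_n) : measurable_fun setT
  (fun p : 'rV[R]_n * 'rV[R]_n => p.1 0 i - p.2 0 i).
Proof.
apply: measurable_funB.
- exact: (measurableT_comp (measurable_coordv i) measurable_fst).
- exact: (measurableT_comp (measurable_coordv i) measurable_snd).
Qed.

Lemma bmeas2_phi (h : R) : bmeas2 (fun x y : 'rV[R]_d => phi (h^-1 *: (x - y))).
Proof.
rewrite /bmeas2 /phi; apply: bmeasM; first exact: bmeas_cst.
pose F (p : 'rV[R]_d * 'rV[R]_d) := \sum_i (h^-1 * (p.1 0 i - p.2 0 i)) ^+ 2.
have mF : measurable_fun setT F.
  apply: measurable_sum => i; apply: measurable_funX.
  by apply: measurable_funM => //; exact: bmeas_coordB.
pose A := F @^-1` `]-oo, 1[.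
have mA : measurable A.
  by rewrite -[A]setTI; apply: mF => //; exact: measurable_itv.
have FE p : (enorm (h^-1 *: (p.1 - p.2)) < 1) = (F p < 1).
  rewrite enorm_lt1 /dotv /F; congr (_ < 1); apply: eq_bigr => i _.
  by rewrite !mxE expr2.
rewrite (_ : (fun p => _) = \1_A); first exact: bmeas_indic.
apply/funext => p; rewrite !indicE; congr (_%:R); congr nat_of_bool.
apply/idP/idP => /set_mem H; apply/mem_set; move: H => /=;
  by rewrite /A/= in_itv/= FE.
Qed.

Variables (Omega : set 'rV[R]_d) (rho : 'rV[R]_d -> R) (h m M : R).
Hypotheses (mO : measurable Omega) (Ooo : (leb Omega < +oo)%E).
Hypotheses (h_gt0 : 0 < h) (mrho : measurable_fun Omega rho) (m_gt0 : 0 < m).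
Hypothesis mM : m <= M.
Hypothesis rho_bounds : forall x, Omega x -> m <= rho x <= M.

Definition restr_leb : {finite_measure set 'rV[R]_d -> \bar R} := mfrestr mO Ooo.
Local Notation mu := restr_leb.

(** The value [m] outside [Omega] makes the bounds on the weight hold everywhere; that region is
    null for [restr_leb]. *)
Definition weight (x : 'rV[R]_d) : R := if x \in Omega then rho x else m.

(** On [Omega] this is [rho x] times the Metropolis density, since [rho x * min (rho y / rho x) 1 =
    min (rho x) (rho y)]. *)
Definition sym_density (x y : 'rV[R]_d) : R :=
  h ^- d * phi (h^-1 *: (x - y)) * Num.min (weight x) (weight y).

Local Notation w := weight.
Local Notation s := sym_density.

Lemma weight_ge x : m <= w x.
Proof. by rewrite /weight; case: ifPn => // /set_mem/rho_bounds/andP[]. Qed.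

Lemma weight_le x : w x <= M.
Proof. by rewrite /weight; case: ifPn => // /set_mem/rho_bounds/andP[]. Qed.

Lemma weightE x : Omega x -> w x = rho x.
Proof. by move=> Ox; rewrite /weight mem_set. Qed.

Lemma bmeas_weight : bmeas w.
Proof.
split; last first.
  by exists M => x; rewrite gtr0_norm ?weight_le// (lt_le_trans m_gt0)// weight_ge.
have -> : w = (fun x => (rho \_ Omega) x + (cst m \_ (~` Omega)) x).
  apply/funext => x; rewrite /weight !patchE in_setC.
  by case: (x \in Omega) => /=; rewrite ?addr0 ?add0r.
by apply: measurable_funD; apply/(measurable_restrictT _ _).1 => //; exact: measurableC.
Qed.

Lemma bmeas_sym_density : bmeas2 s.
Proof.
rewrite /bmeas2 /sym_density; apply: bmeasM.
  by apply: bmeasM; [exact: bmeas_cst|exact: bmeas2_phi].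
have bw := bmeas_weight; split.
  apply: measurable_minr.
  - exact: (measurableT_comp bw.1 measurable_fst).
  - exact: (measurableT_comp bw.1 measurable_snd).
exists M => p; rewrite gtr0_norm; first by rewrite ge_min weight_le.
by rewrite lt_min !(lt_le_trans m_gt0 (weight_ge _)).
Qed.

Lemma phi_ge0 (z : 'rV[R]_d) : 0 <= phi z.
Proof. by rewrite /phi mulr_ge0// invr_ge0 fine_ge0. Qed.

Lemma phi_le (z : 'rV[R]_d) : phi z <= (fine (leb [set x | enorm x < 1]))^-1.
Proof.
by rewrite /phi ler_piMr ?invr_ge0 ?fine_ge0.
Qed.

Lemma phiN (z : 'rV[R]_d) : phi (- z) = phi z.
Proof.
rewrite /phi; congr (_ * _); rewrite !indicE; congr (_%:R); congr nat_of_bool.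
have E : enorm (- z) = enorm z.
  by rewrite /enorm /dotv; under eq_bigr do rewrite !mxE mulrNN.
by apply/idP/idP => /set_mem H; apply/mem_set; move: H; rewrite /= E.
Qed.

Lemma sym_densityC x y : s x y = s y x.
Proof. by rewrite /sym_density minC -(opprB y x) scalerN phiN. Qed.

Lemma sym_density_ge0 x y : 0 <= s x y.
Proof.
rewrite /sym_density mulr_ge0//; last first.
  by rewrite le_min !(le_trans (ltW m_gt0) (weight_ge _)).
by rewrite mulr_ge0 ?phi_ge0// invr_ge0 exprn_ge0// ltW.
Qed.

Lemma sym_density_le x y :
  s x y <= h ^- d * (fine (leb [set x | enorm x < 1]))^-1 * w x.
Proof.
rewrite /sym_density ler_pM// ?ge_min ?lexx//.
- by rewrite mulr_ge0 ?phi_ge0// invr_ge0 exprn_ge0// ltW.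
- by rewrite le_min !(le_trans (ltW m_gt0) (weight_ge _)).
- by rewrite ler_wpM2l ?phi_le// invr_ge0 exprn_ge0// ltW.
Qed.

Lemma metropolis_densityE x y : Omega x -> Omega y ->
  metropolis_density rho h x y = s x y / w x.
Proof.
move=> Ox Oy; rewrite /metropolis_density /sym_density !weightE//.
have r0 : 0 < rho x by have /andP[+ _] := rho_bounds Ox; exact: lt_le_trans.
rewrite -[RHS]mulrA; congr (_ * _).
by rewrite minr_pMl ?invr_ge0 ?(ltW r0)// divff ?gt_eqF// minC.
Qed.

Lemma restr_leb_setC : mu (~` Omega) = 0%E.
Proof. by rewrite /= /mfrestr /mrestr setICl. Qed.

Lemma integral_restr (f : 'rV[R]_d -> \bar R) (g : 'rV[R]_d -> R) : bmeas g ->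
  (forall x, Omega x -> f x = (g x)%:E) ->
  (\int[leb]_(x in Omega) f x = (\int[mu]_x g x)%:E)%E.
Proof.
move=> bg fg.
rewrite (eq_measure_integral mu); last first.
  by move=> A mA AO; rewrite /= /mfrestr /mrestr setIidl.
rewrite (EFin_Rint _ bg) (eq_integral (EFin \o g)); last first.
  by move=> x /set_mem/fg.
rewrite [RHS](_ : _ = \int[mu]_(x in Omega `|` ~` Omega) (EFin \o g) x)%E; last first.
  by rewrite setUv.
have mg : measurable_fun setT (EFin \o g) by apply/measurable_EFinP; case: bg.
rewrite integral_setU//; last 3 first.
- exact: measurableC.
- exact: measurable_funTS.
- apply/disj_setPS => x [] //.
rewrite (null_set_integral _ _ restr_leb_setC) ?adde0//.
- exact: measurableC.
- exact: measurable_funTS.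
Qed.

Lemma Rintegral_restr (f g : 'rV[R]_d -> R) : bmeas g ->
  (forall x, Omega x -> f x = g x) ->
  \int[leb]_(x in Omega) f x = \int[mu]_x g x.
Proof.
by move=> bg fg; rewrite /Rintegral (integral_restr bg)// => x /fg ->.
Qed.

Local Notation rop := (rop mu w s).

Lemma rjumpE x : rjump mu w s x = \int[mu]_y (s x y / w x).
Proof.
rewrite /rjump mulrC RintZr//; exact: bmeas2_l bmeas_sym_density.
Qed.

Lemma holding_probE x : Omega x ->
  holding_prob Omega rho h x = 1 - rjump mu w s x.
Proof.
move=> Ox; have bs := bmeas_sym_density.
rewrite /holding_prob rjumpE; congr (_ - _).
apply: Rintegral_restr => [|y Oy]; last exact: metropolis_densityE.
by bm.
Qed.

Lemma metropolis_opE u x : bmeas u -> Omega x ->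
  metropolis_op Omega rho h u x = rop u x.
Proof.
move=> bu Ox; have bs := bmeas_sym_density.
rewrite /metropolis_op holding_probE// /rop; congr (_ + _).
rewrite mulrC -RintZr; last by bm.
apply: Rintegral_restr => [|y Oy]; first by bm.
by rewrite metropolis_densityE// mulrAC.
Qed.

Hypothesis rjump_le1 : forall x, rjump mu w s x <= 1.

Lemma integral_metropolis_kernel x (f : 'rV[R]_d -> \bar R) g :
  Omega x -> bmeas g -> (forall y, 0 <= g y) ->
  (forall y, Omega y -> f y = (g y)%:E) ->
  (\int[metropolis_kernel Omega rho h x]_(y in Omega) f y = (rop g x)%:E)%E.
Proof.
move=> Ox bg g0 fg; have bs := bmeas_sym_density.
have md : measurable_fun Omega (metropolis_density rho h x).
  apply: (@eq_measurable_fun _ _ _ _ Omega (fun y => s x y / w x)).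
    by move=> y /set_mem Oy; rewrite metropolis_densityE.
  by apply: measurable_funTS; have [] : bmeas (fun y => s x y / w x) by bm.
have d0 y : Omega y -> 0 <= metropolis_density rho h x y.
  move=> Oy; rewrite metropolis_densityE// divr_ge0 ?sym_density_ge0//.
  exact: le_trans (ltW m_gt0) (weight_ge _).
have hold0 : 0 <= holding_prob Omega rho h x by rewrite holding_probE// subr_ge0.
(* The kernel is a bare set function; the laws of integration apply once it is recognised as this
   sum of measures. *)
pose K := measure_add (mscale (NngNum hold0) (dirac x)) (density_measure leb mO md d0).
have -> : metropolis_kernel Omega rho h x = K.
  by apply/funext => A; rewrite /K measure_addE.
rewrite (eq_integral (EFin \o g)); last by move=> y /set_mem/fg.
have mg : measurable_fun Omega (EFin \o g).
  by apply: measurable_funTS; apply/measurable_EFinP; case: bg.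
have g0E y : Omega y -> (0 <= (g y)%:E)%E by rewrite lee_fin.
rewrite ge0_integral_measure_add// ge0_integral_mscale// integral_dirac//.
rewrite ge0_integral_density//= diracE mem_set// mul1e.
rewrite (@integral_restr _ (fun y => (w x)^-1 * (s x y * g y))); [|by bm|].
  rewrite RintZ; last by bm.
  by rewrite -EFinM -EFinD /rop holding_probE.
by move=> y Oy; rewrite metropolis_densityE// -EFinM; congr EFin; ring.
Qed.

Lemma rop_ge0 u : (forall x, 0 <= u x) -> forall x, 0 <= rop u x.
Proof.
move=> u0 x; rewrite addr_ge0//; first by rewrite mulr_ge0// subr_ge0.
rewrite mulr_ge0 ?invr_ge0//; first exact: le_trans (ltW m_gt0) (weight_ge _).
by apply: Rint_ge0 => y; rewrite mulr_ge0 ?sym_density_ge0.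
Qed.

Lemma bmeas_iter_rop n u : bmeas u -> bmeas (iter n rop u).
Proof.
move=> bu; elim: n => //= n; apply: bmeas_rop; first exact: m_gt0.
- exact: weight_ge.
- exact: bmeas_weight.
- exact: bmeas_sym_density.
Qed.

Lemma metropolis_iterE n x A : measurable A -> Omega x ->
  metropolis_iter Omega rho h n x A = (iter n rop (\1_A) x)%:E.
Proof.
move=> mA; elim: n x => [|n IH] x Ox /=; first by rewrite diracE indicE.
have b1 : bmeas (iter n rop (\1_A)) by apply: bmeas_iter_rop; exact: bmeas_indic.
apply: integral_metropolis_kernel => // y.
by elim: n {IH b1} y => [|n IH] y /=; [rewrite indicE|exact: rop_ge0].
Qed.

Lemma mu_rhoE A : measurable A ->
  mu_rho Omega rho A = (\int[mu]_x (\1_A x * w x))%:E.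
Proof.
move=> mA; have bw := bmeas_weight; have bA := bmeas_indic (R := R) mA.
rewrite /mu_rho setIC integral_mkcondr; apply: integral_restr; first by bm.
move=> x Ox; rewrite patchE indicE weightE//.
by case: (x \in A); rewrite ?mul1r ?mul0r.
Qed.

Hypothesis w1 : \int[mu]_x w x = 1.

Local Notation rdot := (rdot mu w).
Local Notation centered := (centered mu w).
Local Notation rgap := (rgap mu w s).

(* With [a] a lower bound of the jump probability and [b^2] an upper bound of
   the density relative to [rho dx], the [L^2] rate is transferred to the total
   variation distance. *)
Lemma TV_dist_rgap a b n : 0 < a -> 0 < b ->
  h ^- d * (fine (leb [set x | enorm x < 1]))^-1 / m <= b ^+ 2 ->
  rgap <= a / 2 -> rgap < 1 ->
  (forall x, Omega x -> a <= rjump mu w s x) ->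
  (forall u, centered u -> rgap * rdot u u <= rdot u u + rdot (rop u) u) ->
  (ereal_sup [set TV_dist (metropolis_iter Omega rho h n x)
                          (mu_rho Omega rho) | x in Omega] <=
   ((1 + 2 * b / a) * (1 - rgap) ^+ n)%:E)%E.
Proof.
move=> a0 b0 kb ga g1 aO lb.
have bw := bmeas_weight; have bs := bmeas_sym_density.
apply: ub_ereal_sup => _ [x Ox <-]; apply: ub_ereal_sup => _ [A mA <-].
have bA := bmeas_indic (R := R) mA.
rewrite metropolis_iterE// mu_rhoE//; set p := \int[mu]_x _.
have A01 y : 0 <= (\1_A y : R) <= 1.
  by rewrite indicE; case: (_ \in _); rewrite ?ler01 ?lexx.
have p01 : 0 <= p <= 1.
  apply/andP; split.
    apply: Rint_ge0 => y; rewrite mulr_ge0//.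
    exact: le_trans (ltW m_gt0) (weight_ge _).
  rewrite -w1; apply: Rint_le => [| |y]; [by bm|by []|].
  by rewrite ler_piMl ?(le_trans (ltW m_gt0) (weight_ge _))//; case/andP: (A01 y).
(* [t^n(x, A) - mu_rho A] is the value at [x] of the [n]-th iterate on this centered function, whose
   bounds are uniform in [A]. The form [u + t * v] is the one of [rop_lin]. *)
pose f := fun y => (\1_A y : R) + (- p) * 1.
have bf : bmeas f by rewrite /f; bm.
have fE : iter n rop f = fun y => iter n rop (\1_A) y + (- p) * 1.
  elim: n => //= n ->; rewrite (rop_lin mu w bs); [|exact: bmeas_iter_rop|by bm].
  by apply/funext => y; rewrite rop1.
have -> : (`|(iter n rop (\1_A) x)%:E - p%:E| = `|iter n rop f x|%:E)%E.
  by rewrite fE mulr1.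
rewrite lee_fin.
have fle y : `|f y| <= 1.
  rewrite /f mulr1 ler_norml; have /andP[? ?] := A01 y; have /andP[? ?] := p01.
  by apply/andP; split; lra.
have cf : centered f.
  split=> //; rewrite /f rdot_lin//; try by bm.
  rewrite /rdot (_ : \int[mu]_y (1 * 1 * w y) = 1); last first.
    by rewrite -[RHS]w1; apply: eq_Rintegral => y _; rewrite !mul1r.
  rewrite (_ : \int[mu]_y (\1_A y * 1 * w y) = p) ?mulr1 ?subrr//.
  by apply: eq_Rintegral => y _; rewrite mulr1.
have f1 : rdot f f <= 1.
  rewrite -w1; apply: Rint_le => [| |y]; [by bm|by []|].
  rewrite ler_piMl ?(le_trans (ltW m_gt0) (weight_ge _))//.
  by rewrite -expr2 -real_normK ?num_real// expr_le1.
have k0 : 0 <= h ^- d * (fine (leb [set x | enorm x < 1]))^-1.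
  by rewrite mulr_ge0 ?invr_ge0 ?fine_ge0// exprn_ge0// ltW.
apply: (rop_iter_rgap m_gt0 weight_ge bw bs sym_densityC sym_density_ge0
  rjump_le1 n a0 b0 k0 kb ga g1 aO _ lb cf f1 _ Ox) => //.
by move=> y z _; exact: sym_density_le.
Qed.

Lemma L2_bmeas u v : bmeas v -> (forall x, Omega x -> u x = v x) ->
  L2 Omega rho u /\ L2norm Omega rho u = Num.sqrt (rdot v v).
Proof.
move=> bv uv; have bw := bmeas_weight.
have E x : Omega x -> u x ^+ 2 * rho x = v x * v x * w x.
  by move=> Ox; rewrite uv// weightE// expr2.
split; last by congr Num.sqrt; apply: Rintegral_restr => //; bm.
split.
  apply: (@eq_measurable_fun _ _ _ _ Omega v) => [x /set_mem/uv //|].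
  by apply: measurable_funTS; case: bv.
rewrite (@integral_restr _ (fun x => v x * v x * w x)) ?ltry//; first by bm.
by move=> x Ox; rewrite E.
Qed.

(* Approximate eigenfunctions contradict the existence of a bounded inverse, so
   no completeness of [L^2] is needed. *)
Lemma spectral_gap_le u0 : centered u0 -> 0 < rdot u0 u0 -> 0 < rgap ->
  spectral_gap Omega rho h <= rgap.
Proof.
move=> cu0 uu0 G0.
have bw := bmeas_weight; have bs := bmeas_sym_density.
have -> : rgap = `|1 - (1 - rgap)| by rewrite opprB addrC subrK gtr0_norm.
apply: ge_inf; first by exists 0 => _ [y _ <-].
exists (1 - rgap) => //; split; last first.
  by move=> /= /eqP; rewrite -subr_eq0 addrAC subrr sub0r oppr_eq0 gt_eqF.
move=> [B [[K BK] BA _]].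
(* The square appears because [K] bounds norms, while the lemma compares squared norms. *)
have [u cu uK] := rgap_not_resolvent m_gt0 weight_ge bw bs sym_densityC
  sym_density_ge0 rjump_le1 (`|K| ^+ 2) cu0 uu0.
have bu : bmeas u by case: cu.
pose v x := (1 - rgap) * u x - rop u x.
have bv : bmeas v.
  rewrite /v; bm.
  exact: (bmeas_rop mu m_gt0 weight_ge bw bs).
pose v' x := - 1 * v x.
have bv' : bmeas v' by rewrite /v'; bm.
set Au := fun x => metropolis_op Omega rho h u x - (1 - rgap) * u x.
have AuE x : Omega x -> Au x = v' x.
  by move=> Ox; rewrite /Au metropolis_opE// /v' /v mulN1r opprB.
have [LA nA] := L2_bmeas bv' AuE.
have [LB nB] := BK _ LA.
have [Lu nu] := L2_bmeas bu (fun _ _ => erefl).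
have eBu := BA _ Lu.
have nBu : L2norm Omega rho (B Au) = Num.sqrt (rdot u u).
  rewrite -nu /L2norm; congr Num.sqrt; rewrite /Rintegral; congr fine.
  apply: ae_eq_integral => //.
  - apply/measurable_EFinP/measurable_funM => //.
    by apply: measurable_funX; case: LB.
  - apply/measurable_EFinP/measurable_funM => //.
    by apply: measurable_funX; case: Lu.
  - by apply: filterS eBu => x /= H Ox; rewrite H.
move: nB; rewrite nBu nA; apply/negP; rewrite -ltNge.
have -> : rdot v' v' = rdot v v.
  by apply: eq_Rintegral => x _; rewrite /v'; ring.
apply: (@le_lt_trans _ _ (`|K| * Num.sqrt (rdot v v))).
  by rewrite ler_wpM2r ?sqrtr_ge0// ler_norm.
rewrite -(@ltr_pXn2r _ 2) ?nnegrE ?sqrtr_ge0 ?mulr_ge0 ?sqrtr_ge0//.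
by rewrite exprMn !sqr_sqrtr ?(rdot_ge0 mu m_gt0 weight_ge).
Qed.

End metropolis_reduction.

(** * Lebesgue measure of cubes and affine images *)

Section lebesgue_cubes.
Context {R : realType}.
Local Notation leb n := (lebesgue_rV (R := R) n).

Definition box n (a b : 'I_n -> R) : set 'rV[R]_n :=
  [set v | forall i, a i < v 0 i < b i].

Definition cube n (c : 'rV[R]_n) (r : R) : set 'rV[R]_n :=
  [set v | forall i, `|v 0 i - c 0 i| < r].

Lemma boxE n (a b : 'I_n -> R) : box a b =
  [set v : 'rV[R]_n | forall i, `]a i, b i[%classic (v 0 i)].
Proof. by apply/seteqP; split => v H i; have := H i; rewrite /= in_itv. Qed.

Lemma cubeE n (c : 'rV[R]_n) r :
  cube c r = box (fun i => c 0 i - r) (fun i => c 0 i + r).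
Proof.
by apply/seteqP; split => v H i; have := H i; rewrite ltr_distl.
Qed.

Lemma measurable_box n (a b : 'I_n -> R) : measurable (box a b).
Proof.
rewrite boxE (_ : [set v | _] = \bigcap_(i in [set: 'I_n])
    ((fun v : 'rV[R]_n => v 0 i) @^-1` `]a i, b i[%classic)).
  apply: fin_bigcap_measurable => [|i _]; first exact: (@finite_finset 'I_n).
  rewrite -[X in measurable X]setTI.
  by apply: (@measurable_coordv _ n i measurableT); exact: measurable_itv.
by apply/seteqP; split => v vA i; [move=> _; exact: vA|exact: vA].
Qed.

Lemma measurable_cube n (c : 'rV[R]_n) r : measurable (cube c r).
Proof. by rewrite cubeE; exact: measurable_box. Qed.

Lemma leb_box n (a b : 'I_n -> R) : (forall i, a i <= b i) ->
  leb n (box a b) = (\prod_i (b i - a i))%:E.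
Proof.
move=> ab; rewrite boxE.
rewrite (lebesgue_rV_box (A := fun i => `]a i, b i[%classic)) => [|i]; last first.
  exact: measurable_itv.
rewrite -prodEFin; apply: eq_bigr => i _.
rewrite lebesgue_measure_itv/= lte_fin; case: ltP => // ba.
by have -> : a i = b i; [apply/eqP; rewrite eq_le ab|rewrite subrr].
Qed.

Lemma leb_cube n (c : 'rV[R]_n) r : 0 <= r -> leb n (cube c r) = ((2 * r) ^+ n)%:E.
Proof.
move=> r0; rewrite cubeE leb_box => [|i]; last by lra.
rewrite (eq_bigr (fun=> 2 * r)); last by move=> i _; ring.
by rewrite prodr_const card_ord.
Qed.

Lemma cube_ball n (c : 'rV[R]_n) r : 0 < r -> cube c r = ball c r.
Proof.
move=> r0; apply/seteqP; split => [v H|v [_ H] i]; last first.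
  by have := H 0 i; rewrite /ball/= distrC.
by split => // i j; rewrite ord1 /ball/= distrC; exact: H.
Qed.

Lemma open_cube n (c : 'rV[R]_n) r : 0 < r -> open (cube c r).
Proof. by move=> r0; rewrite cube_ball//; exact: ball_open. Qed.

Lemma nbhs_cube n (c : 'rV[R]_n) (A : set 'rV[R]_n) :
  nbhs c A <-> exists2 r, 0 < r & cube c r `<=` A.
Proof.
split; first by move=> /nbhs_ballP[r r0 rA]; exists r; rewrite ?cube_ball.
by move=> [r r0 rA]; apply/nbhs_ballP; exists r => //; rewrite -cube_ball.
Qed.

Lemma cube_center n (c : 'rV[R]_n) r : 0 < r -> cube c r c.
Proof. by move=> r0 i; rewrite subrr normr0. Qed.

Lemma coord_le_enorm n (v : 'rV[R]_n) i : `|v 0 i| <= enorm v.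
Proof.
rewrite -sqrtr_sqr ler_sqrt; last first.
  by apply: sumr_ge0 => j _; rewrite -expr2 sqr_ge0.
rewrite /dotv (bigD1 i)//= -expr2 lerDl; apply: sumr_ge0 => j _.
by rewrite -expr2 sqr_ge0.
Qed.

(** The squares sum to at most [r^2 n / (n + 1)^2 < r^2]; the divisor [n + 1] also covers dimension
    0. *)
Lemma enorm_lt n (v : 'rV[R]_n) r : 0 < r ->
  (forall i, `|v 0 i| < r / n.+1%:R) -> enorm v < r.
Proof.
move=> r0 vr; rewrite -(ger0_norm (ltW r0)) -sqrtr_sqr ltr_sqrt ?exprn_gt0//.
apply: (@le_lt_trans _ _ (\sum_(i < n) (r / n.+1%:R) ^+ 2)).
  apply: ler_sum => i _; rewrite -expr2 -real_normK ?num_real//.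
  by apply: lerXn2r; rewrite ?nnegrE ?divr_ge0 ?(ltW r0)// ltW.
have n0 : 0 < n.+1%:R :> R by rewrite ltr0n.
rewrite sumr_const card_ord -[_ *+ n]mulr_natr.
have -> : (r / n.+1%:R) ^+ 2 * n%:R = r ^+ 2 * (n%:R / n.+1%:R ^+ 2).
  by field; rewrite gt_eqF.
rewrite gtr_pMr ?exprn_gt0// ltr_pdivrMr ?exprn_gt0// mul1r -natrX ltr_nat.
by rewrite expnS expn1 mulSn addSn ltnS (leq_trans _ (leq_addr _ _)).
Qed.

(** The argument of [phi] in the kernel; the preimage of [A] is [x - h A] when [h] is nonzero. *)
Definition affv n (x : 'rV[R]_n) (h : R) (y : 'rV[R]_n) := h^-1 *: (x - y).

Lemma measurable_affv n (x : 'rV[R]_n) h : measurable_fun setT (affv x h).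
Proof.
apply: (@measurability _ _ _ _ setT _ (@open 'rV[R]_n)) => // _ [U oU <-].
rewrite setTI; apply: open_rV_measurable; apply: open_comp => // y _.
have c1 : {for y, continuous (fun y : 'rV[R]_n => x - y)}.
  by apply: continuousB; [exact: cst_continuous|exact: cvg_id].
have c2 : {for x - y, continuous (fun z : 'rV[R]_n => h^-1 *: z)}.
  exact: scaler_continuous.
exact: continuous_comp c1 c2.
Qed.

Lemma measurable_rV_boxes n : @measurable _ 'rV[R]_n =
  <<s [set box ab.1 ab.2 | ab in [set: ('I_n -> R) * ('I_n -> R)]] >>.
Proof.
apply/seteqP; split.
- apply: smallest_sub; first exact: smallest_sigma_algebra.
  move=> U oU; set G := [set box _ _ | _ in _].
  suff : @measurable _ (g_sigma_algebraType G) U by [].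
  rewrite (open_rV_bigcup_ball oU) bigcup_mkcond.
  apply: countable_bigcupT_measurable => [|cr]; first exact: countableP.
  case: ifPn => // _; have [r0|r0] := ltP 0 (ratr cr.2 : R).
    rewrite -cube_ball// cubeE; set c : 'rV[R]_n := map_mx _ _.
    apply: sub_sigma_algebra.
    by exists (fun i => c 0 i - ratr cr.2, fun i => c 0 i + ratr cr.2).
  rewrite (_ : ball _ _ = set0); first exact: measurable0.
  by apply/seteqP; split => // y []; rewrite ltNge r0.
- apply: smallest_sub; first exact: smallest_sigma_algebra.
  by move=> _ [ab _ <-]; exact: measurable_box.
Qed.

(** Both sides are measures in [A] that agree on boxes, a generating family stable under
    intersection, and are finite on the boxes [g k], which exhaust the space. *)
Lemma leb_affv n (x : 'rV[R]_n) h (A : set 'rV[R]_n) : 0 < h -> measurable A ->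
  leb n (affv x h @^-1` A) = ((h ^+ n)%:E * leb n A)%E.
Proof.
move=> h0 mA; have hn0 : 0 <= h ^+ n by rewrite exprn_ge0// ltW.
pose m0 : {measure set 'rV[R]_n -> \bar R} := pushforward (leb n) (affv x h).
pose m1 := m0 (measurable_affv x h).
pose m2 : {measure set 'rV[R]_n -> \bar R} := mscale (NngNum hn0) (leb n).
change (m1 A = m2 A).
have bE (a b : 'I_n -> R) : affv x h @^-1` box a b =
    box (fun i => x 0 i - h * b i) (fun i => x 0 i - h * a i).
  apply/seteqP; split => v H i; have := H i; rewrite !mxE [h^-1 * _]mulrC;
    rewrite ltr_pdivlMr// ltr_pdivrMr// => /andP[H1 H2]; apply/andP; split; lra.
pose g k : set 'rV[R]_n := box (fun=> - k%:R) (fun=> k%:R).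
apply: (measure_unique _ g (@measurable_rV_boxes n)) => //.
- move=> _ _ [[a b] _ <-] [[a' b'] _ <-].
  exists (fun i => Num.max (a i) (a' i), fun i => Num.min (b i) (b' i)) => //=.
  apply/seteqP; split => v /=.
    move=> H; split => i; have := H i; rewrite gt_max lt_min.
      by move=> /andP[/andP[-> _] /andP[-> _]].
    by move=> /andP[/andP[_ ->] /andP[_ ->]].
  move=> [H H'] i; rewrite gt_max lt_min.
  by have /andP[-> ->] := H i; have /andP[-> ->] := H' i.
- by move=> k; exists (fun=> - k%:R, fun=> k%:R).
- apply/seteqP; split => // v _.
  exists (Num.bound (\sum_i `|v 0 i|)) => // i; rewrite -ltr_norml.
  apply: (@le_lt_trans _ _ (\sum_i `|v 0 i|)).
    by rewrite (bigD1 i)//= lerDl sumr_ge0.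
  by rewrite archi_boundP ?sumr_ge0.
- move=> _ [[a b] _ <-]; 
  change (leb n (affv x h @^-1` box a b) = (h ^+ n)%:E * leb n (box a b))%E.
  rewrite bE.
  have [ab|] := pselect (forall i, a i <= b i).
    rewrite !leb_box// => [|i]; last by rewrite lerD2l lerN2 ler_pM2l.
    rewrite -EFinM; congr EFin.
    under eq_bigr do rewrite opprB addrC subrKA -mulrBr.
    by rewrite big_split/= prodr_const card_ord.
  move=> /existsNP[i /negP]; rewrite -ltNge => ba.
  have E (p q : 'I_n -> R) : q i < p i -> box p q = set0.
    move=> qp; apply/seteqP; split => // v /(_ i) /andP[H1 H2].
    by have := lt_trans (lt_trans H1 H2) qp; rewrite ltxx.
  by rewrite !E ?measure0 ?mule0// ltrD2l ltrN2 ltr_pM2l.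
- move=> k; change (leb n (affv x h @^-1` g k) < +oo)%E.
  rewrite bE.
  rewrite leb_box ?ltry// => i; rewrite lerD2l lerN2 ler_pM2l//.
  by rewrite (le_trans (y := 0)) ?oppr_le0.
Qed.

Lemma measurable_unit_ball n : measurable [set v : 'rV[R]_n | enorm v < 1].
Proof.
have mf : measurable_fun setT (fun v : 'rV[R]_n => dotv v v).
  apply: measurable_sum => i; apply: measurable_funM; exact: measurable_coordv.
rewrite (_ : [set v | _] = (fun v : 'rV[R]_n => dotv v v) @^-1` `]-oo, 1[).
  by rewrite -[X in measurable X]setTI; apply: mf => //; exact: measurable_itv.
by apply/seteqP; split => v /=; rewrite in_itv/= enorm_lt1.
Qed.

Lemma unit_ball_volume n :
  (0 < leb n [set v : 'rV[R]_n | (enorm v < 1)%R] < +oo)%E.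
Proof.
have mB := @measurable_unit_ball n.
have n0 : 0 < n.+1%:R^-1 :> R by rewrite invr_gt0.
apply/andP; split.
  apply: (@lt_le_trans _ _ (leb n (cube 0 n.+1%:R^-1))).
    by rewrite leb_cube ?ltW// lte_fin exprn_gt0// mulr_gt0.
  apply: le_measure; rewrite ?inE//; first exact: measurable_cube.
  move=> v H; apply: enorm_lt => // i; rewrite mul1r.
  by have := H i; rewrite mxE subr0.
apply: (@le_lt_trans _ _ (leb n (cube 0 1))).
  apply: le_measure; rewrite ?inE//; first exact: measurable_cube.
  by move=> v H i; rewrite mxE subr0 (le_lt_trans (coord_le_enorm _ _)).
by rewrite leb_cube// ltry.
Qed.

End lebesgue_cubes.

(** * Volume of small cubes inside the domain *)

Section local_lipschitz.
Context {R : realType}.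

Lemma partial_mvt n (f : 'rV[R]_n -> R) (i : 'I_n) (p a : 'rV[R]_n) (del B t : R) :
  0 <= t -> cube p del a -> cube p del (a + t *: delta_mx 0 i) ->
  (forall x, cube p del x -> derivable f x (delta_mx 0 i)) ->
  (forall x, cube p del x -> `|'D_(delta_mx 0 i) f x| <= B) ->
  `|f (a + t *: delta_mx 0 i) - f a| <= B * t.
Proof.
move=> t0 pa pat df dB.
pose g (s : R) := f (a + s *: delta_mx 0 i).
have cg s : s \in `[0, t] -> cube p del (a + s *: delta_mx 0 i).
  rewrite in_itv/= => /andP[s0 st] j; have := pa j; have := pat j.
  rewrite !mxE eqxx/=; case: (j == i); rewrite ?mulr0 ?addr0// !mulr1.
  by rewrite !ltr_norml => /andP[H1 H2] /andP[H3 H4]; apply/andP; split; lra.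
have gE s : (fun h => h^-1 *: ((g \o shift s) (h *: 1) - g s)) =
    (fun h => h^-1 *: ((f \o shift (a + s *: delta_mx 0 i))
      (h *: delta_mx 0 i) - f (a + s *: delta_mx 0 i))).
  apply/funext => k; rewrite /g /=; congr (_ *: (f _ - _)).
  by rewrite addrCA -scalerDl [k *: 1]mulr1.
have gD s : s \in `[0, t] -> is_derive s 1 g
    ('D_(delta_mx 0 i) f (a + s *: delta_mx 0 i)).
  move=> /cg/df dfs; split; first by rewrite /derivable gE.
  by rewrite /derive gE.
pose dg s := 'D_(delta_mx 0 i) f (a + s *: delta_mx 0 i).
have H1 s : s \in `]0, t[ -> is_derive s 1 g (dg s).
  rewrite in_itv/= => /andP[s0 st]; apply: gD.
  by rewrite in_itv/= (ltW s0) (ltW st).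
have H2 : {within `[0, t], continuous g}.
  by apply: derivable_within_continuous => s /gD[].
have [c ct] := @MVT_segment R g dg 0 t t0 H1 H2.
rewrite /g scale0r addr0 subr0 => ->.
by rewrite normrM (ger0_norm t0) ler_wpM2r//; exact/dB/cg.
Qed.

(** A cube contains every point obtained by mixing coordinates of two of its points, so one passes
    from [u] to [v] changing one coordinate at a time and applies the one-variable mean value
    theorem to each change. *)
Lemma smooth_lipschitz n p (U : set 'rV[R]_n) (f : 'rV[R]_n -> 'rV[R]_p) x0 :
  open U -> U x0 -> smooth_on U f ->
  exists del L, [/\ 0 < del, 0 < L, cube x0 del `<=` U &
    forall u v e, 0 <= e -> cube x0 del u -> cube x0 del v ->
      (forall i, `|u 0 i - v 0 i| <= e) ->
      forall j, `|f u 0 j - f v 0 j| <= L * e].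
Proof.
move=> oU Ux0 fU.
pose D (i : 'I_n) (j : 'I_p) := 'D_(delta_mx 0 i) (fun x => f x 0 j).
(* A number above every partial derivative at [x0] in absolute value; by continuity it remains a
   bound on a small cube. *)
pose B := 1 + \sum_i \sum_j (`|D i j x0| + 1).
have D_le i j : `|D i j x0| + 1 <= B.
  apply: (@le_trans _ _ (\sum_j (`|D i j x0| + 1))).
    by rewrite (bigD1 j)//= lerDl sumr_ge0// => k _; rewrite addr_ge0.
  apply: (@le_trans _ _ (\sum_i \sum_j (`|D i j x0| + 1))); last first.
    by rewrite lerDr.
  rewrite [leRHS](bigD1 i)//= lerDl sumr_ge0// => k _.
  by rewrite sumr_ge0// => l _; rewrite addr_ge0.
have B0 : 0 < B.
  by rewrite ltr_pwDl// sumr_ge0// => ? _; rewrite sumr_ge0// => ? _; rewrite addr_ge0.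
have [del del0 delU] : exists2 del, 0 < del & cube x0 del `<=`
    [set x | U x /\ forall i j, `|D i j x| <= B].
  apply/nbhs_cube.
  have nU : \forall x \near x0, U x by exact: open_nbhs_nbhs.
  have nD : \forall x \near x0, forall i j, `|D i j x| <= B.
    apply: (@filter_forall _ _ (fun i x => forall j, `|D i j x| <= B)
      (nbhs x0) (nbhs_filter x0)) => i.
    apply: (@filter_forall _ _ (fun j x => `|D i j x| <= B)
      (nbhs x0) (nbhs_filter x0)) => j.
    have [_ /(_ i)[_ [cD _]]] := fU 1%N j.
    have /cvgr_norm_le/(_ B) := cD _ Ux0; apply.
    by apply: lt_le_trans (D_le i j); rewrite ltrDl.
  by near=> x; split; [near: x; exact: nU|near: x; exact: nD].
(* There are [n] coordinate changes, each costing [B e]; the [+ 1] keeps the constant positive when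
   [n = 0]. *)
exists del, (n%:R * B + 1); split => //.
- by rewrite ltr_wpDl// mulr_ge0// ltW.
- by move=> x /delU[].
move=> u v e e0 cu cv uv j.
have dfx (i : 'I_n) x : cube x0 del x -> derivable (fun x => f x 0 j) x (delta_mx 0 i).
  by move=> /delU[Ux _]; have [_ /(_ i)[+ _]] := fU 1%N j; exact.
pose z k : 'rV[R]_n := \row_i (if (i < k)%N then v 0 i else u 0 i).
have cz k : cube x0 del (z k) by move=> i; rewrite mxE; case: ifPn.
have step k : (k < n)%N -> `|f (z k.+1) 0 j - f (z k) 0 j| <= B * e.
  move=> kn; pose i := Ordinal kn.
  have zE : z k.+1 = z k + (v 0 i - u 0 i) *: delta_mx 0 i.
    apply/rowP => l; rewrite !mxE ltnS leq_eqVlt/= -[l == i]/(nat_of_ord l == k).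
    case: (eqVneq (nat_of_ord l) k) => [lk|_] /=; last by rewrite mulr0 addr0.
    have -> : l = i by exact: val_inj.
    by rewrite ltnn mulr1 addrC subrK.
  have [uvi|uvi] := leP (u 0 i) (v 0 i).
    rewrite zE; apply: (@le_trans _ _ (B * (v 0 i - u 0 i))).
      apply: (@partial_mvt _ (fun x => f x 0 j) i x0 (z k) del); rewrite ?subr_ge0//.
      - by rewrite -zE.
      - exact: dfx.
      - by move=> x /delU[_]; exact.
    rewrite ler_pM2l// (le_trans _ (uv i))// distrC ler_norm//.
  have zE' : z k = z k.+1 + (u 0 i - v 0 i) *: delta_mx 0 i.
    by rewrite zE -addrA -scalerDl addrA subrK subrr scale0r addr0.
  rewrite distrC [X in f X]zE'; apply: (@le_trans _ _ (B * (u 0 i - v 0 i))).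
    apply: (@partial_mvt _ (fun x => f x 0 j) i x0 (z k.+1) del); rewrite ?subr_ge0 ?ltW//.
    - by rewrite -zE'.
    - exact: dfx.
    - by move=> x /delU[_]; exact.
  by rewrite ler_pM2l// (le_trans _ (uv i))// ler_norm.
have acc k : (k <= n)%N -> `|f (z k) 0 j - f u 0 j| <= k%:R * (B * e).
  elim: k => [_|k IH kn].
    have -> : z 0%N = u by apply/rowP => i; rewrite mxE.
    by rewrite subrr normr0 mul0r.
  rewrite -(subrKA (f (z k) 0 j)) (le_trans (ler_normD _ _))//.
  by rewrite -natr1 mulrDl mul1r addrC lerD// ?step// IH// ltnW.
have zn : z n = v by apply/rowP => i; rewrite mxE ltn_ord.
have := acc n (leqnn n); rewrite zn distrC => /le_trans; apply.
by rewrite mulrA mulrDl mul1r lerDl.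
Unshelve. all: end_near. Qed.

End local_lipschitz.

(** * Volumes under Lipschitz charts *)

Section inverse_volume.
Context {R : realType}.
Local Notation leb n := (lebesgue_rV (R := R) n).

Lemma continuous_on_measurable n (O : set 'rV[R]_n) (f : 'rV[R]_n -> R) :
  open O -> (forall x, O x -> {for x, continuous f}) -> measurable_fun O f.
Proof.
move=> oO cf; apply: (measurability _ (RGenOpens.measurableE R)).
move=> _ [_ [a [b ->]] <-]; apply: open_rV_measurable.
suff : open (O `&` f @^-1` `]a, b[) by [].
rewrite openE => x [Ox fx]; rewrite /interior; apply: filterI.
  exact: open_nbhs_nbhs.
by apply: cf => //; apply: open_nbhs_nbhs; split => //; exact: interval_open.
Qed.

(* The set of pairs [(z, u)] with [u] in the small cube around [k' z] is
   measured by integrating first over [u], then over [z]; this replaces the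
   change of variables formula by its rough Lipschitz version. *)
Lemma inverse_volume n p (W : set 'rV[R]_p) (E : set 'rV[R]_n)
    (k' : 'rV[R]_p -> 'rV[R]_n) (k : 'rV[R]_n -> 'rV[R]_p) (a b : R) :
  measurable W -> measurable E ->
  (forall i, measurable_fun W (fun z => k' z 0 i)) -> 0 < a -> 0 < b ->
  (forall z u, W z -> cube (k' z) b u -> E u /\ cube (k u) a z) ->
  (((2 * b) ^+ n)%:E * leb p W <= ((2 * a) ^+ p)%:E * leb n E)%E.
Proof.
move=> mW mE mk a0 b0 kE.
pose S := [set zu : 'rV[R]_p * 'rV[R]_n | W zu.1 /\ cube (k' zu.1) b zu.2].
have mS : measurable S.
  pose G i := (fun z => k' z 0 i) \_ W.
  have mG i : measurable_fun setT (G i) by apply/(measurable_restrictT _ _).1.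
  pose F i (zu : 'rV[R]_p * 'rV[R]_n) := zu.2 0 i - G i zu.1.
  have mF i : measurable_fun setT (F i).
    apply: measurable_funB.
      exact: (measurableT_comp (measurable_coordv i) measurable_snd).
    exact: (measurableT_comp (mG i) measurable_fst).
  have -> : S = (W `*` setT) `&`
      \bigcap_(i in [set: 'I_n]) (F i @^-1` `]- b, b[).
    apply/seteqP; split => [[z u] [/= Wz H]|[z u] [[/= Wz _] H]].
      split => // i _.
      by rewrite /= in_itv/= -ltr_norml /F /G patchE mem_set//; exact: H.
    split => // i; have := H i I.
    by rewrite /= in_itv/= -ltr_norml /F /G patchE mem_set.
  apply: measurableI; first exact: measurableX.
  apply: fin_bigcap_measurable => [|i _]; first exact: (@finite_finset 'I_n).
  by rewrite -[X in measurable X]setTI; apply: mF => //; exact: measurable_itv.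
pose f (zu : 'rV[R]_p * 'rV[R]_n) := (\1_S zu : R)%:E.
have mf : measurable_fun setT f by apply/measurable_EFinP; exact: measurable_indic.
have f0 zu : (0 <= f zu)%E by rewrite lee_fin.
have := fubini_tonelli (m1 := leb p) (m2 := leb n) f mf f0.
rewrite (eq_integral (fun z => ((2 * b) ^+ n)%:E * (\1_W z)%:E)%E); last first.
  move=> z _; rewrite /f.
  rewrite (eq_integral (fun u => (\1_[set u | S (z, u)] u : R)%:E)); last first.
    by move=> u _; rewrite !indicE; congr ((nat_of_bool _)%:R%:E);
      apply/idP/idP => /set_mem H; apply/mem_set.
  have mSz : measurable [set u | S (z, u)].
    rewrite -[X in measurable X]setTI.
    exact: (pair1_measurable z measurableT mS).
  rewrite integral_indic// setIT [\1_W z]indicE.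
  have [/set_mem Wz|/negP Wz] := boolP (z \in W).
    have -> : [set u | S (z, u)] = cube (k' z) b.
      by apply/seteqP; split => [u []//|u H]; split.
    by rewrite mule1; apply: leb_cube; exact: ltW.
  have -> : [set u | S (z, u)] = set0.
    by apply/seteqP; split => // u [/mem_set].
  by rewrite measure0 mule0.
rewrite ge0_integralZl//; last 2 first.
- by apply/measurable_EFinP; exact: measurable_indic.
- by rewrite lee_fin exprn_ge0// mulr_ge0// ltW.
rewrite integral_indic// setIT => ->.
have -> : (leb n E = \int[leb n]_u (\1_E u : R)%:E)%E.
  by rewrite integral_indic// setIT.
rewrite -ge0_integralZl//; last 2 first.
- by apply/measurable_EFinP; exact: measurable_indic.
- by rewrite lee_fin exprn_ge0// mulr_ge0// ltW.
apply: ge0_le_integral => //.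
- by move=> u _; apply: integral_ge0.
- exact: measurable_fun_fubini_tonelli_G.
- apply: emeasurable_funM => //.
  by apply/measurable_EFinP; exact: measurable_indic.
move=> u _; rewrite /f.
have mSu : measurable [set z | S (z, u)].
  rewrite -[X in measurable X]setTI.
  exact: (pair2_measurable u measurableT mS).
rewrite (eq_integral (fun z => (\1_[set z | S (z, u)] z : R)%:E)); last first.
  by move=> z _; rewrite !indicE; congr ((nat_of_bool _)%:R%:E);
    apply/idP/idP => /set_mem H; apply/mem_set.
rewrite integral_indic// setIT indicE.
have [/set_mem Eu|/negP Eu] := boolP (u \in E); last first.
  have -> : [set z | S (z, u)] = set0.
    apply/seteqP; split => // z [Wz H]; apply: Eu; apply/mem_set.
    by case: (kE z u).
  by rewrite measure0 mule0.
rewrite mule1 -(leb_cube (k u) (ltW a0)); apply: le_measure; rewrite ?inE//.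
  exact: measurable_cube.
by move=> z [Wz H]; case: (kE z u).
Qed.

End inverse_volume.

(** * Volume near interior and Lipschitz points *)

Section volume_lower_bound.
Context {R : realType}.
Local Notation leb n := (lebesgue_rV (R := R) n).

(** The constants depend on [q] but are uniform over all nearby [x] in [Omega], which is the form
    that a compactness argument can glue. *)
Definition volume_at n (Omega : set 'rV[R]_n) (g : R) (q : 'rV[R]_n) :=
  exists c del, [/\ 0 < c, 0 < del & forall x r, Omega x -> cube q del x ->
    0 < r <= del -> ((c * r `^ (n%:R + g))%:E <= leb n (cube x r `&` Omega))%E].

Lemma powR_le_expr n (g r : R) : 0 <= g -> 0 < r <= 1 ->
  r `^ (n%:R + g) <= r ^+ n.
Proof.
move=> g0 r01; have /andP[r0 _] := r01.
by rewrite -(powR_mulrn _ (ltW r0)); apply: ger_powR => //; rewrite lerDl.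
Qed.

(** A subcube of proportional size gives the power [r^n], which dominates [r^(n + g)] for [r <= 1];
    hence the minimum with 1. *)
Lemma volume_at_of_cube n (Omega : set 'rV[R]_n) (g del t : R) (q : 'rV[R]_n) :
  measurable Omega -> 0 <= g -> 0 < del -> 0 < t ->
  (forall x r, Omega x -> cube q del x -> 0 < r <= del -> exists w,
    cube w (t * r) `<=` cube x r `&` Omega) ->
  volume_at Omega g q.
Proof.
move=> mO g0 del0 t0 H; exists ((2 * t) ^+ n), (Num.min del 1).
split; [by rewrite exprn_gt0// mulr_gt0|by rewrite lt_min del0 ltr01|].
move=> x r Ox qx; rewrite le_min => /andP[r0 /andP[rdel r1]].
have [w wE] : exists w, cube w (t * r) `<=` cube x r `&` Omega.
  apply: H => //; last by rewrite r0.
  by move=> i; rewrite (lt_le_trans (qx i))// ge_min lexx.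
apply: (@le_trans _ _ (leb n (cube w (t * r)))); last first.
  apply: le_measure; rewrite ?inE//; first exact: measurable_cube.
  by apply: measurableI => //; exact: measurable_cube.
rewrite leb_cube ?mulr_ge0 ?(ltW t0) ?(ltW r0)// lee_fin mulrA [leRHS]exprMn.
by rewrite ler_wpM2l ?exprn_ge0 ?mulr_ge0 ?(ltW t0)// powR_le_expr// r0.
Qed.

Lemma volume_at_interior n (Omega : set 'rV[R]_n) (g : R) (q : 'rV[R]_n) :
  open Omega -> 0 <= g -> Omega q -> volume_at Omega g q.
Proof.
move=> oO g0 Oq; have /nbhs_cube[e e0 eO] : nbhs q Omega by exact: open_nbhs_nbhs.
apply: (@volume_at_of_cube n Omega g (e / 2) 1) => //.
- exact: open_rV_measurable.
- by rewrite divr_gt0.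
move=> x r Ox qx /andP[r0 re]; exists x; rewrite mul1r => u xu; split => //.
apply: eO => i; rewrite -(subrKA (x 0 i)) (le_lt_trans (ler_normD _ _))//.
by rewrite (splitr e) ltrD// (lt_le_trans (xu i)).
Qed.

Lemma dotvDl n (x y z : 'rV[R]_n) : dotv (x + y) z = dotv x z + dotv y z.
Proof.
by rewrite /dotv -big_split/=; apply: eq_bigr => i _; rewrite mxE mulrDl.
Qed.

Lemma dotvZl n t (x z : 'rV[R]_n) : dotv (t *: x) z = t * dotv x z.
Proof. by rewrite /dotv mulr_sumr; apply: eq_bigr => i _; rewrite mxE mulrA. Qed.

(** Interior cone condition: from [x] one moves up by [r / 2] along [e] and takes the cube of radius
    [s = r / K] there. Inside it the height falls by at most [N s] and the graph rises by at most
    [2 |L| N^2 s]; [K] is chosen so that these losses add up to [r / 2]. *)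
Lemma volume_at_lipschitz n (Omega : set 'rV[R]_n) (g : R) (p : 'rV[R]_n) :
  open Omega -> 0 <= g -> lipschitz_boundary_at Omega p ->
  volume_at Omega g p.
Proof.
move=> oO g0 [e [G [L [U [e1 GL oU Up UO]]]]].
have /nbhs_cube[eps eps0 epsU] : nbhs p U by exact: open_nbhs_nbhs.
have ee : dotv e e = 1.
  have := congr1 (fun z => z ^+ 2) e1; rewrite expr1n sqr_sqrtr//.
  by apply: sumr_ge0 => i _; rewrite -expr2 sqr_ge0.
pose N : R := n.+1%:R; have N0 : 0 < N by rewrite ltr0n.
have N1 : 1 <= N by rewrite ler1n.
pose K := 2 * (2 * `|L| * N ^+ 2 + N).
have LN : 0 <= `|L| * N ^+ 2 by rewrite mulr_ge0// exprn_ge0// ltW.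
have K2 : 2 <= K by rewrite /K; lra.
have K0 : 0 < K by exact: lt_le_trans K2.
apply: (@volume_at_of_cube n Omega g (eps / 2) K^-1) => //.
- exact: open_rV_measurable.
- by rewrite divr_gt0.
- by rewrite invr_gt0.
move=> x r Ox px /andP[r0 re]; set s := K^-1 * r.
have s0 : 0 < s by rewrite mulr_gt0// invr_gt0.
have Ks : K * s = r by rewrite /s mulrA divff ?mul1r// gt_eqF.
have sr : s <= r / 2.
  by rewrite ler_pdivlMr// -Ks mulrC ler_wpM2r// ltW.
exists (x + (r / 2) *: e) => u uw.
pose v : 'rV[R]_n := u - x - (r / 2) *: e.
have vs i : `|v 0 i| < s by have := uw i; rewrite !mxE opprD addrA.
have uE : u = x + (r / 2) *: e + v by apply/rowP => i; rewrite !mxE; ring.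
clearbody v.
have ei i : `|e 0 i| <= 1 by rewrite -e1 coord_le_enorm.
have xu : cube x r u.
  move=> i; have -> : u 0 i - x 0 i = r / 2 * e 0 i + v 0 i.
    by rewrite {1}uE !mxE; ring.
  rewrite (le_lt_trans (ler_normD _ _))// normrM.
  have := vs i; have : `|r / 2| * `|e 0 i| <= r / 2.
    by rewrite (ger0_norm (_ : 0 <= r / 2)) ?divr_ge0 ?ler_piMr ?(ltW r0)// divr_ge0 ?(ltW r0).
  by lra.
split => //.
have Ux : U x.
  by apply: epsU => i; rewrite (lt_le_trans (px i))//; lra.
have Uu : U u.
  apply: epsU => i; rewrite -(subrKA (x 0 i)) (le_lt_trans (ler_normD _ _))//.
  by have := xu i; have := px i; lra.
apply/(UO _ Uu); have /(UO _ Ux) gx := Ox.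
have ve : `|dotv v e| <= N * s.
  rewrite /dotv (le_trans (ler_norm_sum _ _ _))//.
  apply: (@le_trans _ _ (\sum_(i < n) s)).
    by apply: ler_sum => i _; rewrite normrM -[leRHS]mulr1 ler_pM// ltW.
  by rewrite sumr_const card_ord -mulr_natl ler_wpM2r ?(ltW s0)// ler_nat.
have ue : dotv u e = dotv x e + r / 2 + dotv v e.
  by rewrite uE !dotvDl dotvZl ee mulr1.
have proj0 y : dotv (y - dotv y e *: e) e = 0.
  by rewrite dotvDl -scaleNr dotvZl ee mulr1 subrr.
have := GL _ _ (proj0 u) (proj0 x).
set du := u - _; set dx := x - _.
have dE : du - dx = v - dotv v e *: e.
  rewrite /du /dx ue; apply/rowP => i; rewrite uE !mxE; ring.
have dlt : enorm (du - dx) < 2 * N ^+ 2 * s.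
  apply: enorm_lt => [|i]; first by rewrite mulr_gt0// mulr_gt0// exprn_gt0.
  have -> : 2 * N ^+ 2 * s / n.+1%:R = 2 * N * s.
    by rewrite -/N; field; rewrite gt_eqF.
  rewrite dE !mxE.
  rewrite (le_lt_trans (ler_normB _ _))// normrM.
  have : `|dotv v e| * `|e 0 i| <= N * s.
    by rewrite -[leRHS]mulr1 ler_pM.
  have := vs i; have : s <= N * s by rewrite ler_peMl// ltW.
  by lra.
move=> Gux; have Gux' : `|G du - G dx| <= `|L| * (2 * N ^+ 2 * s).
  apply: (le_trans Gux); apply: (@le_trans _ _ (`|L| * enorm (du - dx))).
    by rewrite ler_wpM2r ?sqrtr_ge0// ler_norm.
  by rewrite ler_wpM2l// ltW.
have : G du - G dx <= `|L| * (2 * N ^+ 2 * s) by rewrite (le_trans (ler_norm _)).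
move: ve; rewrite ler_norml => /andP[ve _].
have := Ks; rewrite /K ue; move: gx; rewrite -/dx.
have -> : 2 * (2 * `|L| * N ^+ 2 + N) * s =
  2 * (`|L| * (2 * N ^+ 2 * s)) + 2 * (N * s) by ring.
by move: (`|L| * _) => z; lra.
Qed.

End volume_lower_bound.

(** * Boxes inside the model cusp *)

Section cusp_volume.
Context {R : realType}.
Local Notation leb n := (lebesgue_rV (R := R) n).

Lemma enorm_ltE n (x : 'rV[R]_n) A : 0 < A -> (enorm x < A) = (dotv x x < A ^+ 2).
Proof.
by move=> A0; rewrite -{1}(ger0_norm (ltW A0)) -sqrtr_sqr ltr_sqrt// exprn_gt0.
Qed.

(** The weighted inequality [(a + b)^2 <= (1 + B/A) a^2 + (1 + A/B) b^2], summed over coordinates,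
    becomes exactly [(A + B)^2] at the given bounds. *)
Lemma enorm_lt_add n (x y : 'rV[R]_n) A B : 0 < A -> 0 < B ->
  enorm x < A -> enorm y < B -> enorm (x + y) < A + B.
Proof.
move=> A0 B0; rewrite !enorm_ltE ?addr_gt0// => xA yB.
apply: (@le_lt_trans _ _ ((1 + B / A) * dotv x x + (1 + A / B) * dotv y y)).
  rewrite /dotv !mulr_sumr -big_split/=; apply: ler_sum => i _; rewrite !mxE.
  rewrite -subr_ge0 (_ : _ - _ = (A * B)^-1 * (B * x 0 i - A * y 0 i) ^+ 2).
    by rewrite mulr_ge0 ?sqr_ge0// invr_ge0 mulr_ge0// ltW.
  by field; rewrite !gt_eqF.
have -> : (A + B) ^+ 2 = (1 + B / A) * A ^+ 2 + (1 + A / B) * B ^+ 2.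
  by field; rewrite !gt_eqF.
by rewrite ltrD// ltr_pM2l// addr_gt0// divr_gt0.
Qed.

Lemma enormZ_lt n (x : 'rV[R]_n) t A : 0 < t -> 0 < A ->
  enorm x < A -> enorm (t *: x) < t * A.
Proof.
move=> t0 A0; rewrite !enorm_ltE ?mulr_gt0// => xA.
rewrite dotvZl (_ : dotv x (t *: x) = t * dotv x x).
  by rewrite mulrA -expr2 exprMn ltr_pM2l// exprn_gt0.
by rewrite /dotv mulr_sumr; apply: eq_bigr => i _; rewrite mxE mulrCA.
Qed.

Lemma powR_superadditive (a b p : R) : 0 < a -> 0 < b -> 1 <= p ->
  a `^ p + b `^ p <= (a + b) `^ p.
Proof.
move=> a0 b0 p1.
have E x : 0 < x -> x `^ p = x * x `^ (p - 1).
  move=> x0; rewrite -{2}(powRr1 (ltW x0)) -powRD; first by congr (_ `^ _); ring.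
  by apply/implyP => _; rewrite gt_eqF.
rewrite !E ?addr_gt0// mulrDl lerD// ler_wpM2l ?(ltW a0) ?(ltW b0)//.
  by apply: ge0_ler_powR; rewrite ?nnegrE ?subr_ge0 ?addr_ge0 ?lerDl ?(ltW a0) ?(ltW b0).
by apply: ge0_ler_powR; rewrite ?nnegrE ?subr_ge0 ?addr_ge0 ?lerDr ?(ltW a0) ?(ltW b0).
Qed.

(** The base is at most 1, so raising the exponent to the integer [k] only lowers the power, and an
    induction on [k] finishes. *)
Lemma powR_bernoulli (x p : R) (k : nat) : 0 <= x < 1 -> p <= k%:R ->
  1 - k%:R * x <= (1 - x) `^ p.
Proof.
move=> /andP[x0 x1] pk.
apply: (@le_trans _ _ ((1 - x) `^ k%:R)); last first.
  by apply: ger_powR => //; rewrite subr_gt0 x1/= gerBl.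
rewrite powR_mulrn ?subr_ge0 ?(ltW x1)//; elim: k {pk} => [|k IH].
  by rewrite mul0r subr0 expr0.
rewrite exprS; apply: (@le_trans _ _ ((1 - x) * (1 - k%:R * x))).
  rewrite -subr_ge0 -natr1 (_ : _ - _ = k%:R * x ^+ 2); last by ring.
  by rewrite mulr_ge0 ?sqr_ge0.
by rewrite ler_wpM2l// subr_ge0 ltW.
Qed.

(** Half-widths of a box that fits in a cusp at distance [tau] from its edge: [tau^alpha] across,
    [tau] along. The divisors turn coordinate bounds into Euclidean ones through [enorm_lt]. *)
Definition cusp_widths (d' d'' : nat) (alpha tau : R) : 'rV[R]_(1 + d' + d'') :=
  row_mx (row_mx (const_mx tau) (const_mx (tau `^ alpha / d'.+1%:R)))
         (const_mx (tau / d''.+1%:R)).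

(** The point [y] may be arbitrarily close to the boundary of the cusp. Room for a box appears after
    a move of order [tau], because [sg^alpha + tau^alpha <= (sg + tau)^alpha]: going up the axis by
    [tau] widens the section by at least [tau^alpha]. *)
Lemma cusp_box d' d'' (alpha r eps : R) : 1 < alpha -> 0 < r -> 0 < eps ->
  exists K t0, [/\ 0 < K, 0 < t0 &
    forall (y : 'rV[R]_(1 + d' + d'')) tau, cusp alpha r eps y ->
      0 < tau <= t0 -> exists w : 'rV[R]_(1 + d' + d''),
      forall z : 'rV[R]_(1 + d' + d''),
        (forall j, `|z 0 j - w 0 j| < cusp_widths d' d'' alpha tau 0 j) ->
        cusp alpha r eps z /\ cube y (K * tau) z].
Proof.
move=> alpha1 r0 eps0.
have alpha0 : 0 < alpha by exact: lt_trans alpha1.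
pose k := Num.bound alpha.
have alphak : alpha <= k%:R by rewrite ltW// archi_boundP// ltW.
have ea0 : 0 < eps `^ alpha by rewrite powR_gt0.
have kea : 0 <= k%:R * (8 / eps) * eps `^ alpha.
  by rewrite mulr_ge0 ?(ltW ea0)// mulr_ge0// divr_ge0// ltW.
(* The term 8 covers the moves in [x1] and [x'']; the other one bounds, by Bernoulli, the shrinking
   of [x']. The bounds [eps / 8] and [r / 4] on [tau] keep [eps - 4 tau] and [r - 2 tau]
   positive. *)
exists (8 + k%:R * (8 / eps) * eps `^ alpha), (Num.min 1 (Num.min (eps / 8) (r / 4))).
split; first by rewrite ltr_pwDl.
  by rewrite !lt_min ltr01 !divr_gt0.
move=> y tau [/andP[y10 y1e] y' y''].
set y1 := lsubmx (lsubmx y) 0 0 in y10 y1e y'.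
rewrite !le_min => /andP[t0 /andP[t1 /andP[te tr]]].
have ta0 : 0 < tau `^ alpha by rewrite powR_gt0.
have tat : tau `^ alpha <= tau.
  rewrite -{2}(powRr1 (ltW t0)); apply: ger_powR; first by rewrite t0.
  exact: ltW.
(* Move [y] away from the edges [y1 = eps] and [|y''| = r] with the cusp shape
   preserved, then inwards by [2 tau] along the axis. *)
pose sg := Num.min y1 (eps - 4 * tau).
have sg0 : 0 < sg by rewrite lt_min y10; lra.
have sgy : sg <= y1 by rewrite ge_min lexx.
have sge : sg <= eps - 4 * tau by rewrite ge_min lexx orbT.
pose x := (y1 - sg) / y1.
have x0 : 0 <= x by rewrite divr_ge0 ?subr_ge0// ltW.
have ysg : y1 - sg <= 4 * tau.
  by rewrite /sg /Num.min; case: ifP => _; lra.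
have x8 : x <= 8 / eps * tau.
  rewrite ler_pdivrMr//; have [y1s|y1s] := leP y1 (eps - 4 * tau).
    have -> : y1 - sg = 0 by rewrite /sg minEle y1s subrr.
    by rewrite !mulr_ge0 ?invr_ge0// ltW.
  apply: (le_trans ysg).
  have -> : 8 / eps * tau * y1 = 4 * tau * (2 * y1 / eps) by field; rewrite gt_eqF.
  by rewrite ler_peMr ?mulr_ge0 ?(ltW t0)// ler_pdivlMr// mul1r; lra.
have xE : 1 - x = sg / y1 by rewrite /x; field; rewrite gt_eqF.
have x1 : x < 1 by rewrite -subr_gt0 xE divr_gt0.
pose c' := (sg / y1) `^ alpha.
have c'0 : 0 < c' by rewrite powR_gt0// divr_gt0.
have c'E : c' * y1 `^ alpha = sg `^ alpha.
  by rewrite -powRM ?divr_ge0 ?(ltW sg0) ?(ltW y10)// divfK// gt_eqF.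
have c'1 : 1 - k%:R * x <= c'.
  by rewrite /c' -xE; apply: powR_bernoulli; rewrite ?x0.
have c'le1 : c' <= 1.
  have : c' * y1 `^ alpha <= 1 * y1 `^ alpha.
    rewrite c'E mul1r; apply: ge0_ler_powR; rewrite ?nnegrE ?(ltW alpha0) ?(ltW sg0) ?(ltW y10)//.
  by rewrite ler_pM2r// powR_gt0.
pose c'' := 1 - 2 * tau / r.
have c''0 : 0 < c''.
  by rewrite subr_gt0 ltr_pdivrMr// mul1r; lra.
have c''E : c'' * r = r - 2 * tau by rewrite /c''; field; rewrite gt_eqF.
exists (row_mx (row_mx (const_mx (sg + 2 * tau)) (c' *: rsubmx (lsubmx y)))
  (c'' *: rsubmx y)) => z zw.
have z1 : `|lsubmx (lsubmx z) 0 0 - (sg + 2 * tau)| < tau.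
  have := zw (lshift d'' (lshift d' 0)).
  by rewrite /cusp_widths !row_mxEl !mxE.
have z' j : `|rsubmx (lsubmx z) 0 j - c' * rsubmx (lsubmx y) 0 j| <
    tau `^ alpha / d'.+1%:R.
  have := zw (lshift d'' (rshift 1 j)).
  by rewrite /cusp_widths !row_mxEl !row_mxEr !mxE.
have z'' j : `|rsubmx z 0 j - c'' * rsubmx y 0 j| < tau / d''.+1%:R.
  have := zw (rshift (1 + d') j).
  by rewrite /cusp_widths !row_mxEr !mxE.
move: z1; set zz1 := lsubmx (lsubmx z) 0 0; rewrite ltr_norml => /andP[z1l z1r].
split.
  rewrite /cusp /= -/zz1; split.
  - by apply/andP; split; lra.
  - apply: (@lt_le_trans _ _ (sg `^ alpha + tau `^ alpha)).
      have -> : rsubmx (lsubmx z) = c' *: rsubmx (lsubmx y) +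
          (rsubmx (lsubmx z) - c' *: rsubmx (lsubmx y)) by rewrite addrC subrK.
      apply: enorm_lt_add; rewrite ?powR_gt0//.
        by rewrite -c'E; apply: (enormZ_lt c'0 _ y'); rewrite powR_gt0.
      by apply: enorm_lt => // j; rewrite mxE [X in _ + X]mxE [X in - X]mxE.
    apply: (le_trans (powR_superadditive sg0 t0 (ltW alpha1))).
    apply: ge0_ler_powR; rewrite ?nnegrE ?(ltW alpha0)//; lra.
  - have -> : rsubmx z = c'' *: rsubmx y + (rsubmx z - c'' *: rsubmx y).
      by rewrite addrC subrK.
    apply: (@lt_le_trans _ _ (c'' * r + tau)).
      apply: enorm_lt_add; rewrite ?mulr_gt0//; first exact: enormZ_lt.
      by apply: enorm_lt => // j; rewrite mxE [X in _ + X]mxE [X in - X]mxE.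
    by rewrite c''E; lra.
have Kt : 8 * tau <= (8 + k%:R * (8 / eps) * eps `^ alpha) * tau.
  by rewrite ler_pM2r// lerDl.
have le_div (s : R) m : 0 < s -> s / m.+1%:R <= s.
  by move=> s0; rewrite ler_pdivrMr ?ltr0n// ler_peMr ?ler1n// ltW.
move=> j; rewrite -[z]hsubmxK -[y]hsubmxK.
case: (split_ordP j) => {}j ->; last first.
  rewrite !row_mxEr; apply: lt_le_trans Kt.
  have H : `|c'' * rsubmx y 0 j - rsubmx y 0 j| <= 2 * tau.
    rewrite -{2}[rsubmx y 0 j]mul1r -mulrBl (_ : c'' - 1 = - (2 * tau / r)).
      rewrite mulNr normrN normrM gtr0_norm ?divr_gt0 ?mulr_gt0//.
      rewrite mulrAC ler_pdivrMr// ler_pM2l ?mulr_gt0//.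
      by rewrite (le_trans (coord_le_enorm _ _))// ltW.
    by rewrite /c''; ring.
  rewrite -(subrKA (c'' * rsubmx y 0 j)) (le_lt_trans (ler_normD _ _))//.
  move: H (z'' j) (le_div tau d'' t0) (t0).
  move: (`|rsubmx z 0 j - _|) (`|_ - rsubmx y 0 j|) (tau / d''.+1%:R).
  by clear => P Q S; lra.
rewrite !row_mxEl -[lsubmx z]hsubmxK -[lsubmx y]hsubmxK.
case: (split_ordP j) => {}j ->.
  rewrite !row_mxEl (ord1 j) -/zz1 -/y1; apply: lt_le_trans Kt.
  by rewrite ltr_norml; apply/andP; split; lra.
rewrite !row_mxEr.
have H : `|c' * rsubmx (lsubmx y) 0 j - rsubmx (lsubmx y) 0 j| <=
    k%:R * (8 / eps) * eps `^ alpha * tau.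
  rewrite -{2}[rsubmx (lsubmx y) 0 j]mul1r -mulrBl mulrC.
  rewrite normrM [X in _ * X]distrC (ger0_norm (_ : 0 <= 1 - c')) ?subr_ge0//.
  have -> : k%:R * (8 / eps) * eps `^ alpha * tau =
     eps `^ alpha * (k%:R * (8 / eps * tau)) by ring.
  apply: ler_pM => //; first by rewrite subr_ge0.
    apply: (le_trans (coord_le_enorm _ _)); apply: (le_trans (ltW y')).
    by apply: ge0_ler_powR; rewrite ?nnegrE ?(ltW y10) ?(ltW y1e) ?(ltW eps0) ?(ltW alpha0).
  apply: (@le_trans _ _ (k%:R * x)); first by lra.
  by rewrite ler_wpM2l.
rewrite -(subrKA (c' * rsubmx (lsubmx y) 0 j)) (le_lt_trans (ler_normD _ _))//.
rewrite mulrDl; move: H (z' j) (le_div _ d' ta0) tat (t0).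
move: (k%:R * _ * _ * tau) (`|rsubmx (lsubmx z) 0 j - _|).
move: (`|_ - rsubmx (lsubmx y) 0 j|) (tau `^ alpha) (tau `^ alpha / _).
by clear => P Q S U V; lra.
Qed.

End cusp_volume.

(** * Volume near cusp points *)

Section cusp_chart.
Context {R : realType}.
Local Notation leb n := (lebesgue_rV (R := R) n).

(** The powers [1], [alpha d'] and [d''] of [tau] add up to the dimension plus [(alpha - 1) d']:
    this is where the exponent [gamma] originates. *)
Lemma prod_cusp_widths d' d'' (alpha tau : R) : 0 < tau ->
  \prod_j cusp_widths d' d'' alpha tau 0 j =
  (d'.+1%:R ^- d' * d''.+1%:R ^- d'') *
    tau `^ ((1 + d' + d'')%:R + (alpha - 1) * d'%:R).
Proof.
move=> t0; rewrite /cusp_widths big_split_ord/= big_split_ord/=.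
under eq_bigr do rewrite !row_mxEl mxE.
under [X in _ * X * _]eq_bigr do rewrite row_mxEl row_mxEr mxE.
under [X in _ * _ * X]eq_bigr do rewrite row_mxEr mxE.
rewrite !prodr_const !card_ord expr1 !expr_div_n.
have E (p : R) k : (tau `^ p) ^+ k = tau `^ (p * k%:R).
  by rewrite -powR_mulrn ?powR_ge0// powRrM.
rewrite E -[tau ^+ d'']powR_mulrn ?(ltW t0)//.
have -> : (1 + d' + d'')%:R + (alpha - 1) * d'%:R =
    1 + alpha * d'%:R + d''%:R :> R by rewrite !natrD; ring.
have tD (p q : R) : tau `^ (p + q) = tau `^ p * tau `^ q.
  by rewrite powRD//; apply/implyP => _; rewrite gt_eqF.
rewrite !tD powRr1 ?(ltW t0)//.
move: (tau `^ _) (tau `^ _) => P Q; ring.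
Qed.

(** A half-size box of the cusp is pulled back by [inverse_volume]. Its radius [a] may be as thin as
    the thinnest side, since only the ratio [b / a = 1 / (2L)] enters the result. The equation on
    dimensions is propositional, so the two spaces keep separate indices and only the powers are
    identified. *)
Lemma volume_at_cusp n (Omega V : set 'rV[R]_n) d' d'' (alpha r eps g : R)
    (kappa : 'rV[R]_n -> 'rV[R]_(1 + d' + d'')) (q : 'rV[R]_n) :
  n = (1 + d' + d'')%N -> 1 < alpha -> 0 < r -> 0 < eps -> open Omega ->
  (alpha - 1) * d'%:R <= g -> smooth_chart V kappa ->
  kappa @` (Omega `&` V) = cusp alpha r eps -> V q -> volume_at Omega g q.
Proof.
move=> en alpha1 r0 eps0 oO ag [oV oK sk [k' sk' Vk]] kO Vq.
have kK v : V v -> k' (kappa v) = v by move=> Vv; apply: Vk; rewrite inE.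
have [del [L [del0 L0 delV Lk]]] := smooth_lipschitz oV Vq sk.
have [del' [L' [del'0 L'0 delK Lk']]] : exists del' L', [/\ 0 < del', 0 < L',
    cube (kappa q) del' `<=` kappa @` V & forall u v e, 0 <= e ->
      cube (kappa q) del' u -> cube (kappa q) del' v ->
      (forall i, `|u 0 i - v 0 i| <= e) ->
      forall j, `|k' u 0 j - k' v 0 j| <= L' * e].
  by apply: smooth_lipschitz => //; exists q.
have [K [t0 [K0 t00 box_cusp]]] := cusp_box d' d'' alpha1 r0 eps0.
(* The second bound keeps the pulled-back box within [rho / 2] of [x]; the bound by [L] gives
   [b <= rho / 4]. *)
pose th := Num.min 1 (Num.min (2 * K * L')^-1 L).
have th0 : 0 < th by rewrite !lt_min ltr01 L0 invr_gt0 !mulr_gt0.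
have th1 : th <= 1 by rewrite ge_min lexx.
have thK : K * th * L' <= 2^-1.
  have : th <= (2 * K * L')^-1 by rewrite !ge_min lexx !orbT.
  rewrite -(ler_pM2l (_ : 0 < K * L')) ?mulr_gt0// (mulrAC K th).
  by rewrite (_ : K * L' * (2 * K * L')^-1 = 2^-1)//; field; rewrite !gt_eqF.
have thL : th <= L by rewrite !ge_min lexx !orbT.
(* [del / 4] keeps all points near [q] where [kappa] is Lipschitz, the two bounds with [del'] keep
   their images where the inverse is Lipschitz, and [t0] is the range of [cusp_box]. *)
pose rad := Num.min 1 (Num.min (del / 4) (Num.min (del' / (4 * L))
  (Num.min t0 (del' / (4 * K))))).
have rad0 : 0 < rad.
  by rewrite !lt_min ltr01 t00 !divr_gt0 ?mulr_gt0.
have rad_le : [/\ rad <= 1, rad <= del / 4, rad <= del' / (4 * L), rad <= t0 &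
    rad <= del' / (4 * K)].
  by split; rewrite !ge_min lexx ?orbT.
have {rad_le} [rad1 radd radL radt radK] := rad_le.
pose E0 := (1 + d' + d'')%:R + (alpha - 1) * d'%:R : R.
pose c0 := (2 * L) ^- n * (d'.+1%:R ^- d' * d''.+1%:R ^- d'') * th `^ E0.
exists c0, rad; split => //.
  by rewrite !mulr_gt0 ?powR_gt0// invr_gt0 exprn_gt0// ?mulr_gt0// ltr0n.
move=> x rho Ox qx /andP[rho0 rhor].
have rho1 : rho <= 1 by exact: le_trans rad1.
have qxd : cube q del x.
  by move=> i; move: (qx i) radd del0; clear; lra.
have Vx := delV _ qxd.
have qqd : cube q del q by exact: cube_center.
pose y := kappa x.
have cy : cusp alpha r eps y by rewrite -kO; exists x.
have yq i : `|y 0 i - kappa q 0 i| <= del' / 4.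
  apply: (@le_trans _ _ (L * rad)).
    by apply: Lk => //; [exact: ltW|move=> j; exact/ltW/qx].
  by rewrite mulrC -ler_pdivlMr// (le_trans radL)// invfM mulrA.
pose tau := th * rho.
have tau0 : 0 < tau by rewrite mulr_gt0.
have taur : tau <= rho by rewrite ler_piMl// ltW.
have tau1 : tau <= 1 by exact: le_trans rho1.
have Ktau : K * tau <= del' / 4.
  rewrite mulrC -ler_pdivlMr// (le_trans taur)// (le_trans rhor)//.
  by rewrite (le_trans radK)// invfM mulrA.
have [w wP] : exists w : 'rV[R]_(1 + d' + d''), forall z : 'rV[R]_(1 + d' + d''),
    (forall j, `|z 0 j - w 0 j| < cusp_widths d' d'' alpha tau 0 j) ->
    cusp alpha r eps z /\ cube y (K * tau) z.
  by apply: box_cusp => //; rewrite tau0 (le_trans taur)// (le_trans rhor).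
pose hb := cusp_widths d' d'' alpha tau.
pose N : R := (1 + d' + d'').+1%:R.
have ta0 : 0 < tau `^ alpha by rewrite powR_gt0.
have tat : tau `^ alpha <= tau.
  by rewrite -{2}(powRr1 (ltW tau0)); apply: ger_powR; rewrite ?tau0 ?tau1 ?(ltW alpha1).
pose a := tau `^ alpha / (2 * N).
have N0 : 0 < N by rewrite ltr0n.
have a0 : 0 < a by rewrite divr_gt0// mulr_gt0.
have ahb j : a <= hb 0 j / 2.
  have H (s : R) m : (m <= 1 + d' + d'')%N -> tau `^ alpha <= s ->
      a <= s / m.+1%:R / 2.
    move=> mN ts; rewrite /a invfM [2^-1 * _]mulrC mulrA ler_pM2r//.
    apply: ler_pM => //; rewrite ?invr_ge0 ?(ltW N0) ?(ltW ta0)//.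
    by rewrite lef_pV2 ?posrE ?ltr0n// ler_nat ltnS.
  rewrite /hb /cusp_widths; case: (split_ordP j) => {}j ->; last first.
    by rewrite row_mxEr mxE; apply: H => //; rewrite leq_addl.
  rewrite row_mxEl; case: (split_ordP j) => {}j ->; last first.
    by rewrite row_mxEr mxE; apply: H => //; rewrite -addnA addnCA leq_addr.
  by rewrite row_mxEl mxE -[tau]divr1; exact: (H tau 0%N).
have hb0 j : 0 < hb 0 j by move: (ahb j) a0; clear; lra.
(* Halving the box leaves a margin of at least [a] on every side, so points whose image is within
   [a / 2] of [W] still map into the cusp. *)
pose W : set 'rV[R]_(1 + d' + d'') :=
  box (fun j => w 0 j - hb 0 j / 2) (fun j => w 0 j + hb 0 j / 2).
have WP z : W z -> forall j, `|z 0 j - w 0 j| < hb 0 j / 2.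
  by move=> Wz j; rewrite ltr_distl; exact: Wz.
have Wcusp z : W z -> cusp alpha r eps z /\ cube y (K * tau) z.
  move=> /WP Wz; apply: wP => j; rewrite (lt_trans (Wz j))//.
  by move: (hb0 j); rewrite -/hb; clear; lra.
have Wdel z : W z -> cube (kappa q) del' z.
  move=> /Wcusp[_ zy] i; rewrite -(subrKA (y 0 i)).
  rewrite (le_lt_trans (ler_normD _ _))//.
  by have := zy i; have := yq i; move: Ktau del'0; clear; lra.
pose b := a / (2 * L).
have b0 : 0 < b by rewrite divr_gt0// mulr_gt0.
have brho : b <= rho / 4.
  have a_tau : a <= tau / 2.
    rewrite ler_pdivrMr ?mulr_gt0// (le_trans tat)//.
    rewrite (_ : tau / 2 * (2 * N) = tau * N); last by field.
    by rewrite ler_peMr ?(ltW tau0)// ler1n.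
  rewrite ler_pdivrMr ?mulr_gt0//; apply: (le_trans a_tau).
  by move: (ler_wpM2r (ltW rho0) thL); rewrite -/tau; clear; lra.
have mO := open_rV_measurable oO.
have := @inverse_volume _ n (1 + d' + d'') W (cube x rho `&` Omega) k' kappa a b.
move=> /(_ (measurable_box _ _)).
have mE : measurable (cube x rho `&` Omega).
  by apply: measurableI => //; exact: measurable_cube.
move=> /(_ mE); have mk' i : measurable_fun W (fun z => k' z 0 i).
  apply: (@measurable_funS _ _ _ _ (kappa @` V)).
  - exact: open_rV_measurable.
  - by move=> z /Wdel/delK.
  - by apply: continuous_on_measurable => //; have [] := sk' 0%N i.
move=> /(_ mk' a0 b0) H.
have {H} : (((2 * b) ^+ n)%:E * leb (1 + d' + d'') W <=
    ((2 * a) ^+ (1 + d' + d''))%:E * leb n (cube x rho `&` Omega))%E.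
  apply: H => z u Wz zu.
  have [cz yz] := Wcusp z Wz.
  have [v0 [Ov0 Vv0] v0z] : (kappa @` (Omega `&` V)) z by rewrite kO.
  have k'z : k' z = v0 by rewrite -v0z kK.
  have zd := Wdel z Wz.
  have yd : cube (kappa q) del' y.
    by move=> i; move: (yq i) del'0; clear; lra.
  have k'zx i : `|k' z 0 i - x 0 i| <= rho / 2.
    rewrite -{1}(kK x Vx); apply: (@le_trans _ _ (L' * (K * tau))).
      apply: Lk' => //; first by rewrite mulr_ge0 ?ltW.
      by move=> j; exact/ltW/yz.
    rewrite (_ : _ * _ = K * th * L' * rho); last by rewrite /tau; ring.
    by rewrite mulrC ler_pM2l.
  have xu i : `|u 0 i - x 0 i| < rho.
    rewrite -(subrKA (k' z 0 i)) (le_lt_trans (ler_normD _ _))//.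
    by have := zu i; have := k'zx i; move: brho rho0; clear; lra.
  have k'zd : cube q del (k' z).
    move=> i; rewrite -(subrKA (x 0 i)) (le_lt_trans (ler_normD _ _))//.
    by have := k'zx i; have := qx i; move: rhor radd rho0 del0; clear; lra.
  have ud : cube q del u.
    move=> i; rewrite -(subrKA (x 0 i)) (le_lt_trans (ler_normD _ _))//.
    by have := xu i; have := qx i; move: rhor radd rho0 del0; clear; lra.
  have Vu := delV _ ud.
  have kuz j : `|kappa u 0 j - z 0 j| <= a / 2.
    rewrite -{1}v0z -k'z (_ : a / 2 = L * b); last by rewrite /b; field; rewrite gt_eqF.
    by apply: Lk => //; [exact: ltW|move=> i; exact/ltW/zu].
  have kuc : cusp alpha r eps (kappa u).
    apply: (wP _ _).1 => j; rewrite -(subrKA (z 0 j)) (le_lt_trans (ler_normD _ _))//.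
    by have := kuz j; have := WP z Wz j; have := ahb j; rewrite -/hb; move: a0; clear; lra.
  (* The cusp is the image of [Omega] within [V], so injectivity of the chart puts [u] itself in
     [Omega]. *)
  have [v [Ov Vv] vu] : (kappa @` (Omega `&` V)) (kappa u) by rewrite kO.
  have uv : u = v by rewrite -(kK u Vu) -vu kK.
  split; first by split => //; rewrite uv.
  by move=> j; rewrite distrC (le_lt_trans (kuz j))//; move: a0; clear; lra.
rewrite leb_box => [|j]; last by move: (hb0 j); clear; lra.
rewrite (eq_bigr (fun j => hb 0 j)); last by move=> j _; field.
rewrite prod_cusp_widths// -/E0 -en.
have a2n : 0 < (2 * a) ^+ n by rewrite exprn_gt0// mulr_gt0.
move=> H; rewrite -(@lee_pmul2l _ ((2 * a) ^+ n)%:E) ?lte_fin//.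
apply: le_trans H; rewrite -!EFinM lee_fin.
have -> : (2 * b) ^+ n = (2 * a) ^+ n * (2 * L) ^- n.
  by rewrite -exprVn -exprMn; congr (_ ^+ n); rewrite /b; field; rewrite gt_eqF.
rewrite -[leRHS]mulrA ler_pM2l// /c0 -!mulrA.
rewrite ler_pM2l ?invr_gt0 ?exprn_gt0 ?mulr_gt0//.
rewrite ler_pM2l ?invr_gt0 ?exprn_gt0 ?ltr0n//.
rewrite ler_pM2l ?invr_gt0 ?exprn_gt0 ?ltr0n//.
rewrite /tau powRM ?(ltW th0) ?(ltW rho0)// ler_pM2l ?powR_gt0//.
apply: ger_powR; first by rewrite rho0.
by rewrite /E0 en lerD2l.
Qed.

End cusp_chart.

(** * From local to uniform volume bounds *)

Section volume_compactness.
Context {R : realType}.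
Local Notation leb n := (lebesgue_rV (R := R) n).

Lemma coord_le_norm n (v : 'rV[R]_n) i : `|v 0 i| <= `|v|.
Proof.
have /mapP[j Hj ->] : `|v 0 i| \in [seq `|v x.1 x.2| | x : 'I_1 * 'I_n].
  by apply/mapP; exists (ord0, i) => //=; rewrite mem_enum.
by rewrite [leRHS]/Num.norm /= mx_normrE; apply/bigmax_geP; right => /=; exists j.
Qed.

Lemma bounded_sub_cube n (A : set 'rV[R]_n) : bounded_set A ->
  exists2 M, 0 < M & A `<=` cube 0 M.
Proof.
move=> [M [_ AM]]; exists (`|M| + 2); first by rewrite ltr_wpDl.
move=> v Av i; rewrite mxE subr0 (le_lt_trans (coord_le_norm _ _))//.
apply: (@le_lt_trans _ _ (`|M| + 1)); last by rewrite ltrD2l ltr1n.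
by apply: AM Av; rewrite (le_lt_trans (ler_norm M))// ltrDl.
Qed.

Lemma compact_closure_bounded n (A : set 'rV[R]_n) : bounded_set A ->
  compact (closure A).
Proof.
move=> /bounded_sub_cube[M M0 AM].
pose B := [set v : 'rV[R]_n | forall i, v 0 i \in `[- M, M]].
have cB : compact B.
  apply: (@rV_compact _  _ (fun=> `[- M, M]%classic)).
  by move=> _; exact: segment_compact.
apply: (subclosed_compact _ cB); first exact: closed_closure.
have : closed B by apply: compact_closed => //; exact: norm_hausdorff.
move=> /closure_id ->; apply: closure_subset => v /AM vM i.
by rewrite in_itv/= -ler_norml; have := vM i; rewrite mxE subr0 => /ltW.
Qed.

(** A single [del] is both the constant and the range of radii: the estimate weakens as [del]
    decreases, so it holds eventually as [del] tends to [0^+] near each point, and compactness of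
    the closure makes this uniform. *)
Lemma volume_lower_bound n (Omega : set 'rV[R]_n) (g : R) :
  bounded_set Omega -> (forall q, closure Omega q -> volume_at Omega g q) ->
  exists2 del, 0 < del & forall x r, Omega x -> 0 < r <= del ->
    ((del * r `^ (n%:R + g))%:E <= leb n (cube x r `&` Omega))%E.
Proof.
move=> bO vO; have /compact_near_coveringP cO := compact_closure_bounded bO.
pose P (del : R) x := Omega x -> forall r, 0 < r <= del ->
  ((del * r `^ (n%:R + g))%:E <= leb n (cube x r `&` Omega))%E.
have PO : \forall del \near 0^'+, closure Omega `<=` P del.
  apply: cO => q /vO[c [e [c0 e0 ce]]].
  exists (cube q e, [set del | del < Num.min c e]).
  - split; first by apply/nbhs_cube; exists e.
    by apply: nbhs_right_lt; rewrite lt_min c0.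
  - move=> [x del] /= [qx]; rewrite lt_min => /andP[dc de] Ox r /andP[r0 rd].
    apply: (le_trans _ (ce x r Ox qx _)); last by rewrite r0 ltW// (le_lt_trans rd).
    by rewrite lee_fin ler_wpM2r ?powR_ge0// ltW.
have PO0 : \forall del \near (0 : R)^'+, closure Omega `<=` P del /\ 0 < del.
  by apply: filterI; [exact: PO|exact: nbhs_right_gt].
case: (@filter_ex _ _ (at_right_proper_filter (0 : R)) _ PO0) => del [PdO del0].
by exists del => // x r Ox rd; apply: PdO => //; exact: subset_closure.
Qed.

Lemma assumption1_volume n (Omega : set 'rV[R]_n) (I : finType) (Ir Ic : {set I})
    (omega S : I -> set 'rV[R]_n) (d' d'' : I -> nat) (alpha r eps : I -> R) g :
  open Omega -> assumption1 Omega Ir Ic omega S d' d'' alpha r eps ->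
  0 <= g -> (forall i, i \in Ic -> (alpha i - 1) * (d' i)%:R <= g) ->
  forall q, closure Omega q -> volume_at Omega g q.
Proof.
move=> oO [_ cover lip cus] g0 ag q cq.
have [Oq|nOq] := pselect (Omega q); first exact: volume_at_interior.
have bq : boundary Omega q.
  by split => //; move=> /interior_subset.
have [i /= + oq] := cover _ bq; rewrite inE => /orP[iI|iI].
  by apply: volume_at_lipschitz => //; apply: lip iI _ _.
have [en d'1 [a1 r0 e0] _ [V oV SV]] := cus _ iI.
move: oq; rewrite oV => -[p Sp Vq].
have [_ [kappa [sk _ kO]]] := SV _ Sp.
exact: (volume_at_cusp en a1 r0 e0 oO (ag _ iI) sk kO Vq).
Qed.

End volume_compactness.

(** * The spectral gap for small steps *)

Section metropolis_estimates.
Context {R : realType} {d : nat}.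
Local Notation leb := (lebesgue_rV (R := R) d).
Variables (Omega : set 'rV[R]_d) (rho : 'rV[R]_d -> R) (m M : R).
Hypotheses (oO : open Omega) (mO : measurable Omega) (Ooo : (leb Omega < +oo)%E).
Hypotheses (mrho : measurable_fun Omega rho) (m_gt0 : 0 < m) (mM : m <= M).
Hypothesis rho_bounds : forall x, Omega x -> m <= rho x <= M.
Local Notation mu := (restr_leb mO Ooo).
Local Notation w := (weight Omega rho m).
Hypothesis w1 : \int[mu]_x w x = 1.

Local Notation V := (fine (leb [set x : 'rV[R]_d | (enorm x < 1)%R])).
Local Notation N := (d.+1%:R : R).

Let M_gt0 : 0 < M. Proof. exact: lt_le_trans mM. Qed.
Let N_gt0 : 0 < N. Proof. by rewrite ltr0n. Qed.
Let bw : bmeas w := bmeas_weight mO mrho m_gt0 mM rho_bounds.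
Let w_ge := weight_ge rho_bounds.
Let w_le := weight_le mM rho_bounds.
Let w_gt0 x : 0 < w x := lt_le_trans m_gt0 (w_ge x).

Lemma unit_volume_gt0 : 0 < V.
Proof. by rewrite fine_gt0// unit_ball_volume. Qed.

Lemma bmeas2_cube r : bmeas2 (fun x z : 'rV[R]_d => \1_(cube z r) x : R).
Proof.
pose A := [set p : 'rV[R]_d * 'rV[R]_d | cube p.2 r p.1].
have mA : measurable A.
  have -> : A = \bigcap_(i in [set: 'I_d])
      ((fun p : 'rV[R]_d * 'rV[R]_d => p.1 0 i - p.2 0 i) @^-1` `]- r, r[).
    apply/seteqP; split => p H i; first by move=> _; rewrite /= in_itv/= -ltr_norml.
    by have := H i I; rewrite /= in_itv/= -ltr_norml.
  apply: fin_bigcap_measurable => [|i _]; first exact: (@finite_finset 'I_d).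
  rewrite -[X in measurable X]setTI.
  by apply: (bmeas_coordB i) => //; exact: measurable_itv.
rewrite /bmeas2 (_ : (fun p => _) = \1_A); first exact: bmeas_indic.
by apply/funext => p; rewrite !indicE.
Qed.

Lemma le_Rint_indic (A : set 'rV[R]_d) (v : R) : measurable A ->
  (v%:E <= leb (A `&` Omega))%E -> v <= \int[mu]_x \1_A x.
Proof.
by move=> mA vA; rewrite Rint_indic// -lee_fin fineK// fin_num_measure.
Qed.

Lemma cube_mass_gt0 x r : Omega x -> 0 < r -> (0 < leb (cube x r `&` Omega))%E.
Proof.
move=> Ox r0.
have /nbhs_cube[e e0 eO] : nbhs x Omega by apply: open_nbhs_nbhs.
pose f := Num.min r e; have f0 : 0 < f by rewrite lt_min r0.
have fr : f <= r by rewrite ge_min lexx.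
have fe : f <= e by rewrite ge_min lexx orbT.
apply: (@lt_le_trans _ _ (leb (cube x f))).
  by rewrite leb_cube ?(ltW f0)// lte_fin exprn_gt0// mulr_gt0.
apply: le_measure; rewrite ?inE; [exact: measurable_cube| |].
  by apply: measurableI => //; exact: measurable_cube.
move=> y yx; split; first by move=> i; exact: lt_le_trans (yx i) fr.
by apply: eO => i; exact: lt_le_trans (yx i) fe.
Qed.

Lemma coordinate_test_function B p (i : 'I_d) : Omega `<=` cube 0 B -> Omega p ->
  exists u, [/\ centered mu w u, 0 < rdot mu w u u & forall x y,
    Omega x -> Omega y -> `|u x - u y| <= `|x 0 i - y 0 i|].
Proof.
move=> OB Op; have B0 : 0 <= B.
  by have := OB p Op i; rewrite mxE subr0 => /ltW; exact: le_trans.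
pose u0 x : R := \1_Omega x * x 0 i.
have bu0 : bmeas u0.
  split; first by apply: measurable_funM => //; exact: measurable_coordv.
  exists B => x; rewrite /u0 indicE; have [/set_mem Ox|_] := boolP (x \in Omega).
    by rewrite mul1r; have := OB x Ox i; rewrite mxE subr0 => /ltW.
  by rewrite mul0r normr0.
pose c := \int[mu]_x (u0 x * w x).
pose u x := u0 x + (- c) * 1; have bu : bmeas u by rewrite /u; bm.
have uE x : Omega x -> u x = x 0 i - c.
  by move=> Ox; rewrite /u /u0 indicE mem_set// mul1r mulr1.
exists u; split; last first.
- by move=> x y Ox Oy; rewrite !uE// opprB subrKA.
- have /nbhs_cube[e e0 eO] : nbhs p Omega by apply: open_nbhs_nbhs.
  (* The shift goes away from the mean [c], so that [|u|] is at least [e / 4] on the cube around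
     [q]. *)
  pose t := if c <= p 0 i then e / 2 else - (e / 2).
  have tE : `|t| = e / 2 by rewrite /t; case: ifP; rewrite ?normrN gtr0_norm// divr_gt0.
  pose q : 'rV[R]_d := \row_j (p 0 j + t * (j == i)%:R).
  have e40 : 0 < e / 4 by rewrite divr_gt0.
  pose D := cube q (e / 4); have mD : measurable D by exact: measurable_cube.
  have bD := bmeas_indic (R := R) mD.
  have DO : D `<=` Omega.
    move=> x Dx; apply: eO => j; have := Dx j; rewrite mxE => H.
    have tj : `|t * (j == i)%:R| <= e / 2.
      by rewrite normrM tE ler_piMr ?divr_ge0 ?(ltW e0)//; case: (j == i); rewrite ?normr1 ?normr0.
    have -> : x 0 j - p 0 j = x 0 j - (p 0 j + t * (j == i)%:R) + t * (j == i)%:R by ring.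
    by rewrite (le_lt_trans (ler_normD _ _))//; move: H tj e0; lra.
  have Du x : D x -> e / 4 <= `|u x|.
    move=> Dx; rewrite uE; last exact: DO.
    have := Dx i; rewrite mxE eqxx mulr1 /t ltr_norml => /andP[].
    case: ifP => [cp|/negbT]; last rewrite -ltNge => cp.
      by move=> H1 H2; rewrite (le_trans _ (ler_norm _))//; move: cp H1 e0; lra.
    by move=> H1 H2; rewrite -normrN (le_trans _ (ler_norm _))//; move: cp H2 e0; lra.
  apply: (@lt_le_trans _ _ (\int[mu]_x ((e / 4) ^+ 2 * m * \1_D x))).
    rewrite RintZ// mulr_gt0//; first by rewrite mulr_gt0// exprn_gt0.
    apply: (@lt_le_trans _ _ ((2 * (e / 4)) ^+ d)); first by rewrite exprn_gt0// mulr_gt0.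
    apply: le_Rint_indic => //; rewrite setIidl//.
    by have /= -> := leb_cube q (ltW e40).
  apply: Rint_le; [by bm|by bm|move=> x].
  rewrite indicE; have [/set_mem Dx|_] := boolP (x \in D); last first.
    by rewrite mulr0 -expr2 mulr_ge0 ?sqr_ge0// ltW.
  rewrite mulr1 -expr2 ler_pM ?sqr_ge0 ?(ltW m_gt0)//.
  rewrite -[leRHS]real_normK ?num_real//.
  by apply: lerXn2r; rewrite ?nnegrE ?(ltW e40)//; exact: Du.
- split => //; rewrite /rdot.
  transitivity (\int[mu]_x (u0 x * w x + (- c) * w x)).
    by apply: eq_Rintegral => x _; rewrite /u; ring.
  by rewrite RintD; [|by bm|by bm]; rewrite RintZ// w1 mulr1 subrr.
Qed.

Section fixed_step.
Variable h : R.
Hypothesis h_gt0 : 0 < h.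
Local Notation s := (sym_density Omega rho h m).
Let bs : bmeas2 s := bmeas_sym_density h mO mrho m_gt0 mM rho_bounds.
Let s_ge0 := sym_density_ge0 h_gt0 m_gt0 rho_bounds.
Let s_sym := sym_densityC Omega rho h m.
Local Notation rop := (rop mu w s).
Local Notation rdot := (rdot mu w).
Local Notation rgap := (rgap mu w s).
Local Notation centered := (centered mu w).

(** By scaling, the proposal density has mass 1 over the whole space, and
    [min (w x) (w y) <= w x]. *)
Lemma metropolis_rjump_le1 x : rjump mu w s x <= 1.
Proof.
pose B := affv x h @^-1` [set v : 'rV[R]_d | enorm v < 1].
have mB : measurable B.
  rewrite -[B]setTI; apply: measurable_affv => //.
  exact: measurable_unit_ball.
have V0 := unit_volume_gt0; have hd0 : 0 < h ^+ d by rewrite exprn_gt0.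
rewrite /rjump ler_pdivrMl// mulr1.
have bB := bmeas_indic (R := R) mB.
apply: (@le_trans _ _ (\int[mu]_y (w x * (h ^- d * V^-1) * \1_B y))).
  apply: Rint_le; [by bm|by bm|move=> y].
  rewrite indicE; have [_|/negP yB] := boolP (y \in B).
    by rewrite mulr1 mulrC; exact: (sym_density_le h_gt0 m_gt0 rho_bounds).
  rewrite mulr0 /sym_density /phi indicE memNset ?mulr0 ?mul0r//.
  by move=> H; apply: yB; apply/mem_set.
rewrite RintZ// Rint_indic// -mulrA ler_piMr ?(ltW (w_gt0 x))//.
rewrite -invfM ler_pdivrMl ?mulr_gt0// mulr1.
rewrite -lee_fin fineK ?fin_num_measure//.
apply: (@le_trans _ _ (leb B)).
  by apply: le_measure; rewrite ?inE//; exact: measurableI.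
rewrite leb_affv//; last exact: measurable_unit_ball.
rewrite EFinM fineK// ge0_fin_numE//.
by case/andP: (@unit_ball_volume R d).
Qed.

Lemma sym_density_near (x y : 'rV[R]_d) : (forall i, `|x 0 i - y 0 i| < h / N) ->
  h ^- d * V^-1 * m <= s x y.
Proof.
move=> xy; have hd0 : 0 < h ^+ d by rewrite exprn_gt0.
have V0 := unit_volume_gt0; rewrite /sym_density /phi indicE mem_set.
  by rewrite mulr1 ler_pM2l ?mulr_gt0 ?invr_gt0// le_min !w_ge.
rewrite /= ; apply: enorm_lt => // i; rewrite !mxE normrM gtr0_norm ?invr_gt0//.
by rewrite mulrC ltr_pdivrMr// mul1r mulrC.
Qed.

Lemma metropolis_rjump_ge x (v : R) : (v%:E <= leb (cube x (h / N) `&` Omega))%E ->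
  h ^- d * V^-1 * (m / M) * v <= rjump mu w s x.
Proof.
move=> vx; have hd0 : 0 < h ^+ d by rewrite exprn_gt0.
have V0 := unit_volume_gt0.
have bc : bmeas (\1_(cube x (h / N)) : _ -> R) by apply: bmeas_indic; exact: measurable_cube.
rewrite /rjump ler_pdivlMl//.
apply: (@le_trans _ _ (\int[mu]_y (h ^- d * V^-1 * m * \1_(cube x (h / N)) y))); last first.
  apply: Rint_le; [by bm|by bm|move=> y].
  rewrite indicE; have [/set_mem yx|_] := boolP (y \in _); last by rewrite mulr0.
  by rewrite mulr1; apply: sym_density_near => i; rewrite distrC.
have vI := le_Rint_indic (measurable_cube _ _) vx.
have I0 : 0 <= \int[mu]_y (\1_(cube x (h / N)) y : R) by apply: Rint_ge0.
rewrite RintZ// [leLHS](_ : _ = h ^- d * V^-1 * m * (w x / M * v)); last by ring.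
rewrite ler_pM2l ?mulr_gt0 ?invr_gt0//.
apply: (@le_trans _ _ (w x / M * \int[mu]_y \1_(cube x (h / N)) y)).
  by rewrite ler_wpM2l// divr_ge0 ?(ltW (w_gt0 x))// ltW.
by rewrite ler_piMl// ler_pdivrMr// mul1r.
Qed.

(** [rop_lower_bound] with the cubes of radius [r = h / (2N)]: two points of such a cube differ by
    less than [h / N], where the kernel is bounded below. If [z] is within [r / 2] of [x], its cube
    contains the cube of radius [r / 2] about [x], of mass at least [v]; such [z] fill a volume
    [r^d]. *)
Lemma metropolis_bottom (B v : R) : 0 < B -> Omega `<=` cube 0 B -> h <= 1 ->
  0 <= v -> (forall x, Omega x -> (v%:E <= leb (cube x (h / (4 * N)) `&` Omega))%E) ->
  forall u, bmeas u ->
  v * m / (2 ^+ d * h ^+ d * V * M) * rdot u u <= rdot u u + rdot (rop u) u.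
Proof.
move=> B0 OB h1 v0 vO u bu; have V0 := unit_volume_gt0.
have hd0 : 0 < h ^+ d by rewrite exprn_gt0.
pose r := h / (2 * N).
have r0 : 0 < r by rewrite divr_gt0// mulr_gt0.
have rE : r = h / (4 * N) + h / (4 * N).
  by rewrite /r; move: N N_gt0 => k k0; field; rewrite gt_eqF.
have q0 : 0 < h / (4 * N) by rewrite divr_gt0// mulr_gt0.
have q1 : h / (4 * N) <= 1.
  rewrite ler_pdivrMr ?mulr_gt0// mul1r (le_trans h1)//.
  by rewrite -natrM ler1n.
(* Enlarging by 1 is enough for all these centres, as [h / (4N) <= 1]. *)
have mZ : measurable (cube (0 : 'rV[R]_d) (B + 1)) by exact: measurable_cube.
have Zoo : (leb (cube 0 (B + 1)) < +oo)%E.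
  by rewrite leb_cube ?ltry// addr_ge0// ltW.
pose nu : {finite_measure set 'rV[R]_d -> \bar R} := restr_leb mZ Zoo.
pose C1 := (2 * r) ^+ d * (h ^+ d * V / m).
have C10 : 0 < C1.
  by apply: mulr_gt0; [rewrite exprn_gt0// mulr_gt0|rewrite divr_gt0// mulr_gt0].
have be := bmeas2_cube r.
have -> : v * m / (2 ^+ d * h ^+ d * V * M) = r ^+ d * v / (C1 * M).
  have rd0 : 0 < r ^+ d by rewrite exprn_gt0.
  have td0 : 0 < 2 ^+ d :> R by rewrite exprn_gt0.
  rewrite /C1 [(2 * r) ^+ d]exprMn; move: m_gt0 M_gt0 V0 hd0 rd0 td0.
  move: V (h ^+ d) (r ^+ d) (2 ^+ d) => k1 k2 k3 k4 *; field.
  by rewrite !gt_eqF.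
apply: (rop_lower_bound m_gt0 w_ge bw bs s_sym metropolis_rjump_le1 (nu := nu)
  be _ mO _ C10 _ M_gt0 w_le _ _ bu) => //.
- exact: restr_leb_setC.
- by rewrite mulr_ge0// exprn_ge0// ltW.
- move=> x y; have bx : bmeas (fun z => \1_(cube z r) x : R) := bmeas2_l x be.
  have by_ : bmeas (fun z => \1_(cube z r) y : R) := bmeas2_l y be.
  apply: (@le_trans _ _ (\int[nu]_z (\1_(cube z r) x * (h ^+ d * V / m * s x y)))).
    apply: Rint_le; [by bm|by bm|move=> z].
    rewrite !indicE; have [/set_mem zx|_] := boolP (x \in _); last by rewrite !mul0r.
    rewrite !mul1r; have [/set_mem zy|_] := boolP (y \in _); last first.
      by rewrite mulr_ge0// divr_ge0 ?mulr_ge0 ?(ltW hd0) ?(ltW V0) ?(ltW m_gt0).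
    have := @sym_density_near x y; rewrite -(ler_pM2l (_ : 0 < h ^+ d * V / m)); last first.
      by rewrite divr_gt0// mulr_gt0.
    rewrite (_ : _ / _ * _ = 1); last by field; rewrite !gt_eqF.
    apply => i; rewrite -(subrKA (z 0 i)) (le_lt_trans (ler_normD _ _))//.
    rewrite (_ : h / N = r + r); last first.
      by rewrite /r; move: N N_gt0 => k k0; field; rewrite gt_eqF.
    by apply: ltrD; [exact: zx|rewrite distrC; exact: zy].
  rewrite RintZr// /C1 -[leRHS]mulrA ler_wpM2r//.
    by rewrite mulr_ge0// divr_ge0 ?mulr_ge0 ?(ltW hd0) ?(ltW V0) ?(ltW m_gt0).
  have -> : \int[nu]_z (\1_(cube z r) x : R) = \int[nu]_z \1_(cube x r) z.
    apply: eq_Rintegral => z _; rewrite !indicE; congr ((nat_of_bool _)%:R).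
    by apply/idP/idP => /set_mem H; apply/mem_set => i; rewrite distrC; exact: H.
  rewrite Rint_indic; last exact: measurable_cube.
  rewrite -lee_fin fineK; last by rewrite fin_num_measure//; exact: measurable_cube.
  apply: (@le_trans _ _ (leb (cube x r))); last by rewrite leb_cube// ltW.
  apply: le_measure; rewrite ?inE; [|exact: measurable_cube|by move=> z []].
  by apply: measurableI; exact: measurable_cube.
- move=> x Ox; have bx : bmeas (fun z => \1_(cube z r) x : R) := bmeas2_l x be.
  pose D := cube x (h / (4 * N)); have mD : measurable D by exact: measurable_cube.
  have bD := bmeas_indic (R := R) mD.
  have bI : bmeas (fun z => \int[mu]_y (\1_(cube z r) y : R)).
    by apply: bmeas_Rint; exact: (bmeas2_swap be).
  apply: (@le_trans _ _ (\int[nu]_z (\1_D z * v))).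
    rewrite RintZr// ler_wpM2r// Rint_indic//.
    have -> : nu D = leb D.
      rewrite /= /mfrestr /mrestr setIidl// => z Dz i.
      rewrite mxE subr0 -(subrK (x 0 i) (z 0 i)) (le_lt_trans (ler_normD _ _))//.
      rewrite addrC ltrD//; first by have := OB x Ox i; rewrite mxE subr0.
      by rewrite (lt_le_trans (Dz i)).
    rewrite leb_cube ?(ltW q0)// (_ : 2 * _ = r)//.
    by rewrite /r; move: N N_gt0 => k k0; field; rewrite gt_eqF.
  apply: Rint_le; [by bm|by bm|move=> z].
  rewrite !indicE; have [/set_mem Dz|_] := boolP (z \in D); last first.
    by rewrite mul0r mulr_ge0//; apply: Rint_ge0.
  rewrite mul1r mem_set ?mul1r.
    apply: le_Rint_indic; first exact: measurable_cube.
    apply: (le_trans (vO x Ox)); apply: le_measure; rewrite ?inE.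
    - by apply: measurableI => //; exact: measurable_cube.
    - by apply: measurableI => //; exact: measurable_cube.
    move=> y [xy Oy]; split => // i.
    rewrite -(subrKA (x 0 i)) (le_lt_trans (ler_normD _ _))// rE ltrD//.
    by rewrite distrC; exact: Dz.
  by move=> i; rewrite rE distrC (lt_trans (Dz i))// ltrDl.
Qed.

Lemma metropolis_rgap_le u (i : 'I_d) : centered u ->
  (forall x y, Omega x -> Omega y -> `|u x - u y| <= `|x 0 i - y 0 i|) ->
  rgap * rdot u u <= h ^+ 2 / 2.
Proof.
move=> cu ul; have bu : bmeas u by case: cu.
apply: (le_trans (rgap_le m_gt0 w_ge bw bs s_sym s_ge0 cu)).
rewrite (dirichlet_rop mu m_gt0 w_ge bw bs s_sym bu) mulrC ler_pM2r ?invr_gt0//.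
have OC := restr_leb_setC mO Ooo.
apply: (@le_trans _ _ (\int[mu]_x (h ^+ 2 * w x))); last by rewrite RintZ// w1 mulr1.
apply: (Rint_ae_le mO OC) => [| |x Ox]; [by bm|by bm|].
apply: (@le_trans _ _ (\int[mu]_y (h ^+ 2 * s x y))).
  apply: (Rint_ae_le mO OC) => [| |y Oy]; [by bm|by bm|].
  rewrite mulrC; have [xy|xy] := ltP (enorm (h^-1 *: (x - y))) 1.
    rewrite ler_wpM2r// -real_normK ?num_real//.
    have xyh : `|x 0 i - y 0 i| <= h.
      have := le_lt_trans (coord_le_enorm _ i) xy.
      rewrite !mxE normrM gtr0_norm ?invr_gt0// mulrC ltr_pdivrMr// mul1r.
      exact: ltW.
    by apply: lerXn2r; rewrite ?nnegrE ?(ltW h_gt0)// (le_trans (ul _ _ Ox Oy)).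
  rewrite (_ : s x y = 0) ?mulr0// /sym_density /phi indicE memNset ?mulr0 ?mul0r//.
  by move=> /=; rewrite ltNge xy.
rewrite RintZ; last by bm.
rewrite ler_pM2l ?exprn_gt0//.
by have := metropolis_rjump_le1 x; rewrite /rjump ler_pdivrMl// mulr1.
Qed.

(** Four times [del] is [h / N]: points of two cubes whose centres are less than [2 del] apart are
    within direct reach of the kernel. *)
Let del := h / (4 * N).
Let A x := cube x del `&` Omega.

Let del0 : 0 < del. Proof. by rewrite divr_gt0// mulr_gt0. Qed.

Let mA x : measurable (A x).
Proof. by apply: measurableI => //; exact: measurable_cube. Qed.

Let A0 x : Omega x -> (0 < mu (A x))%E.
Proof.
move=> Ox; rewrite /= /mfrestr /mrestr setIidl; first exact: cube_mass_gt0.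
by move=> ? [].
Qed.

Let near_cubes (x y : 'rV[R]_d) : cube x (del + del) y -> linked mu s (A x) (A y).
Proof.
move=> xy; apply: (linked_near mu bs s_ge0 (c := h ^- d * V^-1 * m)) => //.
  by rewrite !mulr_gt0 ?invr_gt0 ?exprn_gt0 ?unit_volume_gt0.
move=> a b [ax _] [by_ _].
apply: sym_density_near => i.
have hE : h / N = del + (del + del) + del.
  by rewrite /del; move: N N_gt0 => k k0; field; rewrite gt_eqF.
have -> : a 0 i - b 0 i = (a 0 i - x 0 i) + (x 0 i - y 0 i) + (y 0 i - b 0 i) by ring.
rewrite hE (le_lt_trans (ler_normD _ _))// ltrD//; last by rewrite distrC; exact: by_.
apply: (le_lt_trans (ler_normD _ _)); apply: ltrD; first exact: ax.
by rewrite distrC; exact: xy.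
Qed.

Let close_cubes (x y : 'rV[R]_d) : cube x del y -> linked mu s (A x) (A y).
Proof.
by move=> xy; apply: near_cubes => i; rewrite (lt_trans (xy i))// ltrDl.
Qed.

(** The centres whose cube is linked to that of [x0] form an open and closed subset of [Omega],
    since cubes with close centres are linked. Finitely many cubes cover [Omega], and their union
    inherits the link. The constant depends on [h]; only the positivity of the gap for each [h] is
    drawn from it. *)
Lemma linked_connected : bounded_set Omega -> connected Omega -> Omega !=set0 ->
  linked mu s Omega Omega.
Proof.
move=> bO cO [x0 Ox0].
pose B := [set x | Omega x /\ linked mu s (A x0) (A x)].
have BS x y : B x -> Omega y -> cube x del y -> B y.
  move=> [Ox lx] Oy xy; split; first exact: Oy.
  exact: (linked_trans (mA _) (mA _) (mA _) (A0 Ox0) (A0 Ox) (A0 Oy) lx (close_cubes xy)).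
have BO : B = Omega.
  apply: cO.
  - by exists x0; split; [exact: Ox0|apply: close_cubes; exact: cube_center].
  - exists (\bigcup_(x in B) cube x del).
      by apply: bigcup_open => x _; exact: open_cube.
    apply/seteqP; split => [x Bx|y [Oy [x Bx xy]]]; last exact: BS Bx Oy xy.
    by split; [case: Bx|exists x => //; exact: cube_center].
  - exists (~` \bigcup_(x in Omega `\` B) cube x del).
      by apply: open_closedC; apply: bigcup_open => x _; exact: open_cube.
    apply/seteqP; split => [y By|y [Oy nC]].
      split; first by case: By.
      move=> [x [Ox nBx] xy]; apply: nBx; apply: BS By Ox _ => i.
      by rewrite distrC; exact: xy.
    apply: contrapT => nBy; apply: nC; exists y => //; exact: cube_center.
have AO x : A x `<=` Omega by move=> ? [].
have lA x : Omega x -> linked mu s (A x0) (A x) by rewrite -[in X in X -> _]BO => -[].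
(* Compactness is that of the closure; each of its points is within [del] of a centre taken in
   [Omega]. *)
have cc : cover_compact (closure Omega).
  by rewrite -compact_cover; exact: compact_closure_bounded.
have [| |D DO cD] := cc _ Omega (fun x => cube x del).
- by move=> x _; exact: open_cube.
- move=> y cy; have [|z [Oz yz]] := cy (cube y del).
    by apply/nbhs_cube; exists del.
  by exists z => // i; rewrite distrC; exact: yz.
have lU (l : seq 'rV[R]_d) : (forall x, x \in l -> Omega x) ->
    linked mu s (A x0) (\bigcup_(x in [set` l]) A x).
  elim: l => [_|x l IH lO].
    rewrite set_nil bigcup_set0.
    by exact: (linked_subr (mA x0) (mA x0) measurable0 (sub0set _) (lA _ Ox0)).
  have mU : measurable (\bigcup_(x in [set` l]) A x) by apply: fin_bigcup_measurable.
  have Ox : Omega x by apply: lO; rewrite mem_head.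
  rewrite bigcup_seq big_cons -bigcup_seq.
  apply: (linkedUr (mA x0) (mA x) mU (lA x Ox)).
  by apply: IH => y yl; apply: lO; rewrite in_cons yl orbT.
have A0O : linked mu s (A x0) Omega.
  have lD := lU (finmap.enum_fset D) (fun x xD => set_mem (DO x xD)).
  apply: (linked_subr (mA x0) _ mO _ lD); first by apply: fin_bigcup_measurable.
  by move=> x Ox; have [y Dy yx] := cD x (subset_closure Ox); exists y.
have O0 : (0 < mu Omega)%E.
  apply: lt_le_trans (A0 Ox0) _; apply: le_measure; rewrite ?inE//.
have lO := linked_sym (mA x0) mO A0O.
exact: (linked_trans mO (mA _) mO O0 (A0 Ox0) O0 lO A0O).
Qed.

End fixed_step.

Lemma metropolis_convergence (g del : R) (i : 'I_d) :
  bounded_set Omega -> connected Omega -> Omega !=set0 -> 0 < g < 2 -> 0 < del ->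
  (forall x r, Omega x -> 0 < r <= del ->
    ((del * r `^ (d%:R + g))%:E <= leb (cube x r `&` Omega))%E) ->
  exists C h0 : R, [/\ 0 < C, 0 < h0 <= 1 & forall (h : R) (n : nat), 0 < h <= h0 ->
    (ereal_sup [set TV_dist (metropolis_iter Omega rho h n x) (mu_rho Omega rho) |
        x in Omega]
      <= (C * h `^ (- g - d%:R / 2) *
          expR (- (n%:R * spectral_gap Omega rho h)))%:E)%E].
Proof.
move=> bO cO O0 /andP[g0 g2] del0 vO.
have [B B0 OB] := bounded_sub_cube bO.
have [u [cu uu0 u_lip]] : exists u, [/\ centered mu w u, 0 < rdot mu w u u &
    forall x y, Omega x -> Omega y -> `|u x - u y| <= `|x 0 i - y 0 i|].
  have [p Op] := O0.
  exact: (coordinate_test_function i OB Op).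
set v0 := rdot mu w u u in uu0.
have V0 : 0 < V := unit_volume_gt0.
set p := d%:R + g in vO.
(* [a0 h^g] bounds the jump probability and [c0 h^g] the form of [1 + T] from below; [b0^2 h^(-d)]
   bounds the jump density relative to [rho dx] from above. *)
pose a0 := V^-1 * (m / M) * del * N^-1 `^ p.
pose c0 := del * (4 * N)^-1 `^ p * m / (2 ^+ d * V * M).
pose b0 := Num.sqrt (V * m)^-1.
have a00 : 0 < a0 by rewrite !(mulr_gt0, divr_gt0, invr_gt0, powR_gt0).
have c00 : 0 < c0.
  by rewrite !(mulr_gt0, divr_gt0, invr_gt0, powR_gt0, exprn_gt0).
have b00 : 0 < b0 by rewrite sqrtr_gt0 invr_gt0 mulr_gt0.
(* From [G <= h^2 / (2 v0)] and [h^(2 - g) <= k] follow the three smallness conditions on [G]: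
   against [a / 2], against the bottom of [1 + T], and against 1. *)
pose k := Num.min (a0 * v0) (Num.min (c0 * v0) v0).
have k0 : 0 < k by rewrite !lt_min uu0 mulr_gt0//= mulr_gt0.
have g2' : 0 < 2 - g by rewrite subr_gt0.
pose h0 := Num.min (Num.min 1 del) (k `^ (2 - g)^-1).
have h00 : 0 < h0 by rewrite !lt_min ltr01 del0 powR_gt0.
exists (1 + 2 * b0 / a0), h0; split.
- by rewrite addr_gt0// divr_gt0// mulr_gt0.
- by rewrite h00 /h0 !ge_min lexx.
move=> h n /andP[h_gt0]; rewrite /h0 !le_min -andbA => /and3P[h1 hdel hk].
have h01 : 0 < h <= 1 by rewrite h_gt0.
have h_ge0 := ltW h_gt0.
have hg0 : 0 < h `^ g by rewrite powR_gt0.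
have hd0 : 0 < h ^+ d by rewrite exprn_gt0.
have h2E : h ^+ 2 = h `^ g * h `^ (2 - g).
  by rewrite -powRD ?(gt_eqF h_gt0) ?implybT// addrC subrK powR_mulrn.
have hk' : h `^ (2 - g) <= k.
  have -> : k = (k `^ (2 - g)^-1) `^ (2 - g).
    by rewrite -powRrM mulVf ?gt_eqF// powRr1 ?ltW.
  by apply: ge0_ler_powR; rewrite ?nnegrE ?powR_ge0 ?(ltW g2').
have [ka kc kv] : [/\ k <= a0 * v0, k <= c0 * v0 & k <= v0].
  by rewrite /k !ge_min !lexx !orbT.
have hpE : h `^ p = h ^+ d * h `^ g.
  by rewrite powRD ?(gt_eqF h_gt0) ?implybT// powR_mulrn.
have vol q x : 1 <= q -> Omega x ->
    ((del * (h / q) `^ p)%:E <= leb (cube x (h / q) `&` Omega))%E.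
  move=> q1 Ox; have q0 : 0 < q by exact: lt_le_trans q1.
  apply: vO => //; rewrite divr_gt0//= ler_pdivrMr//.
  by rewrite (le_trans hdel)// ler_peMr// ltW.
have N1 : 1 <= N by rewrite ler1n.
have N41 : 1 <= 4 * N by rewrite -natrM ler1n.
have bs := bmeas_sym_density h mO mrho m_gt0 mM rho_bounds.
have s_sym := sym_densityC Omega rho h m.
have j1 := metropolis_rjump_le1 h_gt0.
pose s := sym_density Omega rho h m; pose G := rgap mu w s.
have G0 : 0 < G.
  apply: (rgap_gt0 m_gt0 w_ge bw bs s_sym mO _ M_gt0 w_le w1 _ cu uu0).
    exact: restr_leb_setC.
  exact: (linked_connected h_gt0 bO cO O0).
have gapG : spectral_gap Omega rho h <= G.
  exact: (spectral_gap_le h_gt0 mrho m_gt0 mM rho_bounds j1 cu uu0 G0).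
have Gh : G <= h ^+ 2 / (2 * v0).
  rewrite invfM mulrA ler_pdivlMr//.
  exact: (metropolis_rgap_le h_gt0 cu u_lip).
have Gk c : k <= c * v0 -> G <= c * h `^ g / 2.
  move=> kc'; rewrite (le_trans Gh)// h2E ler_pdivrMr ?mulr_gt0//.
  rewrite [leRHS](_ : _ = h `^ g * (c * v0)); last by field.
  by rewrite ler_pM2l// (le_trans hk').
pose a := a0 * h `^ g.
have aO x : Omega x -> a <= rjump mu w s x.
  move=> Ox.
  apply: le_trans (metropolis_rjump_ge h_gt0 (vol _ _ N1 Ox)).
  rewrite powRM ?invr_ge0 ?(ltW N_gt0)// hpE /a /a0.
  move: (N^-1 `^ p) (h ^+ d) hd0 => q1 q2 q20; rewrite le_eqVlt; apply/orP; left.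
  by apply/eqP; field; rewrite !gt_eqF.
pose b := b0 * h `^ (- (d%:R / 2)).
have b_gt0 : 0 < b by rewrite mulr_gt0// powR_gt0.
have bE : h ^- d * V^-1 / m <= b ^+ 2.
  rewrite exprMn sqr_sqrtr ?invr_ge0 ?mulr_ge0 ?(ltW V0) ?(ltW m_gt0)//.
  rewrite -[(_ `^ _) ^+ 2]powR_mulrn ?powR_ge0// -powRrM mulNr mulrAC divfK//.
  rewrite powRN powR_mulrn// invfM le_eqVlt; apply/orP; left.
  by apply/eqP; ring.
have G1 : G < 1.
  rewrite (le_lt_trans (Gk 1 _))// ?mul1r//.
  rewrite ltr_pdivrMr// mul1r (@le_lt_trans _ _ 1) ?ltr1n//.
  by rewrite -(powRr0 h); apply: (ger_powR h01); exact: ltW.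
have lower f : centered mu w f -> G * rdot mu w f f <=
    rdot mu w f f + rdot mu w (rop mu w s f) f.
  move=> [bf _]; have v_ge0 : 0 <= del * (h / (4 * N)) `^ p.
    by rewrite mulr_ge0 ?powR_ge0// ltW.
  apply: le_trans (metropolis_bottom h_gt0
    B0 OB h1 v_ge0 (fun x => vol _ x N41) bf).
  apply: ler_wpM2r; first exact: rdot_ge0 m_gt0 w_ge f.
  apply: (@le_trans _ _ (c0 * h `^ g)).
    apply: (le_trans (Gk _ kc)); rewrite ler_pdivrMr// ler_peMr ?ler1n//.
    by rewrite mulr_ge0// ltW.
  rewrite powRM ?invr_ge0 ?mulr_ge0 ?(ltW N_gt0)// hpE /c0.
  have td0 : 0 < 2 ^+ d :> R by rewrite exprn_gt0.
  move: ((4 * N)^-1 `^ p) (h ^+ d) hd0 (2 ^+ d) td0 => q1 q2 q20 q3 q30.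
  by rewrite le_eqVlt; apply/orP; left; apply/eqP; field; rewrite !gt_eqF.
have a_gt0 : 0 < a by rewrite mulr_gt0.
apply: (le_trans (TV_dist_rgap h_gt0 mrho m_gt0 mM rho_bounds j1 w1 n
  a_gt0 b_gt0 bE (Gk _ ka) G1 aO lower)).
rewrite lee_fin -/s -/G ler_pM//.
- by rewrite addr_ge0// divr_ge0 ?(ltW a_gt0)// mulr_ge0// ltW.
- by rewrite exprn_ge0// subr_ge0 ltW.
(* The summand 1 is absorbed into the negative power of [h], as [h <= 1]. *)
- have -> : 2 * b / a = 2 * b0 / a0 * h `^ (- g - d%:R / 2).
    rewrite powRD ?(gt_eqF h_gt0) ?implybT// (powRN _ g) /a /b.
    by field; rewrite !gt_eqF.
  rewrite [leRHS]mulrDl mul1r lerD2r -[leLHS](powRr0 h); apply: (ger_powR h01).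
  by rewrite -opprD oppr_le0 addr_ge0 ?divr_ge0// ltW.
(* [1 - G <= exp(-G)], and then [g(h) <= G] replaces [G] by the spectral gap. *)
apply: (@le_trans _ _ (expR (- G) ^+ n)).
  by apply: lerXn2r; rewrite ?nnegrE ?expR_ge0 ?subr_ge0 ?(ltW G1)// expR_ge1Dx.
by rewrite -expRM_natl ler_expR mulrN lerN2 ler_wpM2l.
Qed.

End metropolis_estimates.

Theorem theorem1p4 (R : realType) (d : nat) (Omega : set 'rV[R]_d)
    (I : finType) (Ir Ic : {set I}) (omega S : I -> set 'rV[R]_d)
    (d' d'' : I -> nat) (alpha r eps : I -> R) (gamma : R)
    (rho : 'rV[R]_d -> R) (m M : R)
    (Omega_bounded : bounded_set Omega)
    (Omega_connected : connected Omega)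
    (Omega_open : open Omega)
    (Omega_boundary : assumption1 Omega Ir Ic omega S d' d'' alpha r eps)
    (* every term is positive, so 0 is only the maximum of the empty family *)
    (gammaE : gamma = \big[Num.max/0]_(i in Ic) ((alpha i - 1) * (d' i)%:R))
    (gamma_bounds : 0 < gamma < 2)
    (rho_measurable : measurable_fun (closure Omega) rho)
    (m_gt0 : 0 < m) (M_gt0 : 0 < M)
    (rho_bounds : forall x, Omega x -> m <= rho x <= M)
    (rho_int : \int[lebesgue_rV d]_(x in Omega) rho x = 1) :
  exists (C h0 : R) (err : R -> nat -> R),
    [/\ 0 < C, 0 < h0 <= 1 &
      forall (h : R) (n : nat), 0 < h <= h0 ->
        `|err h n| <= C * h `^ (2 - gamma) /\
        (ereal_sup [set TV_dist (metropolis_iter Omega rho h n x)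
                                (mu_rho Omega rho) | x in Omega]
         <= (C * h `^ (- gamma - d%:R / 2) *
             expR (- (n%:R * spectral_gap Omega rho h * (1 + err h n))))%:E)%E].
Proof.
have /andP[gamma_gt0 gamma_lt2] := gamma_bounds.
have le_gamma i : i \in Ic -> (alpha i - 1) * (d' i)%:R <= gamma.
  by move=> Ii; rewrite gammaE; exact: (le_bigmax_cond _ (fun i => (alpha i - 1) * (d' i)%:R)).
(* The empty maximum is 0, so [gamma > 0] produces a cusp, hence a positive dimension and a
   coordinate to test with. *)
have [i0 Ii0] : exists i, i \in Ic.
  have [E|[i Ii]] := set_0Vmem Ic; last by exists i.
  by move: gamma_gt0; rewrite gammaE E big_set0 ltxx.
have d_gt0 : (0 < d)%N.
  have [_ _ _ /(_ _ Ii0)[dE _ _ _ _]] := Omega_boundary.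
  exact: (eq_ind_r (fun n => 0 < n)%N _ dE).
have vO := assumption1_volume Omega_open Omega_boundary (ltW gamma_gt0) le_gamma.
have [del del0 volO] := volume_lower_bound Omega_bounded vO.
have mO : measurable Omega by exact: open_rV_measurable.
have Ooo : (lebesgue_rV d Omega < +oo)%E.
  have [B B0 OB] := bounded_sub_cube Omega_bounded.
  apply: (@le_lt_trans _ _ (lebesgue_rV d (cube 0 B))).
    by apply: le_measure; rewrite ?inE//; exact: measurable_cube.
  by rewrite leb_cube ?ltry// ltW.
have mrho : measurable_fun Omega rho.
  apply: (measurable_funS _ (@subset_closure _ Omega) rho_measurable).
  rewrite -[X in measurable X]setCK; apply: measurableC.
  by apply: open_rV_measurable; apply: closed_openC; exact: closed_closure.
have [x0 Ox0] : Omega !=set0.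
  apply/set0P/eqP => O0; move: rho_int; rewrite O0 Rintegral_set0 => /esym/eqP.
  by rewrite oner_eq0.
have mM : m <= M by have /andP[mr] := rho_bounds x0 Ox0; exact: le_trans.
have w1 : \int[restr_leb mO Ooo]_x weight Omega rho m x = 1.
  rewrite -(Rintegral_restr mO Ooo (f := rho)) //; last first.
    by move=> x Ox; rewrite weightE.
  exact: bmeas_weight mO mrho m_gt0 mM rho_bounds.
have [C [h0 [C0 h00 H]]] := metropolis_convergence Omega_open mrho m_gt0 mM rho_bounds
  w1 (Ordinal d_gt0) Omega_bounded Omega_connected (ex_intro _ x0 Ox0)
  gamma_bounds del0 volO.
(* The bound already holds with the exact rate, so the error term is 0. *)
exists C, h0, (fun=> fun=> 0); split => // h n hh0; split.
  by rewrite normr0 mulr_ge0 ?powR_ge0// ltW.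
by rewrite addr0 mulr1; exact: H.
Qed.
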